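(* Let $r=r_n\ge 3$ be integers, $\mathbf{w}=\mathbf{w}_n\in\mathbb{S}^{n-1}$ an arbitrary sequence of deterministic unit vectors, $\mathcal{G}\sim\mathsf{GOTE}(r,n)$, and $M_n=\mathcal{G}\cdot\mathbf{w}^{\otimes(r-2)}$, with $\lambda_1(M_n)$ and $\lambda_n(M_n)$ its largest and smallest eigenvalues. The following hold as $n\to\infty$. (a) If $r\ge 3$ is fixed, then $$\Big(\frac{\lambda_1(M_n)}{\sqrt n},\frac{\lambda_n(M_n)}{\sqrt n}\Big)\xrightarrow{p}(\varpi_r,-\varpi_r),\qquad \varpi_r:=\frac{1}{\sqrt{r-1}}\Big(\sqrt{r-2}+\frac{1}{\sqrt{r-2}}\Big).$$ (b) If $1\ll r\ll n$, then $$\Big(\frac{\lambda_1(M_n)}{\sqrt n},\frac{\lambda_n(M_n)}{\sqrt n}\Big)\xrightarrow{p}(1,-1).$$ (c) If $\frac rn\to c\in(0,\infty)$, then $$\Big(\frac{\lambda_1(M_n)}{\sqrt n},\frac{\lambda_n(M_n)}{\sqrt n}\Big)\xrightarrow{d}\Big(\xi,-\frac1\xi\Big),$$ where $\xi=\frac{\sqrt c\,\zeta+\sqrt{c\zeta^2+4}}{2}$ with $\zeta\sim\mathcal{N}(0,1)$. (d) If $\frac rn\to\infty$, then $$\Big(\frac{\lambda_1(M_n)}{\sqrt r},\frac{\lambda_n(M_n)}{\sqrt r}\Big)\xrightarrow{d}(\zeta_+,-\zeta_-),$$ where $\zeta\sim\mathcal{N}(0,1)$, $x_+=\max\{x,0\}$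 and $x_-=\max\{-x,0\}$.
   Context: A symmetric tensor of order $r$ and dimension $n$ is an array $(\mathcal{T}_{i_1,\dots,i_r})_{(i_1,\dots,i_r)\in[n]^r}$ of reals invariant under permutations of its indices. $\mathcal{G}\sim\mathsf{GOTE}(r,n)$ (Gaussian Orthogonal Tensor Ensemble) means that $\mathcal{G}$ is a random symmetric tensor of order $r$ and dimension $n$ with density proportional to $\exp\big(-\frac{1}{2r}\|\mathcal{G}\|_F^2\big)$ with respect to Lebesgue measure on the space of symmetric tensors, where $\|\mathcal{G}\|_F^2=\sum_{(i_1,\dots,i_r)\in[n]^r}\mathcal{G}_{i_1\cdots i_r}^2$. Equivalently, the entries indexed by distinct multisets $\{i_1,\dots,i_r\}$ are independent, with $\mathcal{G}_{i_1\cdots i_r}\sim\mathcal{N}(0,r/\#\mathrm{Perm}(i_1,\dots,i_r))$, where $\#\mathrm{Perm}(i_1,\dots,i_r)$ is the number of distinct rearrangements of $(i_1,\dots,i_r)$. $\mathbb{S}^{n-1}$ is the unit sphere of $\mathbb{R}^n$. The contraction $\mathcal{G}\cdot\mathbf{w}^{\otimes(r-2)}$ is the $n\times n$ symmetric matrix with $(i,j)$ entry $\sum_{i_3,\dots,i_r}\mathcal{G}_{iji_3\cdots i_r}w_{i_3}\cdots w_{i_r}$. $f(n)\ll g(n)$ means $f(n)/g(n)\to0$; $\xrightarrow{p}$ and $\xrightarrow{d}$ denote convergence in probability and in distribution. *)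

(* Defs.v *)
From mathcomp Require Import all_boot all_order all_algebra.
From mathcomp Require Import all_classical all_reals all_analysis.

Set Implicit Arguments.
Unset Strict Implicit.
Unset Printing Implicit Defensive.
Import Order.TTheory GRing.Theory Num.Theory.
Import numFieldNormedType.Exports.

Local Open Scope classical_set_scope.
Local Open Scope ring_scope.

(* [v] is the variance; [normal_prob] takes the standard deviation.  The two
   laws are only compared on measurable sets, since the values of a measure on
   other sets are irrelevant. *)
Definition has_normal_law (R : realType) (d : measure_display)
    (T : measurableType d) (P : probability T R) (X : {RV P >-> R}) (m v : R) :=
  forall A : set R, measurable A ->
    distribution P X A = normal_prob m (Num.sqrt v) A.

(* A tensor of order [r] and dimension [n] is a function on multi-indices
   [r.-tuple 'I_n]; two multi-indices represent the same multiset iff they are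
   related by [perm_eq]. *)
Definition num_perm (r n : nat) (k : r.-tuple 'I_n) : nat :=
  #|[pred l : r.-tuple 'I_n | perm_eq l k]|.

Definition symmetric_tensor (R : realType) (r n : nat)
    (A : r.-tuple 'I_n -> R) :=
  forall k l : r.-tuple 'I_n, perm_eq k l -> A k = A l.

(* Mutual independence of the entries at distinct multisets: the product rule
   over every finite family [J] of multi-indices, no two of which represent the
   same multiset. *)
Definition independent_entries (R : realType) (d : measure_display)
    (T : measurableType d) (P : probability T R) (r n : nat)
    (G : r.-tuple 'I_n -> {RV P >-> R}) :=
  forall J : {set r.-tuple 'I_n},
    (forall k l, k \in J -> l \in J -> perm_eq k l -> k = l) ->
  forall B : r.-tuple 'I_n -> set R, (forall k, measurable (B k)) ->
    P [set t | forall k, k \in J -> B k (G k t)] =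
    (\prod_(k in J) P (G k @^-1` B k))%E.

Definition GOTE (R : realType) (d : measure_display) (T : measurableType d)
    (P : probability T R) (r n : nat) (G : r.-tuple 'I_n -> {RV P >-> R}) :=
  [/\ forall t, symmetric_tensor (fun k => G k t),
      forall k, has_normal_law (G k) 0 (r%:R / (num_perm k)%:R)
    & independent_entries G].

(* The sum runs over the multi-indices [i :: j :: i_3 :: ... :: i_r]; this is
   the contraction of [A] with the tensor power [r - 2] of [w] when [2 <= r]. *)
Definition tensor_contraction (R : realType) (r n : nat) (A : r.-tuple 'I_n -> R)
    (w : 'rV[R]_n) : 'M[R]_n :=
  \matrix_(i, j) \sum_(k : r.-tuple 'I_n | take 2 k == [:: i; j])
    A k * \prod_(l <- drop 2 k) w ord0 l.

(* Over the reals a nonempty square symmetric matrix has a finite nonempty set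
   of eigenvalues, so this supremum and this infimum are attained. *)
Definition lambda_max (R : realType) (n : nat) (M : 'M[R]_n) : R :=
  sup [set a : R | eigenvalue M a].

Definition lambda_min (R : realType) (n : nat) (M : 'M[R]_n) : R :=
  inf [set a : R | eigenvalue M a].

Definition much_less (R : realType) (f g : nat -> R) :=
  f n / g n @[n --> \oo] --> (0 : R).

(* The probability space may change with [n]. *)
Definition cvg_in_probability (R : realType) (d : nat -> measure_display)
    (T : forall n, measurableType (d n)) (P : forall n, probability (T n) R)
    (X : forall n, T n -> R * R) (c : R * R) :=
  (forall n, measurable_fun [set: T n] (X n)) /\
  forall eps : R, 0 < eps ->
    P n [set t | eps <= `|X n t - c|] @[n --> \oo] --> 0%E.

Definition cvg_in_distribution (R : realType) (d : nat -> measure_display)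
    (T : forall n, measurableType (d n)) (P : forall n, probability (T n) R)
    (X : forall n, T n -> R * R)
    (d' : measure_display) (T' : measurableType d') (Q : probability T' R)
    (Y : T' -> R * R) :=
  [/\ forall n, measurable_fun [set: T n] (X n),
      measurable_fun [set: T'] Y
    & forall f : R * R -> R, continuous f ->
        (exists C : R, forall x, `|f x| <= C) ->
        ('E_(P n)[f \o X n] @[n --> \oo] --> 'E_Q[f \o Y])%E].

Definition varpi (R : realType) (r : nat) : R :=
  (Num.sqrt (r%:R - 1))^-1 *
  (Num.sqrt (r%:R - 2) + (Num.sqrt (r%:R - 2))^-1).

Definition xi (R : realType) (c z : R) : R :=
  (Num.sqrt c * z + Num.sqrt (c * z ^+ 2 + 4)) / 2.

(* The pair of extreme eigenvalues of [M], divided by [s]. *)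
Definition extreme_eigenvalues (R : realType) (n : nat) (s : R)
    (M : 'M[R]_n) : R * R :=
  (lambda_max M / s, lambda_min M / s).

(* Main.v *)
From HB Require Import structures.
Require Import Defs.
From mathcomp Require Import all_boot all_order all_algebra.
From mathcomp Require Import all_classical all_reals all_analysis.
From mathcomp Require Import measurable_realfun.
From mathcomp Require Import fingroup perm.
From mathcomp Require Import ring lra.
Set Implicit Arguments.
Unset Strict Implicit.
Unset Printing Implicit Defensive.
Import Order.TTheory GRing.Theory Num.Theory.
Import numFieldNormedType.Exports.
Local Open Scope classical_set_scope.
Local Open Scope ring_scope.

(** Let [M] be the contraction and split it along the unit vector [w] into a
    corner, a border and a block. The covariance of its quadratic form can be
    computed ([entry_cov]): up to an isometry, the corner is [N(0, r)], the
    border is a standard Gaussian vector and the block is an independent GOE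
    matrix of scale [(r - 1)^(-1/2)] ([contraction_law]). This rests on the
    fact that a centred Gaussian vector is determined by its covariance
    ([gaussian_law_gram]), which is proved from the rotation invariance of the
    Gaussian law of the plane.

    For a fixed order all edges are found by elimination. The largest
    eigenvalue exceeds [lam] if and only if the elimination of one direction
    after the other meets a nonpositive pivot, and a GOE matrix reproduces
    itself under elimination of a direction ([goe_arrow_law]): with [lam]
    written in units of [sqrt n], the pivots follow [y' = lam - sg^2 / y] up to
    small errors, where [sg^2 = 1 / (r - 1)], except in the direction [w],
    eliminated last, where the heavier border requires [y >= 1 / lam]. The threshold is the
    value [om] of [lam] for which [1 / om] is a fixed point of the recursion,
    and this is [varpi r] ([varpi_fixpoint]). Above it, constant pivots survive
    all [n] eliminations ([goe_upper]); below it, boundedly many eliminations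
    suffice for a failure ([pivot_descent], [goe_lower]). The exceptional
    events are deviations of Gaussian variables and of chi-square variables,
    which are exponentially small, so that a union bound over [n] steps is
    harmless ([fixed_order_upper], [fixed_order_lower]).

    When the order diverges, the norm of the block is at most a small multiple
    of [sqrt n], by the same elimination argument, and the length of the border
    is close to [sqrt n]. Hence the extreme eigenvalues are close to those of
    the two by two matrix with corner [sqrt r z] and off-diagonal entry
    [sqrt n], where [z] is standard normal for every [n] ([extreme_tail],
    [corner_law]). Its eigenvalues are explicit, and after division by the
    normalization they converge to the announced functions of [z], in
    probability and uniformly for bounded [z] ([levels_approx]). Convergence in
    distribution follows because the law of [z] does not depend on [n]
    ([cvg_distribution_approx]).

    The smallest eigenvalue needs no separate treatment, since [- M] and [M]
    have the same law. *)

(** * Rotation invariance of the Gaussian law of the plane *)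

Notation pushm mu mf :=
  (measure_function_pushforward__canonical__measure_function_Measure mu mf).

Section one_dim.
Context {R : realType}.
Local Notation mu := (@lebesgue_measure R).
Implicit Types (f : R -> \bar R) (A : set R).

Lemma lebesgue_measure_translation (a : R) (A : set R) : measurable A ->
  pushforward mu (fun x : R => x + a : measurableTypeR R) A = mu A.
Proof.
move=> mA.
have ma : measurable_fun [set: measurableTypeR R]
    (fun x : measurableTypeR R => (x + a : measurableTypeR R)).
  exact: measurable_funD.
pose m : {measure set (measurableTypeR R) -> \bar R} := pushm mu ma.
symmetry; apply: (@lebesgue_measure_unique _ m) => //= _ [[b c]] _ <-.
rewrite /m /= /pushforward /=.
rewrite (_ : _ @^-1` _ = `](b - a), (c - a)]%classic).
  rewrite !lebesgue_measure_itv/= !lte_fin ltrD2r; case: ifP => // _.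
  by rewrite -!EFinB; congr EFin; ring.
by apply/seteqP; split => x /=; rewrite !in_itv/= ltrBlDr lerBrDr.
Qed.

Lemma ge0_integral_translation f (a : R) :
  measurable_fun setT f -> (forall x, (0 <= f x)%E) ->
  (\int[mu]_x f ((x : R) + a)%R = \int[mu]_x f x)%E.
Proof.
move=> mf f0.
have ma : measurable_fun [set: measurableTypeR R]
    (fun x : measurableTypeR R => (x + a : measurableTypeR R)).
  exact: measurable_funD.
rewrite -(@ge0_integral_pushforward _ _ _ (measurableTypeR R) R _ ma mu setT f)//.
by apply: eq_measure_integral => //= A mA AS; exact: lebesgue_measure_translation.
Qed.

(** The normal law is absolutely continuous with density [normal_pdf], so the
    change of variables of Radon-Nikodym applies once the derivative is
    identified almost everywhere with [normal_pdf]. *)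
Lemma ge0_integral_normal_prob (m s : R) f :
  measurable_fun setT f -> (forall x, (0 <= f x)%E) ->
  (\int[normal_prob m s]_x f x = \int[mu]_x (f x * (normal_pdf m s x)%:E))%E.
Proof.
move=> mf f0.
have dom := @normal_prob_dominates R m s.
rewrite -(Radon_Nikodym_SigmaFinite.change_of_variables dom)//.
apply: ae_eq_integral => //.
- apply: emeasurable_funM => //.
  by apply: (measurable_int mu); exact: Radon_Nikodym_SigmaFinite.f_integrable.
- apply: emeasurable_funM => //; apply/measurable_EFinP.
  exact: measurable_normal_pdf.
- apply: ae_eqe_mul2l; apply: integral_ae_eq => //=.
  + exact: Radon_Nikodym_SigmaFinite.f_integrable.
  + by apply/measurable_EFinP; exact: measurable_normal_pdf.
  + by move=> E _ mE; rewrite -(Radon_Nikodym_SigmaFinite.f_integral dom).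
Qed.

End one_dim.

Section plane.
Context {R : realType}.
Local Notation mu := (@lebesgue_measure R).
Local Notation gam := (normal_prob (0 : R) 1).
Implicit Types (f : R * R -> \bar R).

Let tonelli1 := @fubini_tonelli1 _ _ (measurableTypeR R) (measurableTypeR R) R
  mu mu.
Let tonelli2 := @fubini_tonelli2 _ _ (measurableTypeR R) (measurableTypeR R) R
  mu mu.

Let shear1 (t : R) (p : R * R) := (p.1 + t * p.2, p.2).
Let shear2 (t : R) (p : R * R) := (p.1, p.2 + t * p.1).

(** Shears preserve area: by Tonelli, each horizontal line is merely
    translated. *)
Lemma ge0_integral_shear1 f (t : R) :
  measurable_fun setT f -> (forall x, (0 <= f x)%E) ->
  (\int[mu \x mu]_p f (shear1 t p) = \int[mu \x mu]_p f p)%E.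
Proof.
move=> mf f0.
rewrite tonelli2//; last first.
  apply: (measurableT_comp mf) => /=.
  apply/measurable_fun_pairP; split; last exact: measurable_snd.
  by apply: measurable_funD => //; apply: measurable_funM.
rewrite tonelli2//; apply: eq_integral => y _; rewrite /fubini_G /=.
apply: (@ge0_integral_translation _ (fun x => f (x, y)) (t * y)) => //.
exact: measurableT_comp.
Qed.

Lemma ge0_integral_shear2 f (t : R) :
  measurable_fun setT f -> (forall x, (0 <= f x)%E) ->
  (\int[mu \x mu]_p f (shear2 t p) = \int[mu \x mu]_p f p)%E.
Proof.
move=> mf f0.
rewrite tonelli1//; last first.
  apply: (measurableT_comp mf) => /=.
  apply/measurable_fun_pairP; split; first exact: measurable_fst.
  by apply: measurable_funD => //; apply: measurable_funM.
rewrite tonelli1//; apply: eq_integral => y _; rewrite /fubini_F /=.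
apply: (@ge0_integral_translation _ (fun x => f (y, x)) (t * y)) => //.
exact: measurableT_comp.
Qed.

Definition normal_pdf2 (p : R * R) : R := normal_pdf 0 1 p.1 * normal_pdf 0 1 p.2.

Lemma normal_pdf2_rot (p q : R * R) :
  p.1 ^+ 2 + p.2 ^+ 2 = q.1 ^+ 2 + q.2 ^+ 2 -> normal_pdf2 p = normal_pdf2 q.
Proof.
move=> h; rewrite /normal_pdf2 !normal_pdfE ?oner_neq0//.
rewrite mulrACA [RHS]mulrACA; congr (_ * _).
rewrite /normal_fun -expRD -[in RHS]expRD; congr expR.
by rewrite !subr0 -mulrDl -[RHS]mulrDl -opprD h opprD.
Qed.

Lemma measurable_normal_pdf2 : measurable_fun setT normal_pdf2.
Proof.
apply: measurable_funM => //=; apply: measurableT_comp => //;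
exact: measurable_normal_pdf.
Qed.

Lemma normal_prob2_density (S : set (R * R)) : measurable S ->
  ((gam \x gam) S = \int[mu \x mu]_p ((normal_pdf2 p)%:E * (\1_S p)%:E))%E.
Proof.
move=> mS; rewrite tonelli1//; last 2 first.
- apply: emeasurable_funM; apply/measurable_EFinP.
    exact: measurable_normal_pdf2.
  exact: measurable_indic.
- by move=> p; rewrite mule_ge0// lee_fin// mulr_ge0 ?normal_pdf_ge0.
rewrite /product_measure1 ge0_integral_normal_prob//; last first.
  exact: measurable_fun_xsection.
apply: eq_integral => x _; rewrite /fubini_F /= /normal_pdf2/=.
under eq_integral do rewrite EFinM -muleA.
rewrite ge0_integralZl//; last 3 first.
- apply: emeasurable_funM; apply/measurable_EFinP.
    exact: measurable_normal_pdf.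
  by apply: measurableT_comp => //; exact: measurable_indic.
- by move=> y _; rewrite mule_ge0 ?lee_fin ?normal_pdf_ge0.
- by rewrite lee_fin normal_pdf_ge0.
rewrite muleC; congr (_ * _)%E.
rewrite [LHS]integral_mkcond; apply: eq_integral => y _.
rewrite patchE /= indicE mem_xsection.
by case: ifP => _; rewrite ?mule1 ?mule0.
Qed.

(** The density only depends on the norm, and Lebesgue measure is rotation
    invariant because a rotation is a product of three shears; this
    factorization breaks down only for the half turn, which [c != -1] excludes.
    *)
Lemma normal_prob2_rot (c s : R) (S : set (R * R)) :
  c ^+ 2 + s ^+ 2 = 1 -> c != -1 -> measurable S ->
  (gam \x gam)%E [set p | S (c * p.1 - s * p.2, s * p.1 + c * p.2)] =
  (gam \x gam)%E S.
Proof.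
move=> cs c1 mS.
have c10 : 1 + c != 0 by rewrite addrC -subr_eq0 opprK in c1 *.
have mrot : measurable_fun setT
    (fun p : R * R => (c * p.1 - s * p.2, s * p.1 + c * p.2)).
  apply/measurable_fun_pairP; split => /=.
    by apply: measurable_funB; exact: measurable_funM.
  by apply: measurable_funD; exact: measurable_funM.
rewrite !normal_prob2_density//; last by rewrite -[X in measurable X]setTI; exact: mrot.
(* t is the tangent of half the angle; the shears have parameters -t, s, -t *)
set t := s / (1 + c).
pose f (p : R * R) := ((normal_pdf2 p)%:E * (\1_S p)%:E)%E.
have mf : measurable_fun setT f.
  apply: emeasurable_funM; apply/measurable_EFinP.
    exact: measurable_normal_pdf2.
  exact: measurable_indic.
have f0 p : (0 <= f p)%E.
  by rewrite mule_ge0// lee_fin// mulr_ge0 ?normal_pdf_ge0.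
pose f1 (p : R * R) := f (shear1 (- t) p).
pose f2 (p : R * R) := f1 (shear2 s p).
have mf1 : measurable_fun setT f1.
  apply: (measurableT_comp mf) => /=.
  apply/measurable_fun_pairP; split; last exact: measurable_snd.
  by apply: measurable_funD => //; apply: measurable_funM.
have mf2 : measurable_fun setT f2.
  apply: (measurableT_comp mf1) => /=.
  apply/measurable_fun_pairP; split; first exact: measurable_fst.
  by apply: measurable_funD => //; apply: measurable_funM.
rewrite -(ge0_integral_shear1 (- t) mf f0).
rewrite -(@ge0_integral_shear2 f1 s mf1)//; last by move=> ?; exact: f0.
rewrite -(@ge0_integral_shear1 f2 (- t) mf2)//; last by move=> ?; exact: f0.
apply: eq_integral => p _.
have E2 : p.2 + s * (p.1 + - t * p.2) = s * p.1 + c * p.2.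
  have -> : c = 1 - s * t; last by ring.
  have -> : s * t = s ^+ 2 / (1 + c) by rewrite /t; ring.
  have -> : s ^+ 2 = (1 - c) * (1 + c) by rewrite (_ : s ^+ 2 = 1 - c ^+ 2); [ring | rewrite -cs; ring].
  by rewrite mulfK//; ring.
have E1 : p.1 + - t * p.2 + - t * (p.2 + s * (p.1 + - t * p.2)) = c * p.1 - s * p.2.
  rewrite E2.
  have hs : s = t * (1 + c) by rewrite /t divfK.
  have hst : s * t = 1 - c.
    have -> : s * t = s ^+ 2 / (1 + c) by rewrite /t; ring.
    have -> : s ^+ 2 = (1 - c) * (1 + c) by rewrite (_ : s ^+ 2 = 1 - c ^+ 2); [ring | rewrite -cs; ring].
    by rewrite mulfK.
  have -> : p.1 + - t * p.2 + - t * (s * p.1 + c * p.2) =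
     (1 - s * t) * p.1 - (t * (1 + c)) * p.2 by ring.
  by rewrite hst -hs; ring.
rewrite /f2 /f1 /f /shear1 /shear2 /= E1 E2 !indicE.
have -> : (p \in [set p0 | S (c * p0.1 - s * p0.2, s * p0.1 + c * p0.2)]) =
    ((c * p.1 - s * p.2, s * p.1 + c * p.2) \in S).
  by apply/idP/idP => /set_mem ?; apply/mem_set.
congr (_ * _)%E; congr EFin; apply: normal_pdf2_rot => /=.
by rewrite -[LHS]mul1r -cs; ring.
Qed.

End plane.

(** * Scaling of Gaussian laws and the exponential moment of a square *)

Section scaling.
Context {R : realType}.
Local Notation mu := (@lebesgue_measure R).
Local Notation gam := (normal_prob (0 : R) 1).

Lemma lebesgue_measure_scaling (k : R) (A : set R) : 0 < k -> measurable A ->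
  (k%:E * pushforward mu (fun x : R => (k * x)%R : measurableTypeR R) A = mu A)%E.
Proof.
move=> k0 mA.
have mk : measurable_fun [set: measurableTypeR R]
    (fun x : measurableTypeR R => (k * x : measurableTypeR R)).
  exact: measurable_funM.
pose m : {measure set (measurableTypeR R) -> \bar R} :=
  mscale (NngNum (ltW k0)) (pushm mu mk).
symmetry; apply: (@lebesgue_measure_unique _ m) => //= _ [[b c]] _ <-.
rewrite /m /= /mscale /= /pushforward /=.
rewrite (_ : _ @^-1` _ = `](b / k), (c / k)]%classic).
  rewrite !lebesgue_measure_itv/= !lte_fin ltr_pM2r ?invr_gt0//.
  case: ifP => // _; last by rewrite mule0.
  by rewrite -!EFinB -EFinM; congr EFin; rewrite -mulrBl mulrC divfK// gt_eqF.
by apply/seteqP; split => x /=; rewrite !in_itv/= ltr_pdivrMr// ler_pdivlMr// mulrC.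
Qed.

Lemma ge0_integral_scaling (f : R -> \bar R) (k : R) : 0 < k ->
  measurable_fun setT f -> (forall x, (0 <= f x)%E) ->
  (\int[mu]_x (k%:E * f (k * (x : R))%R) = \int[mu]_x f x)%E.
Proof.
move=> k0 mf f0.
have mk : measurable_fun [set: measurableTypeR R]
    (fun x : measurableTypeR R => (k * x : measurableTypeR R)).
  exact: measurable_funM.
have mfk : measurable_fun setT (fun x : measurableTypeR R => f (k * (x : R))).
  exact: (measurableT_comp mf mk).
rewrite ge0_integralZl//; last by rewrite lee_fin ltW.
rewrite -(@ge0_integral_pushforward _ _ _ (measurableTypeR R) R _ mk mu setT f)//.
rewrite -(@ge0_integral_mscale _ _ _ (pushm mu mk) setT measurableT (NngNum (ltW k0)))//.
apply: eq_measure_integral => //= A mA AS.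
exact: lebesgue_measure_scaling.
Qed.

Lemma normal_pdf_scale (s x : R) : 0 < s ->
  s * normal_pdf 0 s (s * x) = normal_pdf 0 1 x.
Proof.
move=> s0; have sN0 : s != 0 by rewrite gt_eqF.
rewrite !normal_pdfE ?oner_neq0// /normal_peak /normal_fun !subr0 mulrA.
congr (_ * expR _).
  rewrite expr1n mul1r -mulrnAr sqrtrM ?sqr_ge0// sqrtr_sqr gtr0_norm//.
  by rewrite invfM mulrA mulfV// mul1r.
rewrite !mulNr; congr (- _); rewrite expr1n -mulr_natr exprMn -[in RHS]mulr_natr mul1r.
by rewrite invfM mulrACA mulfV ?mul1r// expf_neq0.
Qed.

Lemma normal_prob_scale (s : R) (B : set R) : 0 < s -> measurable B ->
  normal_prob 0 s [set x | B (x / s)] = gam B.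
Proof.
move=> s0 mB; rewrite /normal_prob.
have mB' : measurable [set x : R | B (x / s)].
  rewrite -[X in measurable X]setTI.
  by apply: (measurable_funM (f := id) (g := cst s^-1)).
rewrite integral_mkcond [RHS]integral_mkcond.
rewrite -(@ge0_integral_scaling _ s)//; last 2 first.
- apply/(measurable_restrictT _ _).1 => //; apply/measurable_funTS.
  by apply/measurable_EFinP; exact: measurable_normal_pdf.
- by move=> x; rewrite patchE; case: ifP => // _; rewrite lee_fin normal_pdf_ge0.
apply: eq_integral => x _; rewrite !patchE.
have -> : (s * x \in [set x0 | B (x0 / s)]) = (x \in B).
  have E : s * x / s = x by rewrite mulrC mulKf// gt_eqF.
  by apply/idP/idP => /set_mem /= h; apply/mem_set => /=; rewrite E in h *.
by case: ifP => _; rewrite ?mule0// -EFinM normal_pdf_scale.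
Qed.

Lemma normal_prob_opp (B : set R) : measurable B ->
  gam [set x | B (- x)] = gam B.
Proof.
move=> mB; rewrite /normal_prob.
rewrite integral_mkcond [RHS]integral_mkcond.
pose f : R -> \bar R := (fun x => (normal_pdf 0 1 x)%:E) \_ B.
have mf : measurable_fun [set: measurableTypeR R] f.
  apply/(measurable_restrictT _ _).1 => //; apply/measurable_funTS.
  by apply/measurable_EFinP; exact: measurable_normal_pdf.
have mk : measurable_fun [set: measurableTypeR R]
    (fun x : measurableTypeR R => (- x : measurableTypeR R)).
  exact: oppr_measurable.
transitivity (\int[pushforward mu (fun x : measurableTypeR R => (- x)%R : measurableTypeR R)]_x f x)%E.
  rewrite (@ge0_integral_pushforward _ _ _ (measurableTypeR R) R _ mk mu setT f)//.
    apply: eq_integral => x _; rewrite /f /= !patchE.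
    have -> : (- (x : R) \in B) = (x \in [set x | B (- x)]).
      by apply/idP/idP => /set_mem ?; apply/mem_set.
    case: ifP => // _; congr EFin; rewrite !normal_pdfE ?oner_neq0//.
    by rewrite /normal_fun !subr0 sqrrN.
  move=> x _; rewrite /f patchE; case: ifP => // _; rewrite lee_fin normal_pdf_ge0//.
apply: eq_measure_integral => //= A mA _.
exact: lebesgue_measureN.
Qed.

(** The integrand times the density is a normal density of standard deviation
    [(1 - 2 t)^(-1/2)], up to the constant on the right. *)
Lemma integral_expR_sq (t : R) : t < 1 / 2 ->
  (\int[gam]_x (expR (t * x ^+ 2))%:E = ((Num.sqrt (1 - 2 * t))^-1)%:E)%E.
Proof.
move=> t2; have h0 : 0 < 1 - 2 * t by lra.
have k0 : 0 < Num.sqrt (1 - 2 * t) by rewrite sqrtr_gt0.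
set k := Num.sqrt _ in k0 *.
have me : measurable_fun setT (fun x : R => (expR (t * x ^+ 2))%:E).
  apply/measurable_EFinP/measurableT_comp => //.
  by apply: measurable_funM => //; exact: measurable_funX.
rewrite ge0_integral_normal_prob//.
rewrite -[RHS]mule1 -(integral_normal_pdf 0 k^-1).
rewrite -ge0_integralZl//; last 3 first.
- by apply/measurable_EFinP; exact: measurable_normal_pdf.
- by move=> x _; rewrite lee_fin normal_pdf_ge0.
- by rewrite lee_fin invr_ge0 ltW.
apply: eq_integral => x _; rewrite -!EFinM; congr EFin.
rewrite !normal_pdfE ?oner_neq0 ?invr_neq0 ?gt_eqF//.
rewrite /normal_fun !subr0 /normal_peak.
rewrite mulrCA -expRD [RHS]mulrA; congr (_ * expR _).
  rewrite expr1n mul1r -mulrnAr sqrtrM ?sqr_ge0// sqrtr_sqr.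
  by rewrite ger0_norm ?invr_ge0 ?ltW// invfM invrK mulrA mulVf ?mul1r// gt_eqF.
rewrite exprVn /k sqr_sqrtr ?ltW// -[_^-1 *+ 2]mulr_natr invfM invrK expr1n -[1 *+ 2]/2.
by field.
Qed.

End scaling.

(** * Standard Gaussian families and their isometries *)

Section product_probability.
Context {R : realType} d1 d2 (T1 : measurableType d1) (T2 : measurableType d2).
Variables (P : probability T1 R) (Q : probability T2 R).

Let prod_setT : (P \x Q)%E setT = 1%E.
Proof.
rewrite -setXTT product_measure1E//.
by rewrite -[RHS]mule1; congr (_ * _)%E; exact: probability_setT.
Qed.

HB.instance Definition _ :=
  @Measure_isProbability.Build _ _ _ (P \x Q)%E prod_setT.

Definition prodP : probability (T1 * T2)%type R := (P \x Q)%E.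

Lemma prodPX (A : set T1) (B : set T2) : measurable A -> measurable B ->
  prodP (A `*` B) = (P A * Q B)%E.
Proof. exact: product_measure1E. Qed.

End product_probability.

Section vectors.
Context {R : realType}.
Implicit Types (I J : finType).

(** A pi-system: two laws on [I -> R] that agree on boxes agree on the
    sigma-algebra that they generate. *)
Definition boxes I : set_system (I -> R) :=
  [set A | exists B : I -> set R,
     (forall i, measurable (B i)) /\ A = [set f | forall i, B i (f i)]].

Arguments boxes : clear implicits.

Definition vecT I := g_sigma_algebraType (boxes I).

Lemma boxes_setI I : setI_closed (boxes I).
Proof.
move=> _ _ [B [mB ->]] [C [mC ->]]; exists (fun i => B i `&` C i); split.
  by move=> i; exact: measurableI.
apply/seteqP; split => f /= => [[h1 h2] i|h]; first by split.
by split=> i; have [] := h i.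
Qed.

Lemma measurable_box d (T : measurableType d) I (z : I -> T -> R) (B : I -> set R) :
  (forall i, measurable_fun setT (z i)) -> (forall i, measurable (B i)) ->
  measurable [set t | forall i, B i (z i t)].
Proof.
move=> mz mB.
rewrite (_ : [set t | _] = \bigcap_(i in [set: I]) (z i @^-1` B i)).
  by apply: fin_bigcap_measurable => // i _; rewrite -[X in measurable X]setTI; exact: mz.
by apply/seteqP; split => t /= h i; [move=> _|]; exact: h.
Qed.

Lemma measurable_vec d (T : measurableType d) I (z : I -> T -> R) :
  (forall i, measurable_fun setT (z i)) ->
  measurable_fun setT (fun t => (fun i => z i t) : vecT I).
Proof.
move=> mz; apply: (@measurability _ _ _ (vecT I) setT _ (boxes I)) => // _ [_ [B [mB ->]] <-].
by rewrite setTI; exact: measurable_box.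
Qed.

Lemma measurable_vec_coord I (i : I) :
  measurable_fun setT (fun f : vecT I => (f : I -> R) i).
Proof.
move=> _ A mA; rewrite setTI; apply: sub_sigma_algebra.
exists (fun j => if j == i then A else setT); split.
  by move=> j; case: ifP.
apply/seteqP; split => f /= h; last by have := h i; rewrite eqxx.
by move=> j; case: ifPn => // /eqP ->.
Qed.

Definition dot I (a b : I -> R) : R := \sum_i a i * b i.

Lemma dotC I (a b : I -> R) : dot a b = dot b a.
Proof. by apply: eq_bigr => i _; rewrite mulrC. Qed.

Lemma measurable_dot d (T : measurableType d) I (a : I -> R) (z : I -> T -> R) :
  (forall i, measurable_fun setT (z i)) ->
  measurable_fun setT (fun t => dot a (fun i => z i t)).
Proof.
move=> mz; apply: measurable_sum => i; apply: measurable_funM => //.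
Qed.

End vectors.
Arguments boxes {R} I _.

Section std_gaussian.
Context {R : realType}.
Local Notation gam := (normal_prob (0 : R) 1).
Implicit Types (I J : finType).

(** Independent standard normal variables, through the product rule on boxes
    over the whole finite index set; taking [B i] to be the whole line gives
    the rule for subfamilies. *)
Definition std_gaussian d (T : measurableType d) (P : probability T R)
    I (z : I -> T -> R) :=
  (forall i, measurable_fun setT (z i)) /\
  forall B : I -> set R, (forall i, measurable (B i)) ->
    P [set t | forall i, B i (z i t)] = (\prod_i gam (B i))%E.

Lemma std_gaussian_law d (T : measurableType d) (P : probability T R)
    d' (T' : measurableType d') (P' : probability T' R)
    I (z : I -> T -> R) (z' : I -> T' -> R) (S : set (vecT I)) :
  std_gaussian P z -> std_gaussian P' z' -> measurable S ->
  P [set t | S (fun i => z i t)] = P' [set t | S (fun i => z' i t)].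
Proof.
move=> [mz Pz] [mz' Pz'] mS.
pose m1 := pushm P (measurable_vec mz).
pose m2 := pushm P' (measurable_vec mz').
have [mG1 mG2] : measurable_fun setT (fun t => (fun i => z i t) : vecT I) /\
   measurable_fun setT (fun t => (fun i => z' i t) : vecT I).
  by split; exact: measurable_vec.
have hT : @boxes R I setT.
  by exists (fun _ => setT); split=> //; apply/seteqP; split.
apply: (@g_sigma_algebra_measure_unique _ R (vecT I) (boxes I)
  _ (fun _ => setT) _ _ m1 m2) => //.
- by move=> A ?; exact: sub_sigma_algebra.
- by rewrite bigcup_const.
- exact: boxes_setI.
- by move=> _ [B [mB ->]]; rewrite [LHS]Pz// [RHS]Pz'.
- by move=> _; rewrite /m1/= /pushforward /= preimage_setT probability_setT ltry.
Qed.

Lemma std_gaussian_unit : std_gaussian (gam : probability (measurableTypeR R) R)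
    (fun (_ : unit) (x : R) => x).
Proof.
split; first by move=> _; exact: measurable_id.
move=> B mB; rewrite (big_pred1 tt); last by case.
by congr (normal_prob 0 1 _); apply/seteqP; split => t /= => [/(_ tt)|h []].
Qed.

Lemma std_gaussian_prod d (T : measurableType d) (P : probability T R)
    d' (T' : measurableType d') (P' : probability T' R)
    I I' (z : I -> T -> R) (z' : I' -> T' -> R) :
  std_gaussian P z -> std_gaussian P' z' ->
  std_gaussian (prodP P P')
    (fun (k : I + I') p => match k with inl i => z i p.1 | inr j => z' j p.2 end).
Proof.
move=> [mz Pz] [mz' Pz']; split.
  case=> i; first exact: (measurableT_comp (mz i) measurable_fst).
  exact: (measurableT_comp (mz' i) measurable_snd).
move=> B mB.
pose A1 := [set t | forall i, B (inl i) (z i t)].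
pose A2 := [set t | forall i, B (inr i) (z' i t)].
rewrite (_ : [set t | _] = A1 `*` A2).
  rewrite prodPX; [|exact: (measurable_box mz (fun i => mB (inl i)))
    |exact: (measurable_box mz' (fun i => mB (inr i)))].
  by rewrite (Pz (fun i => B (inl i)))// (Pz' (fun i => B (inr i)))// big_sumType.
apply/seteqP; split => -[t t'] /= => [h|[h1 h2] [i|i]]; [|exact: h1|exact: h2].
by split=> i; [exact: (h (inl i))|exact: (h (inr i))].
Qed.

(** An injective reindexing only drops and renames coordinates: the boxes of
    the new family are boxes of the old one that are full outside the image of
    [f]. *)
Lemma std_gaussian_inj d (T : measurableType d) (P : probability T R)
    I J (z : J -> T -> R) (f : I -> J) : injective f ->
  std_gaussian P z -> std_gaussian P (fun i => z (f i)).
Proof.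
move=> finj [mz Pz]; split; first by move=> i; exact: mz.
move=> B mB.
pose B' j := if [pick i | f i == j] is Some i then B i else setT.
have B'f i : B' (f i) = B i.
  rewrite /B'; case: pickP => [i' /eqP /finj -> //|/(_ i)]; by rewrite eqxx.
rewrite (_ : [set t | _] = [set t | forall j, B' j (z j t)]); last first.
  apply/seteqP; split => t /= h.
    by move=> j; rewrite /B'; case: pickP => // i /eqP <-; exact: h.
  by move=> i; rewrite -B'f; exact: h.
rewrite Pz; last by move=> j; rewrite /B'; case: pickP.
rewrite (bigID (mem (codom f))) /= [X in (_ * X)%E]big1 ?mule1; last first.
  move=> j nj; rewrite /B'; case: pickP => [i /eqP fi|_].
    by move: nj; rewrite -fi codom_f.
  exact: probability_setT.
rewrite (reindex_omap f (fun j => [pick i | f i == j])) /=; last first.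
  by move=> j /codomP[i ->]; case: pickP => [i' /eqP <- //|/(_ i)]; rewrite eqxx.
apply: eq_big => [i|i _]; last by rewrite B'f.
rewrite codom_f; case: pickP => [i' /eqP /finj -> /=|/(_ i)]; by rewrite eqxx.
Qed.

(** Adjoin one independent normal variable at a time through a product space.
    *)
Lemma std_gaussian_exists_ord (N : nat) : exists (d : measure_display)
  (T : measurableType d) (P : probability T R) (z : 'I_N -> T -> R), std_gaussian P z.
Proof.
elim: N => [|N [d [T [P [z zG]]]]].
  exists _, (measurableTypeR R), gam, (fun _ x => x); split; first by case.
  move=> B mB; rewrite big_ord0 (_ : [set t | _] = setT) ?probability_setT//.
  by apply/seteqP; split => // t _ [].
have := std_gaussian_prod std_gaussian_unit zG.
pose f (i : 'I_N.+1) : unit + 'I_N := if unlift ord0 i is Some j then inr j else inl tt.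
have finj : injective f.
  move=> i j; rewrite /f; case: (unliftP ord0 i) => [i'|] ->; case: (unliftP ord0 j) => [j'|] -> //=.
  by move=> [->].
by move=> /(std_gaussian_inj finj) h; do 4 eexists; exact: h.
Qed.

Lemma std_gaussian_exists (I : finType) : exists (d : measure_display)
  (T : measurableType d) (P : probability T R) (z : I -> T -> R), std_gaussian P z.
Proof.
have [d [T [P [z zG]]]] := std_gaussian_exists_ord #|I|.
by exists d, T, P, (fun i => z (enum_rank i)); exact: std_gaussian_inj enum_rank_inj zG.
Qed.

(** Isometries of [R^I] bundled with the invariance of the standard Gaussian
    law under them: the class is closed under composition, and contains plane
    rotations and sign changes, hence reflections. *)
Definition gauss_iso I (O : (I -> R) -> (I -> R)) :=
  (forall a b, dot (O a) (O b) = dot a b) /\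
  (forall d (T : measurableType d) (P : probability T R) (z : I -> T -> R),
     std_gaussian P z -> std_gaussian P (fun i t => O (fun j => z j t) i)).

Lemma gauss_iso_comp I (O1 O2 : (I -> R) -> (I -> R)) :
  gauss_iso O1 -> gauss_iso O2 -> gauss_iso (O1 \o O2).
Proof.
move=> [d1 g1] [d2 g2]; split; first by move=> a b /=; rewrite d1.
by move=> d T P z zG; exact: (g1 _ _ _ _ (g2 _ _ _ _ zG)).
Qed.

Lemma eq_gauss_iso I (O1 O2 : (I -> R) -> (I -> R)) : O1 =1 O2 ->
  gauss_iso O1 -> gauss_iso O2.
Proof. by move=> /funext ->. Qed.

Definition rot I (i j : I) (c s : R) (a : I -> R) : I -> R := fun k =>
  if k == i then c * a i - s * a j else if k == j then s * a i + c * a j else a k.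

Definition flip I (i : I) (a : I -> R) : I -> R := fun k =>
  if k == i then - a i else a k.

Lemma dot_rot I (i j : I) (c s : R) (a b : I -> R) : i != j ->
  c ^+ 2 + s ^+ 2 = 1 -> dot (rot i j c s a) (rot i j c s b) = dot a b.
Proof.
move=> ij cs; have ji : j != i by rewrite eq_sym.
rewrite /dot (bigD1 i)//= [RHS](bigD1 i)//=.
rewrite (bigD1 j) //= [X in _ = _ + X](bigD1 j)//=.
rewrite /rot !eqxx (negbTE ji) !addrA; congr (_ + _).
  transitivity ((c ^+ 2 + s ^+ 2) * (a i * b i + a j * b j)); first by ring.
  by rewrite cs mul1r.
by apply: eq_bigr => k /andP[/negbTE -> /negbTE ->].
Qed.

Lemma dot_flip I (i : I) (a b : I -> R) : dot (flip i a) (flip i b) = dot a b.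
Proof.
by apply: eq_bigr => k _; rewrite /flip; case: eqP => // ->; rewrite mulrNN.
Qed.

(** By [std_gaussian_law] the family may be replaced by one in which the
    coordinates [i] and [j] are the two factors of a separate plane, where
    [normal_prob2_rot] applies. *)
Lemma std_gaussian_rot d (T : measurableType d) (P : probability T R)
    I (z : I -> T -> R) (i j : I) (c s : R) : i != j ->
  c ^+ 2 + s ^+ 2 = 1 -> c != -1 ->
  std_gaussian P z -> std_gaussian P (fun k t => rot i j c s (fun l => z l t) k).
Proof.
move=> ij cs c1 zG; have [mz Pz] := zG.
have ji : j != i by rewrite eq_sym.
have mrz k : measurable_fun setT (fun t => rot i j c s (fun l => z l t) k).
  rewrite /rot; case: (k == i); first by apply: measurable_funB; exact: measurable_funM.
  by case: (k == j) => //; apply: measurable_funD; exact: measurable_funM.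
split=> // B mB.
pose G : probability (measurableTypeR R) R := gam.
pose Q := prodP (prodP G G) P.
have g1 : std_gaussian G (fun (_ : unit) (x : R) => x) := std_gaussian_unit.
have g3 := std_gaussian_prod (std_gaussian_prod g1 g1) zG.
pose f k : (unit + unit) + I :=
  if k == i then inl (inl tt) else if k == j then inl (inr tt) else inr k.
have finj : injective f.
  move=> k l; rewrite /f.
  have [->|_] := eqVneq k i; have [->|_] := eqVneq l i; rewrite ?eqxx//.
  - by case: (l == j).
  - by case: (k == j).
  - by have [->|_] := eqVneq k j; have [->|_] := eqVneq l j => // -[].
have yG := std_gaussian_inj finj g3.
set y := (y in std_gaussian _ y) in yG.
pose S : set (vecT I) := [set a | forall k, B k (rot i j c s a k)].
have mS : measurable S.
  apply: (@measurable_box _ _ (vecT I) I (fun k (a : vecT I) => rot i j c s a k)) => // k.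
  rewrite /rot; case: (k == i).
    by apply: measurable_funB; apply: measurable_funM => //; exact: measurable_vec_coord.
  case: (k == j); last exact: measurable_vec_coord.
  by apply: measurable_funD; apply: measurable_funM => //; exact: measurable_vec_coord.
have := std_gaussian_law zG yG mS; rewrite /S /= => ->.
pose D1 := [set p : R * R | B i (c * p.1 - s * p.2) /\ B j (s * p.1 + c * p.2)].
pose D2 := [set t | forall k, (if (k == i) || (k == j) then setT else B k) (z k t)].
rewrite (_ : [set t | _] = D1 `*` D2); last first.
  apply/seteqP; split => -[[x1 x2] t]; rewrite /D1 /D2 /rot /y /f /= !eqxx /=.
    rewrite (negbTE ji) => h; split.
      by split; [have := h i|have := h j]; rewrite !eqxx ?(negbTE ji).
    by move=> k; have := h k; case: eqP => //= ki; case: eqP.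
  rewrite (negbTE ji) => -[[h1 h2] h3] k; have := h3 k.
  by case: eqP => [->|ki]//=; case: eqP => [->|].
have mD2 : measurable D2.
  by apply: (measurable_box (B := fun k => if (k == i) || (k == j) then setT else B k)) => // k; case: ifP.
have E : D1 = [set p | (B i `*` B j) (c * p.1 - s * p.2, s * p.1 + c * p.2)].
  by [].
have mD1 : measurable D1.
  have mrot : measurable_fun setT
    (fun p : R * R => (c * p.1 - s * p.2, s * p.1 + c * p.2)).
    apply/measurable_fun_pairP; split => /=.
      by apply: measurable_funB; exact: measurable_funM.
    by apply: measurable_funD; exact: measurable_funM.
  rewrite E -[X in measurable X]setTI; apply: mrot => //; exact: measurableX.
have ED1 : prodP G G D1 = (gam (B i) * gam (B j))%E.
  have mBX := measurableX (mB i) (mB j).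
  apply: etrans (normal_prob2_rot cs c1 mBX) _.
  exact: (product_measure1E gam gam (mB i) (mB j)).
rewrite prodPX// ED1.
rewrite (Pz (fun k => if (k == i) || (k == j) then setT else B k)); last first.
  by move=> k; case: ifP.
rewrite [RHS](bigD1 i)//= [in RHS](bigD1 j)//= muleA; congr (_ * _)%E.
rewrite (bigD1 i)//= [in LHS](bigD1 j)//= !eqxx orbT/= !probability_setT !mul1e.
by apply: eq_bigr => k /andP[/negbTE -> /negbTE ->].
Qed.

Lemma std_gaussian_flip d (T : measurableType d) (P : probability T R)
    I (z : I -> T -> R) (i : I) :
  std_gaussian P z -> std_gaussian P (fun k t => flip i (fun l => z l t) k).
Proof.
move=> [mz Pz]; split.
  move=> k; rewrite /flip; case: (k == i) => //.
  exact: (measurableT_comp (@oppr_measurable _ _) (mz i)).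
move=> B mB.
pose B' k := if k == i then [set x | B i (- x)] else B k.
have mBi : measurable [set x : R | B i (- x)].
  by rewrite -[X in measurable X]setTI; exact: oppr_measurable.
rewrite (_ : [set t | _] = [set t | forall k, B' k (z k t)]); last first.
  by apply/seteqP; split => t /= h k; have := h k; rewrite /flip /B'; case: eqP => // ->.
rewrite Pz; last by move=> k; rewrite /B'; case: ifP.
apply: eq_bigr => k _; rewrite /B'; case: eqP => // ->; exact: normal_prob_opp.
Qed.

(** The orthogonal reflection in the hyperplane normal to [v]; it is the
    identity for [v = 0], since division by zero gives zero. *)
Definition reflect_vec I (v a : I -> R) : I -> R := fun k =>
  a k - 2 * dot v a / dot v v * v k.

Lemma reflect_flip I (i : I) (v a : I -> R) :
  (forall k, k != i -> v k = 0) -> v i != 0 ->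
  reflect_vec v a = flip i a.
Proof.
move=> v0 vi; apply/funext => k; rewrite /reflect_vec /flip.
have dE b : dot v b = v i * b i.
  by rewrite /dot (bigD1 i)//= big1 ?addr0// => l li; rewrite v0// mul0r.
rewrite !dE; case: eqP => [->|/eqP ki]; last by rewrite (v0 k ki) mulr0 subr0.
by field.
Qed.

Lemma rot_linear I (i j : I) (c s : R) (k : R) (a b : I -> R) :
  rot i j c s (fun l => a l - k * b l) =
  (fun l => rot i j c s a l - k * rot i j c s b l).
Proof.
apply/funext => l; rewrite /rot; case: eqP => _; first by ring.
by case: eqP => _; ring.
Qed.

Lemma rotK I (i j : I) (c s : R) (a : I -> R) : i != j -> c ^+ 2 + s ^+ 2 = 1 ->
  rot i j c (- s) (rot i j c s a) = a.
Proof.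
move=> ij cs; apply/funext => l.
have h x : (c ^+ 2 + s ^+ 2) * x = x by rewrite cs mul1r.
have ji : j != i by rewrite eq_sym.
rewrite /rot !eqxx (negbTE ji).
by case: eqP => [->|_]; [rewrite -[RHS]h; ring|case: eqP => [->|//]; rewrite -[RHS]h; ring].
Qed.

Lemma gauss_iso_rot I (i j : I) (c s : R) : i != j -> c ^+ 2 + s ^+ 2 = 1 -> c != -1 ->
  gauss_iso (rot i j c s).
Proof.
move=> ij cs c1; split; first by move=> a b; exact: dot_rot.
by move=> d T P z; exact: std_gaussian_rot.
Qed.

(** Induction on the number of nonzero coordinates of [v]: a rotation in the
    plane of two of them kills one of the two and conjugates the reflection in
    [v] to the reflection in a shorter vector. With a single nonzero coordinate
    left, the reflection is a sign change. *)
Lemma gauss_iso_reflect I (v : I -> R) : gauss_iso (reflect_vec v).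
Proof.
have [n] := ubnP #|[pred k | v k != 0]|; elim: n => // n IHn in v *; rewrite ltnS => vn.
have [v0|[i vi]] : (forall k, v k = 0) \/ exists i, v i != 0.
  have [v0|] := pselect (forall k, v k = 0); first by left.
  by move=> /existsNP[i /eqP vi]; right; exists i.
  apply: (@eq_gauss_iso _ id) => // a; apply/funext => k.
  by rewrite /reflect_vec v0 mulr0 subr0.
have [vi0|[j [ji vj]]] : (forall k, k != i -> v k = 0) \/ exists j, j != i /\ v j != 0.
  have [v0|] := pselect (forall k, k != i -> v k = 0); first by left.
  by move=> /existsNP[j /not_implyP[ji /eqP vj]]; right; exists j.
  apply: (@eq_gauss_iso _ (flip i)) => [a|]; first by rewrite (reflect_flip a vi0).
  split; first by move=> a b; exact: dot_flip.
  by move=> d T P z; exact: std_gaussian_flip.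
have ij : i != j by rewrite eq_sym.
set rho := Num.sqrt (v i ^+ 2 + v j ^+ 2).
have r0 : 0 < v i ^+ 2 + v j ^+ 2 by rewrite ltr_pwDl ?sqr_ge0// exprn_even_gt0.
have rho0 : 0 < rho by rewrite sqrtr_gt0.
have rho2 : rho ^+ 2 = v i ^+ 2 + v j ^+ 2 by rewrite sqr_sqrtr// ltW.
(* the angle is chosen so that the coordinate j of the rotated v vanishes *)
pose c := v i / rho; pose s := - (v j / rho).
have cs : c ^+ 2 + s ^+ 2 = 1.
  by rewrite /c /s sqrrN !exprMn -mulrDl -rho2 -exprMn divff ?expr1n// gt_eqF.
have c1 : c != -1.
  apply/eqP => c1.
  have /eqP : s ^+ 2 = 0 by move: cs; rewrite c1 sqrrN expr1n => h; lra.
  by rewrite sqrf_eq0 oppr_eq0 mulf_eq0 invr_eq0 (gt_eqF rho0) orbF (negbTE vj).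
pose w := rot i j c s v.
have wj : w j = 0.
  rewrite /w /rot eqxx (negbTE ji) /c /s; ring.
have wn : (#|[pred k | w k != 0%R]| < n)%N.
  apply: leq_trans vn; apply: proper_card; apply/properP; split.
    apply/fintype.subsetP => k; rewrite !inE /w /rot.
    have [-> _|_] := eqVneq k i; first exact: vi.
    by have [-> _|] := eqVneq k j.
  by exists j; rewrite !inE ?wj ?eqxx.
have gw := IHn w wn.
have g1 := gauss_iso_rot ij cs c1.
have cs' : c ^+ 2 + (- s) ^+ 2 = 1 by rewrite sqrrN.
have g2 := gauss_iso_rot ij cs' c1.
apply: (eq_gauss_iso _ (gauss_iso_comp g2 (gauss_iso_comp gw g1))) => a /=.
rewrite -[RHS](rotK _ ij cs); congr (rot i j c (- s) _).
by rewrite /reflect_vec rot_linear /w !dot_rot.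
Qed.

Lemma dotBl I (k : R) (a b c : I -> R) :
  dot (fun l => a l - k * b l) c = dot a c - k * dot b c.
Proof.
rewrite /dot mulr_sumr -sumrB; apply: eq_bigr => l _; ring.
Qed.

Lemma dot_eq0 I (a : I -> R) : dot a a = 0 -> forall i, a i = 0.
Proof.
move=> /eqP; rewrite psumr_eq0; last by move=> i _; rewrite -expr2 sqr_ge0.
by move=> /allP h i; apply/eqP; have := h i (mem_index_enum _); rewrite /= mulf_eq0 orbb.
Qed.

(** The vectors are matched one by one: once [a_1, ..., a_(k-1)] are sent to
    [b_1, ..., b_(k-1)], reflect the current image of [a_k] onto [b_k]. The
    normal of this reflection is the difference of the two, which is orthogonal
    to the vectors already matched because the Gram matrices agree. *)
Lemma gram_gauss_iso I J (a b : J -> I -> R) :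
  (forall j k, dot (a j) (a k) = dot (b j) (b k)) ->
  exists2 U, gauss_iso U & forall j, U (a j) = b j.
Proof.
move=> gram.
suff h : forall s : seq J, exists2 U, gauss_iso U & forall j, j \in s -> U (a j) = b j.
  by have [U gU Ue] := h (enum J); exists U => // j; apply: Ue; rewrite mem_enum.
elim=> [|k s [U gU Ue]]; first by exists id.
have [dU _] := gU.
(* the factor 1 puts the difference in the form of dotBl *)
pose v l := U (a k) l - 1 * b k l.
exists (reflect_vec v \o U).
  by apply: gauss_iso_comp => //; exact: gauss_iso_reflect.
have vs j : j \in s -> dot v (b j) = 0.
  move=> js; rewrite dotBl mul1r -[X in dot _ X - _](Ue j js) dU gram.
  by rewrite subrr.
have hr x : dot v x = 0 -> reflect_vec v x = x.
  by move=> vx; apply/funext => l; rewrite /reflect_vec vx mulr0 mul0r mul0r subr0.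
have hk : reflect_vec v (U (a k)) = b k.
  have dvv : dot v v = 2 * dot v (U (a k)).
    have hAB : dot (U (a k)) (U (a k)) = dot (b k) (b k) by rewrite dU gram.
    rewrite dotBl (dotC _ v) (dotC (b k) v) !dotBl (dotC (b k) (U _)) hAB; ring.
  have [v0|v0] := eqVneq (dot v v) 0.
    have vl := dot_eq0 v0; apply/funext => l; rewrite /reflect_vec vl mulr0 subr0.
    by have := vl l; rewrite /v mul1r => /eqP; rewrite subr_eq0 => /eqP.
  apply/funext => l; rewrite /reflect_vec -dvv divff// mul1r /v; ring.
move=> j; rewrite inE => /orP[/eqP ->|js] /=; first exact: hk.
by rewrite (Ue j js) hr// vs.
Qed.

(** A centred Gaussian vector is determined in law by its covariance: an
    isometry carrying the coefficient vectors [a] to [b] transforms one vector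
    into the other without changing the law of the underlying standard family.
    *)
Lemma gaussian_law_gram d (T : measurableType d) (P : probability T R)
    d' (T' : measurableType d') (P' : probability T' R)
    I I' J (z : I -> T -> R) (z' : I' -> T' -> R)
    (a : J -> I -> R) (b : J -> I' -> R) (S : set (vecT J)) :
  std_gaussian P z -> std_gaussian P' z' ->
  (forall j k, dot (a j) (a k) = dot (b j) (b k)) -> measurable S ->
  P [set t | S (fun j => dot (a j) (fun i => z i t))] =
  P' [set t | S (fun j => dot (b j) (fun i => z' i t))].
Proof.
move=> zG zG' gram mS.
have [mz _] := zG; have [mz' _] := zG'.
(* both families are padded to the disjoint union of the index sets, so that a
   single isometry can act *)
pose a' j (k : I + I') := if k is inl i then a j i else 0.
pose b' j (k : I + I') := if k is inr i then b j i else 0.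
have a'E j x : dot (a' j) x = dot (a j) (fun i => x (inl i)).
  by rewrite /dot big_sumType/= [X in _ + X]big1 ?addr0// => i _; rewrite mul0r.
have b'E j x : dot (b' j) x = dot (b j) (fun i => x (inr i)).
  by rewrite /dot big_sumType/= [X in X + _]big1 ?add0r// => i _; rewrite mul0r.
have [U gU Ue] : exists2 U, gauss_iso U & forall j, U (a' j) = b' j.
  by apply: gram_gauss_iso => j k; rewrite a'E b'E; exact: gram.
have zzG := std_gaussian_prod zG zG'.
set y := (y in std_gaussian _ y) in zzG.
have [dU GU] := gU; have OyG := GU _ _ _ _ zzG.
pose S' : set (vecT (I + I')%type) := [set x | S (fun j => dot (b' j) x)].
have mS' : measurable S'.
  rewrite -[X in measurable X]setTI.
  have m : measurable_fun setT (fun x : vecT (I + I')%type => (fun j => dot (b' j) x) : vecT J).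
    apply: (@measurable_vec R _ (vecT (I + I')%type) J (fun j (x : vecT (I + I')%type) => dot (b' j) x)) => j.
    apply: (@measurable_dot R _ (vecT (I + I')%type) (I + I')%type (b' j) (fun i (x : vecT (I + I')%type) => x i)) => i.
    exact: measurable_vec_coord.
  exact: (m measurableT _ mS).
have mSz : measurable [set t | S (fun j => dot (a j) (fun i => z i t))].
  rewrite -[X in measurable X]setTI.
  have m : measurable_fun setT (fun t => (fun j => dot (a j) (fun i => z i t)) : vecT J).
    by apply: (@measurable_vec R _ T J (fun j t => dot (a j) (fun i => z i t))) => j; exact: measurable_dot.
  exact: (m measurableT _ mS).
have mSz' : measurable [set t | S (fun j => dot (b j) (fun i => z' i t))].
  rewrite -[X in measurable X]setTI.
  have m : measurable_fun setT (fun t => (fun j => dot (b j) (fun i => z' i t)) : vecT J).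
    by apply: (@measurable_vec R _ T' J (fun j t => dot (b j) (fun i => z' i t))) => j; exact: measurable_dot.
  exact: (m measurableT _ mS).
have := std_gaussian_law OyG zzG mS'; rewrite /S'/=.
set L := [set t | _]; set L' := [set t | _] => LL'.
have -> : P [set t | S (fun j => dot (a j) (fun i => z i t))] = prodP P P' L.
  rewrite (_ : L = [set t | S (fun j => dot (a j) (fun i => z i t))] `*` setT).
    by rewrite prodPX// probability_setT mule1.
  rewrite /L; apply/seteqP; split => -[t t'] /=.
    move=> h; split=> //; move: h; congr S; apply/funext => j.
    rewrite -Ue (_ : (fun i => _) = U (y ^~ (t, t'))); last by apply/funext.
    by rewrite dU a'E.
  move=> [h _]; move: h; congr S; apply/funext => j.
  rewrite -Ue (_ : (fun i => U _ i) = U (y ^~ (t, t'))); last by apply/funext.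
  by rewrite dU a'E.
transitivity (prodP P P' L'); first exact: LL'.
rewrite (_ : L' = setT `*` [set t | S (fun j => dot (b j) (fun i => z' i t))]).
  by rewrite prodPX// probability_setT mul1e.
rewrite /L'; apply/seteqP; split => -[t t'] /=.
  by move=> h; split=> //; move: h; congr S; apply/funext => j; rewrite b'E.
by move=> [_ h]; move: h; congr S; apply/funext => j; rewrite b'E.
Qed.

End std_gaussian.

(** * Chi-square tails *)

Section tails.
Context {R : realType}.
Local Notation gam := (normal_prob (0 : R) 1).
Implicit Types (I J : finType).

(** Both integrals are integrals against the common law of the two families on
    [vecT I]. *)
Lemma std_gaussian_integral d (T : measurableType d) (P : probability T R)
    d' (T' : measurableType d') (P' : probability T' R)
    I (z : I -> T -> R) (z' : I -> T' -> R) (f : vecT I -> \bar R) :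
  std_gaussian P z -> std_gaussian P' z' ->
  measurable_fun setT f -> (forall x, (0 <= f x)%E) ->
  (\int[P]_t f (fun i => z i t) = \int[P']_t f (fun i => z' i t))%E.
Proof.
move=> zG zG' mf f0.
have mz := measurable_vec (proj1 zG); have mz' := measurable_vec (proj1 zG').
rewrite -(@ge0_integral_pushforward _ _ _ (vecT I) R _ mz P setT f)//.
rewrite -(@ge0_integral_pushforward _ _ _ (vecT I) R _ mz' P' setT f)//.
by apply: eq_measure_integral => /= A mA _; exact: std_gaussian_law.
Qed.

Lemma measurable_sumsq d (T : measurableType d) I (z : I -> T -> R) :
  (forall i, measurable_fun setT (z i)) ->
  measurable_fun setT (fun t => \sum_i z i t ^+ 2).
Proof. by move=> mz; apply: measurable_sum => i; apply: measurable_funX. Qed.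

(** The moment generating function of a sum of independent squares is a
    product; one variable is split off at each step. *)
Lemma integral_exp_sumsq_ord (s : R) N : s < 1 / 2 ->
  forall d (T : measurableType d) (P : probability T R) (z : 'I_N -> T -> R),
  std_gaussian P z ->
  (\int[P]_t (expR (s * \sum_i z i t ^+ 2))%:E =
   ((Num.sqrt (1 - 2 * s))^-1 ^+ N)%:E)%E.
Proof.
move=> s2; elim: N => [|N IHN] d T P z zG.
  under eq_integral do rewrite big_ord0 mulr0 expR0.
  rewrite integral_cst// expr0 mul1e. exact: probability_setT.
have zG' := std_gaussian_inj (@lift_inj _ ord0) zG.
have g2 := std_gaussian_prod (@std_gaussian_unit R) zG'.
pose f (i : 'I_N.+1) : unit + 'I_N := if unlift ord0 i is Some j then inr j else inl tt.
have finj : injective f.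
  move=> i j; rewrite /f; case: (unliftP ord0 i) => [i'|] ->; case: (unliftP ord0 j) => [j'|] -> //=.
  by move=> [->].
have yG := std_gaussian_inj finj g2.
set y := (y in std_gaussian _ y) in yG.
have mF : measurable_fun setT
    (fun a : vecT 'I_N.+1 => (expR (s * \sum_i (a : _ -> R) i ^+ 2))%:E).
  apply/measurable_EFinP/measurableT_comp => //; apply: measurable_funM => //.
  by apply: (@measurable_sumsq _ (vecT 'I_N.+1)) => i; exact: measurable_vec_coord.
rewrite (std_gaussian_integral zG yG mF); last by move=> x; rewrite lee_fin expR_ge0.
pose E1 x : \bar R := (expR (s * x ^+ 2))%:E.
pose E2 t : \bar R := (expR (s * \sum_(i < N) z (lift ord0 i) t ^+ 2))%:E.
have mE1 : measurable_fun [set: measurableTypeR R] E1.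
  apply/measurable_EFinP/measurableT_comp => //.
  by apply: measurable_funM => //; exact: measurable_funX.
have mE2 : measurable_fun setT E2.
  apply/measurable_EFinP/measurableT_comp => //; apply: measurable_funM => //.
  by apply: measurable_sumsq => i; have [] := zG'.
transitivity (\int[(gam : probability (measurableTypeR R) R) \x P]_p (E1 p.1 * E2 p.2))%E.
  apply: eq_integral => p _; rewrite /E1 /E2 -EFinM -expRD -mulrDr big_ord_recl.
  rewrite /y /f unlift_none; congr (EFin (expR (s * (_ + _)))).
  by apply: eq_bigr => i _; rewrite liftK.
rewrite (@fubini_tonelli1 _ _ (measurableTypeR R) T R); last 2 first.
- apply: emeasurable_funM; [exact: (measurableT_comp mE1)|exact: (measurableT_comp mE2)].
- by move=> p; rewrite mule_ge0// lee_fin expR_ge0.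
transitivity (\int[(gam : probability (measurableTypeR R) R)]_x (E1 x * \int[P]_t E2 t))%E.
  apply: eq_integral => x _; rewrite /fubini_F /=.
  by rewrite ge0_integralZl//; [move=> t _|]; rewrite lee_fin expR_ge0.
rewrite ge0_integralZr//; last 2 first.
- by move=> x _; rewrite lee_fin expR_ge0.
- by apply: integral_ge0 => t _; rewrite lee_fin expR_ge0.
rewrite exprS EFinM; congr (_ * _)%E; first exact: integral_expR_sq.
exact: IHN zG'.
Qed.

(** Chernoff's bound for both tails at once: [s] is positive for the upper tail
    and negative for the lower one. *)
Lemma chernoff_sumsq (s u : R) I d (T : measurableType d) (P : probability T R)
    (z : I -> T -> R) (A : set T) :
  std_gaussian P z -> s < 1 / 2 -> measurable A ->
  (forall t, A t -> 0 <= s * (\sum_i z i t ^+ 2 - u)) ->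
  (P A <= (expR (- s * u) * (Num.sqrt (1 - 2 * s))^-1 ^+ #|I|)%:E)%E.
Proof.
move=> zG s2 mA hA.
pose z' (i : 'I_#|I|) := z (enum_val i).
have zG' : std_gaussian P z' := std_gaussian_inj enum_val_inj zG.
have sE t : \sum_i z i t ^+ 2 = \sum_i z' i t ^+ 2.
  rewrite (reindex (@enum_val _ (mem I))) //=.
  by exists enum_rank => i _; rewrite ?enum_valK ?enum_rankK.
have -> : P A = (\int[P]_t (\1_A t)%:E)%E by rewrite integral_indic// setIT.
rewrite EFinM -(integral_exp_sumsq_ord s2 zG').
have mE : measurable_fun setT (fun t => (expR (s * \sum_i z' i t ^+ 2))%:E).
  apply/measurable_EFinP/measurableT_comp => //; apply: measurable_funM => //.
  by apply: measurable_sumsq => i; have [] := zG'.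
rewrite -ge0_integralZl//.
apply: ge0_le_integral => //.
- by apply/measurable_EFinP; exact: measurable_indic.
- by apply: emeasurable_funM.
- move=> t _; rewrite -EFinM lee_fin -expRD mulNr addrC -mulrBr indicE.
  case: (boolP (t \in A)) => [/set_mem tA|_]; last by rewrite expR_ge0.
  by rewrite -sE -[leLHS]expR0 ler_expR hA.
Qed.

(** A Chernoff factor that is below one for a single variable gives an
    exponential rate in the number of variables. *)
Lemma chi2_rate_aux (s v : R) : s < 1 -> expR (- s * v) < 1 - s ->
  exists2 k : R, 0 < k & forall N : nat,
    expR (- (s / 2) * (v * N%:R)) * (Num.sqrt (1 - 2 * (s / 2)))^-1 ^+ N = expR (- k * N%:R).
Proof.
move=> s1 h; have s10 : 0 < 1 - s by lra.
have -> : 1 - 2 * (s / 2) = 1 - s by field.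
set q := Num.sqrt (1 - s).
have q0 : 0 < q by rewrite sqrtr_gt0.
exists (ln q + s / 2 * v) => [|N].
  rewrite -ltrBlDr sub0r -ltr_expR lnK ?posrE//.
  rewrite -(@ltr_pXn2r _ 2)// ?nnegrE ?expR_ge0 ?ltW// sqr_sqrtr; last exact: ltW.
  rewrite -expRM_natl; apply: le_lt_trans h; rewrite ler_expR.
  by rewrite -mulNr -mulr_natl; lra.
rewrite -{1}(lnK (_ : q \in Num.pos)) ?posrE// -expRN -expRM_natl -expRD.
by congr expR; rewrite -[_ *+ N]mulr_natr; ring.
Qed.

(** The parameter is chosen so that [s (1 + e) = e / 2]; then the inequality
    follows from [1 + x <= exp x]. *)
Lemma chi2_rate_up (e : R) : 0 < e -> exists2 s : R, 0 < s < 1 & expR (- s * (1 + e)) < 1 - s.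
Proof.
move=> e0; exists (e / (2 * (1 + e))).
  apply/andP; split; first by rewrite divr_gt0//; lra.
  by rewrite ltr_pdivrMr; lra.
set s := _ / _; have s0 : 0 < s by rewrite divr_gt0//; lra.
have es : s * (1 + e) = e / 2 by rewrite /s; field; lra.
have s1 : s < 1 by rewrite /s ltr_pdivrMr; lra.
rewrite mulNr expRN es.
have h : 1 + e / 2 <= expR (e / 2) by rewrite expR_ge1Dx.
have e2 : 0 < 1 + e / 2 by lra.
apply: (@le_lt_trans _ _ (1 + e / 2)^-1); first by rewrite lef_pV2 ?posrE ?expR_gt0.
rewrite -[ltLHS]mul1r ltr_pdivrMr//.
have se : 0 < s * e by rewrite mulr_gt0.
have -> : (1 - s) * (1 + e / 2) = 1 - s + (1 - s) * (s * (1 + e)) by rewrite es; field.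
have s2e : s * (1 + e) < 1 * e by rewrite es; lra.
rewrite es; lra.
Qed.

(** With [s = - e / 2] the inequality follows from [1 - x <= exp (- x)]. *)
Lemma chi2_rate_down (e : R) : 0 < e < 1 -> exists2 s : R, s < 0 & expR (- s * (1 - e)) < 1 - s.
Proof.
move=> /andP[e0 e1]; exists (- (e / 2)); first by lra.
have -> : - - (e / 2) * (1 - e) = - (- (e / 2 * (1 - e))) by ring.
set x := e / 2 * (1 - e).
have x0 : 0 < x by rewrite mulr_gt0//; lra.
have xe : x = e / 2 - e ^+ 2 / 2 by rewrite /x; field.
have e2 : 0 < e ^+ 2 by rewrite exprn_gt0.
have x1 : x < 1 by lra.
have h : 1 - x <= expR (- x) by rewrite expR_ge1Dx.
rewrite !opprK -[x]opprK expRN -[ltLHS]mul1r ltr_pdivrMr ?expR_gt0//.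
apply: lt_le_trans (_ : (1 + e / 2) * (1 - x) <= _); last first.
  by apply: ler_wpM2l h; apply: addr_ge0 => //; rewrite divr_ge0// ltW.
rewrite xe.
have -> : (1 + e / 2) * (1 - (e / 2 - e ^+ 2 / 2)) = 1 + (e ^+ 2 / 4 + e ^+ 2 * e / 4) by field.
have : 0 < e ^+ 2 * e by rewrite mulr_gt0.
lra.
Qed.

Lemma chi2_tail_up (e : R) : 0 < e -> exists2 k : R, 0 < k &
  forall I d (T : measurableType d) (P : probability T R) (z : I -> T -> R),
  std_gaussian P z ->
  (P [set t | ((1 + e) * #|I|%:R <= \sum_i z i t ^+ 2)%R] <= (expR (- k * #|I|%:R))%:E)%E.
Proof.
move=> e0; have [s /andP[s0 s1] h] := chi2_rate_up e0.
have [k k0 kE] := chi2_rate_aux s1 h.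
exists k => // I d T P z zG; rewrite -kE; apply: (chernoff_sumsq zG); first by lra.
  rewrite -[X in measurable X]setTI; apply: measurable_fun_ler => //.
  by apply: measurable_sumsq; have [] := zG.
by move=> t /= ht; rewrite mulr_ge0// ?subr_ge0//; lra.
Qed.

Lemma chi2_tail_down (e : R) : 0 < e < 1 -> exists2 k : R, 0 < k &
  forall I d (T : measurableType d) (P : probability T R) (z : I -> T -> R),
  std_gaussian P z ->
  (P [set t | (\sum_i z i t ^+ 2 <= (1 - e) * #|I|%:R)%R] <= (expR (- k * #|I|%:R))%:E)%E.
Proof.
move=> e0; have [s s0 h] := chi2_rate_down e0.
have s1 : s < 1 by lra.
have [k k0 kE] := chi2_rate_aux s1 h.
exists k => // I d T P z zG; rewrite -kE; apply: (chernoff_sumsq zG); first by lra.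
  rewrite -[X in measurable X]setTI; apply: measurable_fun_ler => //.
  by apply: measurable_sumsq; have [] := zG.
by move=> t /= ht; rewrite nmulr_rge0 ?subr_le0//; lra.
Qed.

(** Chernoff's bound for a single variable. *)
Lemma gaussian_tail (u : R) I (i : I) d (T : measurableType d) (P : probability T R)
    (z : I -> T -> R) : std_gaussian P z ->
  (P [set t | (u <= z i t ^+ 2)%R] <= (2 * expR (- (u / 4)))%:E)%E.
Proof.
move=> zG.
have finj : injective (fun _ : unit => i) by move=> [] [].
have zG' := std_gaussian_inj finj zG.
have mA : measurable [set t | u <= z i t ^+ 2].
  rewrite -[X in measurable X]setTI; apply: measurable_fun_ler => //.
  by apply: measurable_funX; have [] := zG.
have s2 : 1 / 4 < 1 / 2 :> R by lra.
apply: (le_trans (chernoff_sumsq (u := u) zG' s2 mA _)).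
  move=> t /= ht; rewrite (big_pred1 tt); last by case.
  by rewrite mulr_ge0// ?subr_ge0//; lra.
rewrite card_unit expr1 lee_fin.
have -> : - (1 / 4) * u = - (u / 4) by field.
have -> : 1 - 2 * (1 / 4) = 1 / 2 :> R by field.
rewrite mulrC ler_wpM2r ?expR_ge0//.
set q := Num.sqrt _.
have q0 : 0 < q by rewrite sqrtr_gt0; lra.
have hq : 2^-1 <= q.
  rewrite -(@ler_pXn2r _ 2)// ?nnegrE ?(ltW q0)//.
  rewrite sqr_sqrtr; last by lra.
  by rewrite exprVn; lra.
by rewrite -[leRHS]invrK lef_pV2 ?posrE ?invr_gt0.
Qed.

(** Fubini: off [Bad] every section is bounded by [p], and on [Bad] by one. *)
Lemma prodP_le d (T : measurableType d) (P : probability T R)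
    d' (T' : measurableType d') (P' : probability T' R)
    (S : set (T * T')) (Bad : set T) (p : R) :
  measurable S -> measurable Bad -> 0 <= p ->
  (forall t, ~ Bad t -> (P' (xsection S t) <= p%:E)%E) ->
  (prodP P P' S <= P Bad + p%:E)%E.
Proof.
move=> mS mB p0 h.
have -> : (P Bad + p%:E = \int[P]_t ((\1_Bad t)%:E + p%:E))%E.
  rewrite ge0_integralD//; last by apply/measurable_EFinP; exact: measurable_indic.
  rewrite integral_indic// setIT integral_cst//; congr (_ + _)%E.
  by rewrite -[LHS]mule1; congr (_ * _)%E; apply/esym/probability_setT.
apply: ge0_le_integral => //.
- exact: measurable_fun_xsection.
- by apply: emeasurable_funD => //; apply/measurable_EFinP; exact: measurable_indic.
move=> t _ /=; rewrite indicE; have [/set_mem tB|/negP tB] := boolP (t \in Bad).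
  apply: (@le_trans _ _ 1%E); first exact: probability_le1 (measurable_xsection _ mS).
  by rewrite -EFinD lee_fin lerDl.
rewrite add0e; apply: h => tB'; apply: tB; exact: mem_set.
Qed.

End tails.

(** * Quadratic forms, projections and arrowhead matrices *)

Section forms.
Context {R : realType}.
Implicit Types (n : nat).

Definition bform n (W : 'M[R]_n) (x y : 'rV[R]_n) : R := (x *m W *m y^T) 0 0.

Definition dotr n (x y : 'rV[R]_n) : R := (x *m y^T) 0 0.

Lemma bformDl n (W : 'M[R]_n) x x' y : bform W (x + x') y = bform W x y + bform W x' y.
Proof. by rewrite /bform !mulmxDl mxE. Qed.

Lemma bformDr n (W : 'M[R]_n) x y y' : bform W x (y + y') = bform W x y + bform W x y'.
Proof. by rewrite /bform linearD mulmxDr mxE. Qed.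

Lemma bformZl n (W : 'M[R]_n) k x y : bform W (k *: x) y = k * bform W x y.
Proof. by rewrite /bform -!scalemxAl mxE. Qed.

Lemma bformZr n (W : 'M[R]_n) k x y : bform W x (k *: y) = k * bform W x y.
Proof. by rewrite /bform linearZ -scalemxAr mxE. Qed.

Lemma bformD n (W W' : 'M[R]_n) x y : bform (W + W') x y = bform W x y + bform W' x y.
Proof. by rewrite /bform mulmxDr mulmxDl mxE. Qed.

Lemma bformZ n k (W : 'M[R]_n) x y : bform (k *: W) x y = k * bform W x y.
Proof. by rewrite /bform -scalemxAr -scalemxAl mxE. Qed.

Lemma bformN n (W : 'M[R]_n) x y : bform (- W) x y = - bform W x y.
Proof. by rewrite -scaleN1r bformZ mulN1r. Qed.

Lemma bform0l n (W : 'M[R]_n) y : bform W 0 y = 0.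
Proof. by rewrite /bform !mul0mx mxE. Qed.

Lemma bformT n (W : 'M[R]_n) x y : bform W^T x y = bform W y x.
Proof.
rewrite /bform (_ : x *m W^T *m y^T = (y *m W *m x^T)^T) ?mxE//.
by rewrite !trmx_mul trmxK mulmxA.
Qed.

Lemma dotrC n (x y : 'rV[R]_n) : dotr x y = dotr y x.
Proof. by rewrite /dotr !mxE; apply: eq_bigr => i _; rewrite !mxE mulrC. Qed.

Lemma dotrDl n (x x' y : 'rV[R]_n) : dotr (x + x') y = dotr x y + dotr x' y.
Proof. by rewrite /dotr mulmxDl mxE. Qed.

Lemma dotrDr n (x x' y : 'rV[R]_n) : dotr y (x + x') = dotr y x + dotr y x'.
Proof. by rewrite dotrC dotrDl !(dotrC y). Qed.

Lemma dotrZl n k (x y : 'rV[R]_n) : dotr (k *: x) y = k * dotr x y.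
Proof. by rewrite /dotr -scalemxAl mxE. Qed.

Lemma dotrZr n k (x y : 'rV[R]_n) : dotr y (k *: x) = k * dotr y x.
Proof. by rewrite dotrC dotrZl dotrC. Qed.

Lemma dotr0l n (x : 'rV[R]_n) : dotr 0 x = 0.
Proof. by rewrite /dotr mul0mx mxE. Qed.

Lemma dotr0r n (x : 'rV[R]_n) : dotr x 0 = 0.
Proof. by rewrite dotrC dotr0l. Qed.

Lemma dotrE n (x y : 'rV[R]_n) : dotr x y = \sum_i x 0 i * y 0 i.
Proof. by rewrite /dotr mxE; apply: eq_bigr => i _; rewrite mxE. Qed.

Lemma dotr_ge0 n (x : 'rV[R]_n) : 0 <= dotr x x.
Proof. by rewrite dotrE; apply: sumr_ge0 => i _; rewrite -expr2 sqr_ge0. Qed.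

Lemma dotr_eq0 n (x : 'rV[R]_n) : (dotr x x == 0) = (x == 0).
Proof.
apply/eqP/eqP => [|->]; last exact: dotr0l.
rewrite dotrE => /eqP; rewrite psumr_eq0; last by move=> i _; rewrite -expr2 sqr_ge0.
move=> /allP h; apply/rowP => i; rewrite mxE; apply/eqP.
by have := h i (mem_index_enum _); rewrite /= mulf_eq0 orbb.
Qed.

Lemma dotr_gt0 n (x : 'rV[R]_n) : x != 0 -> 0 < dotr x x.
Proof. by move=> x0; rewrite lt0r dotr_ge0 dotr_eq0 x0. Qed.

Lemma bform1 n (x y : 'rV[R]_n) : bform 1%:M x y = dotr x y.
Proof. by rewrite /bform mulmx1. Qed.

Lemma bform_outer n (u v x y : 'rV[R]_n) : bform (u^T *m v) x y = dotr x u * dotr v y.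
Proof.
rewrite /bform mulmxA -mulmxA [x *m u^T]mx11_scalar [v *m y^T]mx11_scalar.
by rewrite -scalar_mxM mxE eqxx mulr1n.
Qed.

Lemma outerM n (u v x : 'rV[R]_n) : x *m (u^T *m v) = dotr x u *: v.
Proof. by rewrite mulmxA [x *m u^T]mx11_scalar mul_scalar_mx. Qed.

Lemma bformE n (W : 'M[R]_n) x y : bform W x y = \sum_i \sum_j x 0 i * W i j * y 0 j.
Proof.
rewrite /bform mxE exchange_big /=; apply: eq_bigr => j _.
by rewrite !mxE mulr_suml; apply: eq_bigr.
Qed.

Lemma bform_mulmx n (P W : 'M[R]_n) x y : bform (P^T *m W *m P) x y = bform W (x *m P^T) (y *m P^T).
Proof. by rewrite /bform trmx_mul trmxK !mulmxA. Qed.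

Definition oproj n (P : 'M[R]_n) := P^T = P /\ P *m P = P.

(** For a unit vector [v] in the range of [P], the projection onto the part of
    the range that is orthogonal to [v]. *)
Definition deflate n (P : 'M[R]_n) (v : 'rV[R]_n) : 'M[R]_n := P - v^T *m v.

Lemma oproj1 n : oproj (1%:M : 'M[R]_n).
Proof. by split; rewrite ?trmx1 ?mulmx1. Qed.

Lemma unit_outer n (v : 'rV[R]_n) : dotr v v = 1 -> v *m (v^T *m v) = v.
Proof. by move=> v1; rewrite outerM v1 scale1r. Qed.

Section deflation.
Variables (n : nat) (P : 'M[R]_n) (v : 'rV[R]_n).
Hypotheses (Pp : oproj P) (v1 : dotr v v = 1) (vP : v *m P = v).
Local Notation P' := (deflate P v).

Lemma PvT : P *m v^T = v^T.
Proof. by have [Pt _] := Pp; rewrite -{1}Pt -trmx_mul vP. Qed.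

Lemma deflate_mull : P' *m P = P'.
Proof. by have [_ PP] := Pp; rewrite /deflate mulmxBl PP -mulmxA vP. Qed.

Lemma deflate_mulr : P *m P' = P'.
Proof. by have [_ PP] := Pp; rewrite /deflate mulmxBr PP mulmxA PvT. Qed.

Lemma v_deflate : v *m P' = 0.
Proof. by rewrite /deflate mulmxBr vP unit_outer// subrr. Qed.

Lemma deflate_oproj : oproj P'.
Proof.
have [Pt PP] := Pp; split; first by rewrite /deflate linearB /= Pt trmx_mul trmxK.
by rewrite {1}/deflate mulmxBl deflate_mulr -mulmxA v_deflate mulmx0 subr0.
Qed.

Lemma deflate_orth (x : 'rV_n) : x *m P' = x -> dotr v x = 0.
Proof.
have [Pt' _] := deflate_oproj.
move=> <-; rewrite /dotr trmx_mul Pt' mulmxA v_deflate mul0mx mxE //.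
Qed.

Lemma deflate_fixP (x : 'rV_n) : x *m P' = x -> x *m P = x.
Proof. by move=> <-; rewrite -mulmxA deflate_mull. Qed.

Lemma deflate_split (x : 'rV_n) : x *m P = x ->
  (x - dotr v x *: v) *m P' = x - dotr v x *: v.
Proof.
move=> xP; rewrite mulmxBl -scalemxAl v_deflate scaler0 subr0.
by rewrite /deflate mulmxBr xP outerM dotrC.
Qed.

Lemma trace_deflate : \tr P' = \tr P - 1.
Proof.
rewrite /deflate linearB /= mxtrace_mulC; congr (_ - _).
by rewrite [v *m v^T]mx11_scalar mxtrace_scalar mulr1n.
Qed.

End deflation.

Lemma oproj_trace n (P : 'M[R]_n) : oproj P -> \tr P = \sum_i \sum_j P i j ^+ 2.
Proof.
move=> [Pt PP]; rewrite -{1}PP /mxtrace; apply: eq_bigr => i _; rewrite mxE.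
by apply: eq_bigr => j _; rewrite -{2}Pt mxE expr2.
Qed.

Lemma oproj_trace0 n (P : 'M[R]_n) : oproj P -> \tr P = 0 -> P = 0.
Proof.
move=> Pp; rewrite oproj_trace// => /eqP; rewrite psumr_eq0; last first.
  by move=> i _; apply: sumr_ge0 => j _; exact: sqr_ge0.
move=> /allP h; apply/matrixP => i j; rewrite mxE; apply/eqP.
have := h i (mem_index_enum _); rewrite /= psumr_eq0; last by move=> k _; exact: sqr_ge0.
by move=> /allP /(_ j (mem_index_enum _)); rewrite /= sqrf_eq0.
Qed.

Lemma oproj_unit n (P : 'M[R]_n) : oproj P -> P != 0 ->
  exists u : 'rV[R]_n, dotr u u = 1 /\ u *m P = u.
Proof.
move=> [Pt PP] P0.
have [i ri] : exists i, row i P != 0.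
  apply: contra_notP (negP P0) => h; apply/eqP/row_matrixP => i.
  rewrite row0; apply/eqP/negPn/negP => hi; apply: h; by exists i.
have d0 := dotr_gt0 ri.
exists ((Num.sqrt (dotr (row i P) (row i P)))^-1 *: row i P); split.
  rewrite dotrZl dotrZr mulrA -expr2 exprVn sqr_sqrtr ?ltW// mulVf// gt_eqF//.
by rewrite -scalemxAl -row_mul PP.
Qed.

Lemma normalize n (P : 'M[R]_n) (g : 'rV[R]_n) : g *m P = g -> g != 0 ->
  exists u : 'rV[R]_n, [/\ dotr u u = 1, u *m P = u & g = Num.sqrt (dotr g g) *: u].
Proof.
move=> gP g0; have d0 := dotr_gt0 g0.
have s0 : Num.sqrt (dotr g g) != 0 by rewrite gt_eqF// sqrtr_gt0.
exists ((Num.sqrt (dotr g g))^-1 *: g); split.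
- by rewrite dotrZl dotrZr mulrA -expr2 exprVn sqr_sqrtr ?ltW// mulVf// gt_eqF.
- by rewrite -scalemxAl gP.
- by rewrite scalerA mulfV// scale1r.
Qed.

(** A border of norm [|b|] is written along a unit vector even when it
    vanishes, unless the range itself is trivial; the recursion over deflated
    projections needs such a direction at every stage. *)
Lemma border_direction n m (P : 'M[R]_n) (g : 'rV[R]_n) : oproj P -> \tr P = m%:R -> g *m P = g ->
  exists u b, [/\ m = 0%N \/ dotr u u = 1, u *m P = u, g = b *: u & b ^+ 2 = dotr g g].
Proof.
move=> pp ptr gp; have [g0|g0] := eqVneq g 0; last first.
  have [u [u1 up gu]] := normalize gp g0.
  exists u, (Num.sqrt (dotr g g)); split=> //; first by right.
  by rewrite sqr_sqrtr// dotr_ge0.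
have [m0|m0] := eqVneq m 0%N.
  by exists 0, 0; rewrite mul0mx scaler0 g0 dotr0l expr0n; split=> //; left.
have p0 : P != 0.
  apply/eqP => p0; move: ptr; rewrite p0 mxtrace0 => /eqP.
  by rewrite eq_sym pnatr_eq0 (negbTE m0).
have [u [u1 up]] := oproj_unit pp p0.
by exists u, 0; rewrite scale0r g0 dotr0l expr0n; split=> //; right.
Qed.

(** The family of events that is stable under elimination of one direction.
    With [y = 0] and [P = 1] it says that the largest eigenvalue exceeds [lam].
    In general it says that the pivot of [lam - W] at [v], after elimination of
    the rest of the range of [P], is smaller than [y]. *)
Definition overshoot n (lam y : R) (P : 'M[R]_n) (v : 'rV[R]_n) : set 'M[R]_n :=
  [set W | exists x, x *m P = x /\ lam * dotr x x - y * dotr v x ^+ 2 < bform W x x].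

(** A symmetric matrix in block form along a unit vector [v]: the corner is
    [a], the border is [g], and the remaining block is [W]. *)
Definition arrow n (a : R) (v g : 'rV[R]_n) (W : 'M[R]_n) : 'M[R]_n :=
  a *: (v^T *m v) + (v^T *m g + g^T *m v) + W.

Section arrow.
Variables (n : nat) (P : 'M[R]_n) (v g : 'rV[R]_n) (W : 'M[R]_n) (a : R).
Hypotheses (Pp : oproj P) (v1 : dotr v v = 1) (vP : v *m P = v).
Local Notation P' := (deflate P v).
Hypotheses (gP : g *m P' = g) (WP : P' *m W *m P' = W).

Lemma arrow_form s (x : 'rV_n) : x *m P' = x ->
  bform (arrow a v g W) (s *: v + x) (s *: v + x) =
  a * s ^+ 2 + 2 * s * dotr g x + bform W x x.
Proof.
move=> xP'; have vx := deflate_orth Pp v1 vP xP'.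
have vg := deflate_orth Pp v1 vP gP.
have [Pt' _] := deflate_oproj Pp v1 vP.
have Wv y : bform W v y = 0.
  by rewrite /bform -WP !mulmxA v_deflate// !mul0mx mxE.
have vW y : bform W y v = 0.
  by rewrite /bform -WP -!mulmxA -{2}Pt' -trmx_mul v_deflate// trmx0 !mulmx0 mxE.
rewrite /arrow !bformD bformZ !bform_outer.
rewrite !dotrDl !dotrDr !dotrZl !dotrZr (dotrC x v) (dotrC x g) (dotrC g v) vx vg v1.
rewrite !bformDl !bformDr !bformZl !bformZr Wv vW Wv; ring.
Qed.

Lemma arrow_norm s (x : 'rV_n) : x *m P' = x ->
  dotr (s *: v + x) (s *: v + x) = s ^+ 2 + dotr x x /\ dotr v (s *: v + x) = s.
Proof.
move=> xP'; have vx := deflate_orth Pp v1 vP xP'.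
split; last by rewrite dotrDr dotrZr vx v1 mulr1 addr0.
by rewrite dotrDl !dotrDr !dotrZl !dotrZr (dotrC x v) vx v1; ring.
Qed.

(** Schur's complement: if the block minus the pivot term is nonpositive,
    completing the square in the component along [v] costs at most [b^2 / y'],
    which has to fit below [lam - y - a]. *)
Lemma overshoot_upper (lam y y' b : R) (u : 'rV[R]_n) :
  0 < y' -> a + b ^+ 2 / y' <= lam - y -> g = b *: u ->
  ~ overshoot lam y' P' u W -> ~ overshoot lam y P v (arrow a v g W).
Proof.
move=> y'0 hab gu hW [x [xP]].
pose s := dotr v x; pose x' := x - s *: v.
have xE : x = s *: v + x' by rewrite /x' addrC subrK.
have x'P : x' *m P' = x' by exact: deflate_split.
rewrite xE arrow_form//; have [-> ->] := arrow_norm s x'P.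
rewrite gu dotrZl; set c := dotr u x'.
have hx' : bform W x' x' <= lam * dotr x' x' - y' * c ^+ 2.
  by rewrite leNgt; apply/negP => h; apply: hW; exists x'.
have h1 : 2 * s * (b * c) <= s ^+ 2 * (b ^+ 2 / y') + y' * c ^+ 2.
  rewrite -subr_ge0.
  have -> : s ^+ 2 * (b ^+ 2 / y') + y' * c ^+ 2 - 2 * s * (b * c) =
    (s * b - y' * c) ^+ 2 / y' by field; rewrite gt_eqF.
  by rewrite divr_ge0 ?sqr_ge0// ltW.
have h2 : s ^+ 2 * (a + b ^+ 2 / y') <= s ^+ 2 * (lam - y) by rewrite ler_wpM2l ?sqr_ge0.
apply/negP; rewrite -leNgt.
move: hx' h1 h2; move: (bform W x' x') (dotr x' x') (y' * c ^+ 2) (b ^+ 2 / y') => A B C D.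
nra.
Qed.

(** Conversely a vector [x'] that overshoots for the block extends to one for
    the whole matrix; the component [s] along [v] is the optimal one, [s = y'
    <u, x'> / b]. *)
Lemma overshoot_lower (lam y y' b : R) (u : 'rV[R]_n) :
  0 <= y' -> 0 < b -> y' * (lam - a - y) <= b ^+ 2 -> g = b *: u ->
  overshoot lam y' P' u W -> overshoot lam y P v (arrow a v g W).
Proof.
move=> y'0 b0 hab gu [x' [x'P hx']].
set c := dotr u x' in hx'.
pose s := y' * c / b.
exists (s *: v + x'); split.
  by rewrite mulmxDl -scalemxAl vP (deflate_fixP Pp vP x'P).
have [-> ->] := arrow_norm s x'P.
rewrite arrow_form// gu dotrZl -/c.
have bs : b * s = y' * c by rewrite /s mulrC divfK// gt_eqF.
have h2 : 2 * s * (b * c) = 2 * (y' * c ^+ 2).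
  by rewrite (_ : 2 * s * (b * c) = 2 * (b * s) * c); [rewrite bs; ring|ring].
have h3 : (lam - a - y) * s ^+ 2 <= y' * c ^+ 2.
  have sb : s ^+ 2 = (y' * c ^+ 2) * (y' / b ^+ 2).
    by rewrite /s; field; rewrite gt_eqF.
  rewrite sb mulrCA; rewrite -[leRHS]mulr1; apply: ler_wpM2l.
    by rewrite mulr_ge0 ?sqr_ge0.
  by rewrite mulrCA mulrA ler_pdivrMr ?exprn_gt0// mul1r.
rewrite h2; move: hx' h3; move: (bform W x' x') (dotr x' x') (y' * c ^+ 2) (s ^+ 2) => A B C D.
nra.
Qed.

End arrow.

End forms.

(** * Rayleigh quotients and measurable events of matrices *)

Section rayleigh.
Context {R : realType}.
Implicit Types (n : nat).

Lemma continuous_bform n (W : 'M[R]_n) : continuous (fun x : 'rV[R]_n => bform W x x).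
Proof.
have -> : (fun x : 'rV[R]_n => bform W x x) =
    (fun x => \sum_i \sum_j x 0 i * W i j * x 0 j).
  by apply/funext => x; exact: bformE.
apply: continuous_big => [|i _]; first exact: add_continuous.
apply: continuous_big => [|j _ x]; first exact: add_continuous.
have hc k : (z 0 k : R) @[z --> x] --> x 0 k by exact: coord_continuous.
exact: (cvgM (cvgM (hc i) (cvg_cst (W i j))) (hc j)).
Qed.

Lemma continuous_dotr n : continuous (fun x : 'rV[R]_n => dotr x x).
Proof.
have -> : (fun x : 'rV[R]_n => dotr x x) = (fun x => bform 1%:M x x).
  by apply/funext => x; rewrite bform1.
exact: continuous_bform.
Qed.

Lemma compact_sphere n : compact [set x : 'rV[R]_n | dotr x x = 1].
Proof.
apply: bounded_closed_compact.
  exists 1; split => // M M1 x /= x1.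
  rewrite [leLHS]/Num.norm /= mx_normrE; apply/bigmax_leP; split; first by apply: ltW; exact: lt_trans M1.
  move=> [i j] _ /=; rewrite ord1.
  apply: le_trans (ltW M1); rewrite -(@ler_pXn2r _ 2)// ?nnegrE// real_normK ?num_real//.
  rewrite expr1n -x1 dotrE (bigD1 j)//= -expr2 lerDl.
  by apply: sumr_ge0 => k _; rewrite -expr2 sqr_ge0.
apply: (@preimage_closed _ _ (fun x : 'rV[R]_n => dotr x x) [set 1]).
  by move=> x _; exact: continuous_dotr.
exact: closed_eq.
Qed.

(** The form is maximal on the compact sphere, and the first-order condition at
    a maximum makes it an eigenvector. *)
Lemma rayleigh_max n (M : 'M[R]_n) : (0 < n)%N -> M^T = M ->
  exists mu (v : 'rV[R]_n), [/\ v != 0, v *m M = mu *: v &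
    forall x, bform M x x <= mu * dotr x x].
Proof.
move=> n0 Ms.
have [c] : exists2 c, c \in [set x : 'rV[R]_n | dotr x x = 1] &
   forall t, t \in [set x : 'rV[R]_n | dotr x x = 1] -> bform M t t <= bform M c c.
  apply: EVT_max_rV; last 2 first.
  - exact: compact_sphere.
  - by apply: continuous_subspaceT; exact: continuous_bform.
  have one0 : (1%:M : 'M[R]_n) != 0.
    apply/eqP => /matrixP /(_ (Ordinal n0) (Ordinal n0)); rewrite !mxE eqxx.
    by move/eqP; rewrite oner_eq0.
  by have [u [u1 _]] := oproj_unit (oproj1 n) one0; exists u.
move=> /set_mem /= c1 cmax.
set mu := bform M c c in cmax.
have hmu x : bform M x x <= mu * dotr x x.
  have [->|x0] := eqVneq x 0; first by rewrite bform0l dotr0l mulr0.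
  have d0 := dotr_gt0 x0; set s := Num.sqrt (dotr x x).
  have s0 : 0 < s by rewrite sqrtr_gt0.
  have s2 : s ^+ 2 = dotr x x by rewrite sqr_sqrtr// ltW.
  have /cmax : s^-1 *: x \in [set x : 'rV[R]_n | dotr x x = 1].
    by apply/mem_set; rewrite /= dotrZl dotrZr mulrA -expr2 exprVn s2 mulVf// gt_eqF.
  by rewrite bformZl bformZr mulrA -expr2 exprVn s2 ler_pdivrMl// mulrC.
exists mu, c; split=> //.
  by apply/eqP => c0; move: c1; rewrite c0 dotr0l => /eqP; rewrite eq_sym oner_eq0.
pose N := mu%:M - M.
have NE x y : bform N x y = mu * dotr x y - bform M x y.
  by rewrite /N bformD bformN -scalemx1 bformZ bform1.
have Ns : N^T = N by rewrite /N linearB /= tr_scalar_mx Ms.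
have N0 x : 0 <= bform N x x by rewrite NE subr_ge0.
have Ncc : bform N c c = 0 by rewrite NE c1 mulr1 subrr.
have Ncy y : bform N c y = 0.
  apply/eqP/negPn/negP => e0; set e := bform N c y in e0.
  have yc : bform N y c = e by rewrite -bformT Ns.
  have := N0 (- (bform N y y + 1) / (2 * e) *: c + y).
  rewrite bformDl !bformDr !bformZl !bformZr Ncc yc -/e.
  set b := bform N y y; set t := - (b + 1) / (2 * e).
  have te : t * e = - (b + 1) / 2 by rewrite /t; field.
  have -> : t * (t * 0) + t * e + (t * e + b) = 2 * (t * e) + b by ring.
  by rewrite te; clear te; clearbody t; clearbody b; clear => h; lra.
have /eqP : dotr (c *m N) (c *m N) = 0 by rewrite -[RHS](Ncy (c *m N)).
rewrite dotr_eq0 /N mulmxBr mul_mx_scalar subr_eq0 => /eqP ->//.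
Qed.

Lemma lambda_max_spec n (M : 'M[R]_n) : (0 < n)%N -> M^T = M ->
  (forall x, bform M x x <= lambda_max M * dotr x x) /\
  exists x, x != 0 /\ bform M x x = lambda_max M * dotr x x.
Proof.
move=> n0 Ms; have [mu [v [v0 vM hmu]]] := rayleigh_max n0 Ms.
have muE : lambda_max M = mu.
  have ub : ubound [set a : R | eigenvalue M a] mu.
    move=> a /= /eigenvalueP[x xM x0].
    have := hmu x; rewrite /bform xM -scalemxAl mxE -/(dotr x x).
    by rewrite ler_pM2r// dotr_gt0.
  have mem : [set a : R | eigenvalue M a] mu by apply/eigenvalueP; exists v.
  apply/eqP; rewrite eq_le; apply/andP; split.
    by apply: ge_sup => //; exists mu.
  by apply: ub_le_sup => //; exists mu.
rewrite muE; split=> //; exists v; split=> //.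
by rewrite /bform vM -scalemxAl mxE.
Qed.

Lemma lambda_max_gt n (M : 'M[R]_n) lam : (0 < n)%N -> M^T = M ->
  lam < lambda_max M <-> exists x, lam * dotr x x < bform M x x.
Proof.
move=> n0 Ms; have [hub [v [v0 vE]]] := lambda_max_spec n0 Ms; split=> [h|[x hx]].
  by exists v; rewrite vE ltr_pM2r// dotr_gt0.
rewrite ltNge; apply/negP => h; move: hx; apply/negP; rewrite -leNgt.
by apply: (le_trans (hub x)); rewrite ler_wpM2r// dotr_ge0.
Qed.

Lemma lambda_max_gt_overshoot n (M : 'M[R]_n) lam v : (0 < n)%N -> M^T = M ->
  lam < lambda_max M <-> overshoot lam 0 1%:M v M.
Proof.
move=> n0 Ms; rewrite lambda_max_gt//; split=> [[x hx]|[x [_ hx]]]; exists x.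
  by rewrite mulmx1 mul0r subr0.
by move: hx; rewrite mul0r subr0.
Qed.

Lemma lambda_minE n (M : 'M[R]_n) : lambda_min M = - lambda_max (- M).
Proof.
rewrite /lambda_min /lambda_max /inf; congr (- sup _).
have eN a (A : 'M[R]_n) : eigenvalue A a -> eigenvalue (- A) (- a).
  move=> /eigenvalueP[x xM x0]; apply/eigenvalueP; exists x => //.
  by rewrite mulmxN xM scaleNr.
apply/seteqP; split => [_ [a /= ha <-]|a /= ha]; first exact: eN.
by exists (- a); rewrite ?opprK//= -(opprK M); exact: eN.
Qed.

End rayleigh.

Section matrix_events.
Context {R : realType}.
Implicit Types (n : nat).

Definition vtomx n (f : 'I_n * 'I_n -> R) : 'M[R]_n := \matrix_(i, j) f (i, j).

(** The sigma-algebra on matrices is that of the entries, through [vtomx]. *)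
Definition mxevent n (S : set 'M[R]_n) :=
  measurable [set f : vecT ('I_n * 'I_n)%type | S (vtomx f)].

Lemma mxevent_preimage n (S : set 'M[R]_n) d (T : measurableType d) (X : T -> 'M[R]_n) :
  (forall i j, measurable_fun setT (fun t => X t i j)) -> mxevent S ->
  measurable [set t | S (X t)].
Proof.
move=> mX mS.
have m : measurable_fun setT (fun t => (fun ij => X t ij.1 ij.2) : vecT ('I_n * 'I_n)%type).
  by apply: (@measurable_vec R _ T ('I_n * 'I_n)%type (fun ij t => X t ij.1 ij.2)) => -[i j].
rewrite (_ : [set t | _] = setT `&` (fun t => (fun ij => X t ij.1 ij.2) : vecT ('I_n * 'I_n)%type) @^-1`
   [set f : vecT ('I_n * 'I_n)%type | S (vtomx f)]).
  exact: m.
have E t : vtomx (fun ij => X t ij.1 ij.2) = X t by apply/matrixP => i j; rewrite mxE.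
by rewrite setTI; apply/seteqP; split => t /=; rewrite E.
Qed.

Lemma measurable_vtomx n (i j : 'I_n) :
  measurable_fun setT (fun f : vecT ('I_n * 'I_n)%type => vtomx f i j).
Proof.
rewrite (_ : (fun f => _) = (fun f : vecT ('I_n * 'I_n)%type => (f : _ -> R) (i, j))).
  exact: measurable_vec_coord.
by apply/funext => f; rewrite mxE.
Qed.

Lemma measurable_bform d (T : measurableType d) n (X : T -> 'M[R]_n) x y :
  (forall i j, measurable_fun setT (fun t => X t i j)) ->
  measurable_fun setT (fun t => bform (X t) x y).
Proof.
move=> mX; rewrite (_ : (fun t => _) = (fun t => \sum_i \sum_j x 0 i * X t i j * y 0 j)).
  apply: measurable_sum => i; apply: measurable_sum => j.
  by apply: measurable_funM => //; apply: measurable_funM.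
by apply/funext => t; exact: bformE.
Qed.

Lemma rat_rV_approx n (f : 'rV[R]_n -> R) (x : 'rV[R]_n) : continuous f -> 0 < f x ->
  exists q : 'rV[rat]_n, 0 < f (map_mx ratr q).
Proof.
move=> cf fx.
have : nbhs x [set y | 0 < f y].
  have := cf x [set z | 0 < z]; apply; exact: (open_nbhs_nbhs (conj (@open_gt R 0) fx)).
move=> /nbhs_ballP[e /= e0 he].
have /choice[q hq] : forall i, exists q : rat, x 0 i - e < ratr q < x 0 i + e.
  move=> i; have /rat_in_itvoo[q] : x 0 i - e < x 0 i + e by lra.
  by rewrite in_itv /=; exists q.
exists (\row_i q i); apply: he; split=> // i j; rewrite ord1 !mxE.
rewrite /ball /= ltr_distlC; exact: hq.
Qed.

(** By continuity the witness can be taken among the countably many rational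
    vectors. *)
Lemma mxevent_overshoot n lam y (P : 'M[R]_n) (v : 'rV[R]_n) : oproj P ->
  mxevent (overshoot lam y P v).
Proof.
move=> [Pt PP].
pose F (W : 'M[R]_n) (x : 'rV[R]_n) :=
  bform W (x *m P) (x *m P) - (lam * dotr (x *m P) (x *m P) - y * dotr v (x *m P) ^+ 2).
rewrite /mxevent (_ : [set f | _] =
   \bigcup_(q : 'rV[rat]_n) [set f : vecT ('I_n * 'I_n)%type | 0 < F (vtomx f) (map_mx ratr q)]).
  apply: countable_bigcupT_measurable => [|q]; first exact: countableP.
  rewrite -[X in measurable X]setTI; apply: measurable_fun_ltr => //.
  apply: measurable_funB => //; apply: measurable_bform; exact: measurable_vtomx.
apply/seteqP; split => f /=.
  move=> [x [xP hx]].
  have [||q hq] := @rat_rV_approx n (F (vtomx f)) x; last by exists q.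
    have -> : F (vtomx f) = (fun x : 'rV[R]_n => bform (P *m (vtomx f - lam%:M + y *: (v^T *m v)) *m P) x x).
      apply/funext => z; rewrite -{1}Pt bform_mulmx Pt !bformD bformZ bform_outer bformN.
      by rewrite -scalemx1 bformZ bform1 /F (dotrC _ v); ring.
    exact: continuous_bform.
  by rewrite /F xP subr_gt0.
move=> [q _ /=]; rewrite /F subr_gt0 => hq; exists (map_mx ratr q *m P); split => //.
by rewrite -mulmxA PP.
Qed.

End matrix_events.

(** * Symmetric Gaussian matrices and their covariance *)

Section symmetric_gaussian.
Context {R : realType}.
Implicit Types (n : nat) (I : finType).

(** With a standard Gaussian family for [f], this is the general centred
    Gaussian matrix. *)
Definition mxcomb n I (A : I -> 'M[R]_n) (f : I -> R) : 'M[R]_n := \sum_k f k *: A k.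

Lemma measurable_mxcomb d (T : measurableType d) n I (A : I -> 'M[R]_n) (z : I -> T -> R) i j :
  (forall k, measurable_fun setT (z k)) ->
  measurable_fun setT (fun t => mxcomb A (fun k => z k t) i j).
Proof.
move=> mz; rewrite (_ : (fun t => _) = (fun t => \sum_k z k t * A k i j)).
  by apply: measurable_sum => k; apply: measurable_funM.
by apply/funext => t; rewrite /mxcomb summxE; apply: eq_bigr => k _; rewrite mxE.
Qed.

Lemma delta_polar n (A : 'M[R]_n) i j : A^T = A ->
  2 * A i j = bform A (delta_mx 0 i + delta_mx 0 j) (delta_mx 0 i + delta_mx 0 j)
    - bform A (delta_mx 0 i) (delta_mx 0 i) - bform A (delta_mx 0 j) (delta_mx 0 j).
Proof.
move=> As.
have E k l : bform A (delta_mx 0 k) (delta_mx 0 l) = A k l.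
  by rewrite /bform -rowE trmx_delta -colE !mxE.
have Aji : A j i = A i j by rewrite -[in LHS]As mxE.
rewrite bformDl !bformDr !E Aji; ring.
Qed.

(** By polarization, the covariance of the quadratic forms determines the
    covariance of the entries of a symmetric matrix, hence its law by
    [gaussian_law_gram]. *)
Lemma law_sym d (T : measurableType d) (P : probability T R)
    d' (T' : measurableType d') (P' : probability T' R)
    n I I' (z : I -> T -> R) (z' : I' -> T' -> R)
    (A : I -> 'M[R]_n) (B : I' -> 'M[R]_n) (S : set 'M[R]_n) :
  std_gaussian P z -> std_gaussian P' z' ->
  (forall k, (A k)^T = A k) -> (forall k, (B k)^T = B k) ->
  (forall x y, \sum_k bform (A k) x x * bform (A k) y y =
               \sum_k bform (B k) x x * bform (B k) y y) ->
  mxevent S ->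
  P [set t | S (mxcomb A (fun k => z k t))] =
  P' [set t | S (mxcomb B (fun k => z' k t))].
Proof.
move=> zG zG' As Bs cov mS.
pose a (ij : 'I_n * 'I_n) k := A k ij.1 ij.2.
pose b (ij : 'I_n * 'I_n) k := B k ij.1 ij.2.
have aE (I0 : finType) (A0 : I0 -> 'M[R]_n) f : mxcomb A0 f =
    vtomx (fun ij : 'I_n * 'I_n => dot (fun k => A0 k ij.1 ij.2) f).
  apply/matrixP => i j; rewrite mxE /mxcomb summxE /dot /=.
  by apply: eq_bigr => k _; rewrite mxE mulrC.
have gram ij kl : dot (a ij) (a kl) = dot (b ij) (b kl).
  have h (x y : R) : 4 * x = 4 * y -> x = y by move=> e; lra.
  apply: h; rewrite /dot !mulr_sumr.
  pose q (x : 'rV[R]_n) k := bform (A k) x x.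
  pose p (x : 'rV[R]_n) k := bform (B k) x x.
  pose e i : 'rV[R]_n := delta_mx 0 i.
  have cov' x y : dot (q x) (q y) = dot (p x) (p y) by exact: cov.
  transitivity (dot (fun k => q (e ij.1 + e ij.2) k - q (e ij.1) k - q (e ij.2) k)
                    (fun k => q (e kl.1 + e kl.2) k - q (e kl.1) k - q (e kl.2) k)).
    by apply: eq_bigr => k _; rewrite /q -!delta_polar// /a; ring.
  transitivity (dot (fun k => p (e ij.1 + e ij.2) k - p (e ij.1) k - p (e ij.2) k)
                    (fun k => p (e kl.1 + e kl.2) k - p (e kl.1) k - p (e kl.2) k)).
    have dE (J : finType) (u1 u2 u3 v1 v2 v3 : J -> R) :
       dot (fun k => u1 k - u2 k - u3 k) (fun k => v1 k - v2 k - v3 k) =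
       dot u1 v1 - dot u1 v2 - dot u1 v3 - (dot u2 v1 - dot u2 v2 - dot u2 v3)
        - (dot u3 v1 - dot u3 v2 - dot u3 v3).
      by rewrite /dot -!sumrB; apply: eq_bigr => k _; ring.
    by rewrite !dE !cov'.
  by apply: eq_bigr => k _; rewrite /p -!delta_polar// /b; ring.
have := @gaussian_law_gram R _ _ P _ _ P' _ _ _ z z' a b
  [set f : vecT ('I_n * 'I_n)%type | S (vtomx f)] zG zG' gram mS.
rewrite /= => h.
rewrite (_ : [set t | _] = [set t | S (vtomx (fun j => dot (a j) (z^~ t)))]); last first.
  by apply/seteqP; split => t /=; rewrite aE.
rewrite h; congr (P' _); by apply/seteqP; split => t /=; rewrite aE.
Qed.

(** The GOE on the range of [P], of scale [s]: each diagonal entry in an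
    orthonormal basis of the range has variance [2 s^2], each other entry has
    variance [s^2]. *)
Definition goe n (s : R) (P : 'M[R]_n) (f : 'I_n * 'I_n -> R) : 'M[R]_n :=
  (s / Num.sqrt 2) *: (P *m (vtomx f + (vtomx f)^T) *m P).

Definition goe_basis n (s : R) (P : 'M[R]_n) (ij : 'I_n * 'I_n) : 'M[R]_n :=
  (s / Num.sqrt 2) *: (P *m (delta_mx ij.1 ij.2 + delta_mx ij.2 ij.1) *m P).

Lemma vtomxE n (f : 'I_n * 'I_n -> R) : vtomx f = \sum_ij f ij *: delta_mx ij.1 ij.2.
Proof.
transitivity (\sum_ij f (ij.1, ij.2) *: (delta_mx ij.1 ij.2 : 'M[R]_n)); last first.
  by apply: eq_bigr => -[i j].
rewrite -(pair_bigA _ (fun i j => f (i, j) *: delta_mx i j)) /=.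
by rewrite [LHS]matrix_sum_delta; apply: eq_bigr => i _; apply: eq_bigr => j _; rewrite mxE.
Qed.

Lemma goeE n (s : R) (P : 'M[R]_n) f : goe s P f = mxcomb (goe_basis s P) f.
Proof.
have vT : (vtomx f)^T = \sum_ij f ij *: delta_mx ij.2 ij.1.
  by rewrite vtomxE linear_sum; apply: eq_bigr => ij _; rewrite linearZ /= trmx_delta.
rewrite /goe vT vtomxE -big_split /= mulmx_sumr mulmx_suml scaler_sumr.
apply: eq_bigr => ij _; rewrite /goe_basis -scalerDr -scalemxAr -scalemxAl.
by rewrite !scalerA mulrC.
Qed.

Lemma goe_basis_sym n (s : R) (P : 'M[R]_n) ij : P^T = P -> (goe_basis s P ij)^T = goe_basis s P ij.
Proof.
move=> Pt; rewrite /goe_basis linearZ /= !trmx_mul Pt linearD /= !trmx_delta mulmxA.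
by rewrite addrC.
Qed.

Lemma bform_goe_basis n (s : R) (P : 'M[R]_n) ij x : P^T = P ->
  bform (goe_basis s P ij) x x = s * Num.sqrt 2 * ((x *m P) 0 ij.1 * (x *m P) 0 ij.2).
Proof.
move=> Pt; rewrite /goe_basis bformZ -{1}Pt bform_mulmx Pt bformD.
have dE i j (y : 'rV[R]_n) : bform (delta_mx i j) y y = y 0 i * y 0 j.
  have -> : delta_mx i j = (delta_mx 0 i : 'rV[R]_n)^T *m (delta_mx 0 j : 'rV[R]_n).
    by rewrite trmx_delta mul_delta_mx.
  have eE k : dotr y (delta_mx 0 k) = y 0 k by rewrite /dotr trmx_delta -colE mxE.
  by rewrite bform_outer eE dotrC eE.
rewrite !dE.
have s2 : Num.sqrt 2 * Num.sqrt 2 = 2 :> R by rewrite -expr2 sqr_sqrtr.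
have s20 : Num.sqrt 2 != 0 :> R by rewrite gt_eqF// sqrtr_gt0.
have h : s / Num.sqrt 2 * 2 = s * Num.sqrt 2.
  by apply: (mulIf s20); rewrite mulrAC divfK// -mulrA s2.
rewrite -h; ring.
Qed.

Lemma goe_cov n (s : R) (P : 'M[R]_n) x y : P^T = P ->
  \sum_k bform (goe_basis s P k) x x * bform (goe_basis s P k) y y =
  2 * s ^+ 2 * dotr (x *m P) (y *m P) ^+ 2.
Proof.
move=> Pt; have s2 : Num.sqrt 2 ^+ 2 = 2 :> R by rewrite sqr_sqrtr.
transitivity (\sum_k bform (goe_basis s P (k.1, k.2)) x x *
    bform (goe_basis s P (k.1, k.2)) y y); first by apply: eq_bigr => -[i j].
rewrite -(pair_bigA _ (fun i j => bform (goe_basis s P (i, j)) x x *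
    bform (goe_basis s P (i, j)) y y)) /=.
rewrite dotrE [X in _ = _ * X]expr2 mulr_suml mulr_sumr; apply: eq_bigr => i _.
rewrite mulr_sumr mulr_sumr; apply: eq_bigr => j _.
by rewrite !bform_goe_basis//= -[in RHS]s2; ring.
Qed.

(** The arrow matrix with independent Gaussian corner, border and GOE block, as
    a combination of fixed symmetric matrices; [arrow_basisE] identifies it. *)
Definition arrow_basis n (al be s : R) (v : 'rV[R]_n) (P' : 'M[R]_n)
    (k : (unit + 'I_n) + ('I_n * 'I_n)) : 'M[R]_n :=
  match k with
  | inl (inl _) => al *: (v^T *m v)
  | inl (inr i) => be *: (v^T *m row i P' + (row i P')^T *m v)
  | inr ij => goe_basis s P' ij
  end.

Definition hrow n (f : unit + 'I_n -> R) : 'rV[R]_n := \row_i f (inr i).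

Lemma arrow_basisE n (al be s : R) (v : 'rV[R]_n) (P' : 'M[R]_n) f :
  mxcomb (arrow_basis al be s v P') f =
  arrow (al * f (inl (inl tt))) v (be *: (hrow (fun k => f (inl k)) *m P'))
    (goe s P' (fun k => f (inr k))).
Proof.
rewrite /mxcomb big_sumType /= big_sumType /= (big_pred1 tt); last by case.
rewrite /arrow goeE /mxcomb scalerA [f _ * al]mulrC; congr (_ + _ + _).
pose S := \sum_i f (inl (inr i)) *: row i P'.
have -> : hrow (fun k => f (inl k)) *m P' = S.
  by rewrite mulmx_sum_row; apply: eq_bigr => i _; rewrite mxE.
have -> : (be *: S)^T = be *: S^T by rewrite linearZ.
have -> : S^T = \sum_i f (inl (inr i)) *: (row i P')^T.
  by rewrite /S linear_sum; apply: eq_bigr => i _; rewrite linearZ.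
rewrite -scalemxAr -scalemxAl -scalerDr.
rewrite /S mulmx_sumr mulmx_suml -big_split scaler_sumr /=; apply: eq_bigr => i _.
by rewrite -scalemxAl -scalemxAr -scalerDr !scalerA mulrC.
Qed.

Lemma arrow_basis_sym n (al be s : R) (v : 'rV[R]_n) (P' : 'M[R]_n) k : P'^T = P' ->
  (arrow_basis al be s v P' k)^T = arrow_basis al be s v P' k.
Proof.
move=> Pt; case: k => [[_|i]|ij] /=; last exact: goe_basis_sym.
  by rewrite linearZ /= trmx_mul trmxK.
by rewrite linearZ linearD /= !trmx_mul !trmxK addrC.
Qed.

Lemma arrow_cov n (al be s : R) (v : 'rV[R]_n) (P' : 'M[R]_n) x y : P'^T = P' ->
  \sum_k bform (arrow_basis al be s v P' k) x x * bform (arrow_basis al be s v P' k) y y =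
  al ^+ 2 * dotr v x ^+ 2 * dotr v y ^+ 2 +
  4 * be ^+ 2 * dotr v x * dotr v y * dotr (x *m P') (y *m P') +
  2 * s ^+ 2 * dotr (x *m P') (y *m P') ^+ 2.
Proof.
move=> Pt; rewrite big_sumType /= goe_cov// big_sumType /= (big_pred1 tt); last by case.
congr (_ + _ + _); first by rewrite !bformZ !bform_outer !(dotrC _ v); ring.
rewrite [dotr (x *m P') _]dotrE mulr_sumr; apply: eq_bigr => i _.
have rE (z : 'rV[R]_n) : dotr z (row i P') = (z *m P') 0 i.
  by rewrite /dotr tr_row Pt colE mulmxA -colE mxE.
rewrite !bformZ !bformD !bform_outer !(dotrC _ v) !(dotrC (row i P')) !rE; ring.
Qed.

End symmetric_gaussian.

(** * Eliminating one direction of a GOE matrix *)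

Section goe_recursion.
Context {R : realType}.
Implicit Types (n : nat).

Lemma dotr_proj n (P : 'M[R]_n) x y : oproj P -> dotr (x *m P) (y *m P) = bform P x y.
Proof. by move=> [Pt PP]; rewrite /dotr trmx_mul Pt /bform !mulmxA -(mulmxA x) PP. Qed.

Lemma dotr_deflate n (P : 'M[R]_n) v x y : oproj P -> dotr v v = 1 -> v *m P = v ->
  dotr (x *m P) (y *m P) =
  dotr v x * dotr v y + dotr (x *m deflate P v) (y *m deflate P v).
Proof.
move=> Pp v1 vP; rewrite !dotr_proj//; last exact: deflate_oproj.
by rewrite /deflate bformD bformN bform_outer (dotrC x); ring.
Qed.

Lemma dotr_proj_le n (P : 'M[R]_n) x : oproj P -> dotr (x *m P) (x *m P) <= dotr x x.
Proof.
move=> Pp; have [Pt PP] := Pp.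
have h : dotr (x - x *m P) (x - x *m P) = dotr x x - dotr (x *m P) (x *m P).
  have e : dotr x (x *m P) = dotr (x *m P) (x *m P).
    by rewrite dotr_proj// /dotr trmx_mul Pt mulmxA.
  rewrite -scaleN1r dotrDl !dotrDr !dotrZl !dotrZr (dotrC (x *m P) x) e; ring.
by have := dotr_ge0 (x - x *m P); rewrite h subr_ge0.
Qed.

(** In the direction [v] a GOE matrix splits into an independent corner, border
    and smaller GOE, because both sides have the same covariance. *)
Lemma goe_arrow_law d (T : measurableType d) (P : probability T R)
    d' (T' : measurableType d') (Q : probability T' R)
    n (H : 'I_n * 'I_n -> T -> R) (z : unit + 'I_n -> T' -> R)
    (s : R) (p : 'M[R]_n) (v : 'rV[R]_n) (S : set 'M[R]_n) :
  std_gaussian P H -> std_gaussian Q z -> oproj p -> dotr v v = 1 -> v *m p = v ->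
  mxevent S ->
  P [set t | S (goe s p (fun k => H k t))] =
  prodP Q P [set t | S (arrow (s * Num.sqrt 2 * z (inl tt) t.1) v
                (s *: (hrow (fun k => z k t.1) *m deflate p v))
                (goe s (deflate p v) (fun k => H k t.2)))].
Proof.
move=> HG zG pp v1 vp mS; have [pt _] := pp.
have pp' := deflate_oproj pp v1 vp; have [pt' _] := pp'.
have := law_sym HG (std_gaussian_prod zG HG) (A := goe_basis s p)
  (B := arrow_basis (s * Num.sqrt 2) s s v (deflate p v)) _ _ _ mS.
move=> h; rewrite (_ : [set t | _] = [set t | S (mxcomb (goe_basis s p) (fun k => H k t))]); last first.
  by apply/seteqP; split => t /=; rewrite goeE.
rewrite h => [|k|k|x y].
- by congr (prodP Q P _); apply/seteqP; split => t /=; rewrite arrow_basisE.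
- exact: goe_basis_sym.
- exact: arrow_basis_sym.
rewrite goe_cov// arrow_cov// (dotr_deflate x y pp v1 vp).
rewrite exprMn sqr_sqrtr//; ring.
Qed.

Lemma goe_sandwich n s (P : 'M[R]_n) f : oproj P -> P *m goe s P f *m P = goe s P f.
Proof.
move=> [Pt PP]; rewrite /goe -scalemxAr -scalemxAl; congr (_ *: _).
by rewrite !mulmxA PP -!mulmxA PP !mulmxA.
Qed.

Lemma goe0 n s f : goe s (0 : 'M[R]_n) f = 0.
Proof. by rewrite /goe mul0mx mul0mx scaler0. Qed.

Lemma goe_sym n s (P : 'M[R]_n) f : P^T = P -> (goe s P f)^T = goe s P f.
Proof.
by move=> Pt; rewrite /goe linearZ /= !trmx_mul Pt linearD /= trmxK addrC mulmxA.
Qed.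

Lemma measurable_hrow n d (T : measurableType d) (z : unit + 'I_n -> T -> R) (p : 'M[R]_n) i j :
  (forall k, measurable_fun setT (z k)) ->
  measurable_fun setT (fun t => (hrow (fun k => z k t) *m p) i j).
Proof.
move=> mz; rewrite (_ : (fun t => _) = (fun t => \sum_k z (inr k) t * p k j)).
  by apply: measurable_sum => k; apply: measurable_funM.
by apply/funext => t; rewrite mxE; apply: eq_bigr => k _; rewrite mxE.
Qed.

Lemma measurable_dotr_hrow n d (T : measurableType d) (z : unit + 'I_n -> T -> R) (p : 'M[R]_n) :
  (forall k, measurable_fun setT (z k)) ->
  measurable_fun setT (fun t => dotr (hrow (fun k => z k t) *m p) (hrow (fun k => z k t) *m p)).
Proof.
move=> mz; rewrite (_ : (fun t => _) = (fun t => \sum_j (hrow (fun k => z k t) *m p) 0 j *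
  (hrow (fun k => z k t) *m p) 0 j)).
  by apply: measurable_sum => k; apply: measurable_funM; exact: measurable_hrow.
by apply/funext => t; rewrite dotrE.
Qed.

Lemma measurable_goe n d (T : measurableType d) (H : 'I_n * 'I_n -> T -> R) s (p : 'M[R]_n) i j :
  (forall k, measurable_fun setT (H k)) ->
  measurable_fun setT (fun t => goe s p (fun k => H k t) i j).
Proof.
move=> mH; rewrite (_ : (fun t => _) = (fun t => mxcomb (goe_basis s p) (fun k => H k t) i j)).
  exact: measurable_mxcomb.
by apply/funext => t; rewrite goeE.
Qed.

Lemma measurable_arrow n d (T : measurableType d) d' (T' : measurableType d')
   (z : unit + 'I_n -> T' -> R) (H : 'I_n * 'I_n -> T -> R) al be s (v : 'rV[R]_n) (p' : 'M[R]_n) i j :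
  (forall k, measurable_fun setT (z k)) -> (forall k, measurable_fun setT (H k)) ->
  measurable_fun setT (fun t : T' * T => arrow (al * z (inl tt) t.1) v
                (be *: (hrow (fun k => z k t.1) *m p')) (goe s p' (fun k => H k t.2)) i j).
Proof.
move=> mz mH.
pose zz (k : (unit + 'I_n) + ('I_n * 'I_n)) (t : T' * T) := match k with inl i => z i t.1 | inr j => H j t.2 end.
rewrite (_ : (fun t => _) = (fun t => mxcomb (arrow_basis al be s v p') (fun k => zz k t) i j)).
  apply: measurable_mxcomb => -[k|k]; first exact: (measurableT_comp (mz k) measurable_fst).
  exact: (measurableT_comp (mH k) measurable_snd).
by apply/funext => t; rewrite arrow_basisE.
Qed.

(** The corner and the border are frozen outside [Bad]; the event for the arrow
    matrix then implies an event for the independent block, whose probability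
    is bounded uniformly. *)
Lemma arrow_prob_le d (T : measurableType d) (P : probability T R)
    d' (T' : measurableType d') (Q : probability T' R)
    n (H : 'I_n * 'I_n -> T -> R) (z : unit + 'I_n -> T' -> R)
    (al be s : R) (p' : 'M[R]_n) (v : 'rV[R]_n) (S : set 'M[R]_n)
    (Bad : set T') (c : R) :
  std_gaussian P H -> std_gaussian Q z -> mxevent S -> measurable Bad -> 0 <= c ->
  (forall t, ~ Bad t -> exists S' : set 'M[R]_n, [/\ mxevent S',
     (P [set u | S' (goe s p' (fun k => H k u))] <= c%:E)%E &
     forall u, S (arrow (al * z (inl tt) t) v (be *: (hrow (fun k => z k t) *m p'))
                (goe s p' (fun k => H k u))) -> S' (goe s p' (fun k => H k u))]) ->
  (prodP Q P [set t | S (arrow (al * z (inl tt) t.1) v (be *: (hrow (fun k => z k t.1) *m p'))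
                (goe s p' (fun k => H k t.2)))] <= Q Bad + c%:E)%E.
Proof.
move=> [mH HG] [mz zG] mS mB c0 h.
have mE : measurable [set t : T' * T | S (arrow (al * z (inl tt) t.1) v (be *: (hrow (fun k => z k t.1) *m p'))
                (goe s p' (fun k => H k t.2)))].
  by apply: (mxevent_preimage _ mS) => i j; exact: measurable_arrow.
apply: prodP_le => // t nB; have [S' [mS' pS' SS']] := h t nB.
apply: le_trans pS'; apply: le_measure; rewrite ?in_setE.
- exact: measurable_xsection.
- by apply: (mxevent_preimage _ mS') => i j; exact: measurable_goe.
- by move=> u; rewrite /xsection /= => /set_mem /= /SS'.
Qed.

Lemma overshoot_set0 n lam y v : overshoot lam y (0 : 'M[R]_n) v 0 -> False.
Proof.
move=> [x [<-]]; rewrite mulmx0 bform0l dotr0l dotr0r mulr0 expr0n mulr0 subr0.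
by rewrite ltxx.
Qed.

Section upper.
Variables (n : nat) (s lam y dl b2 : R).
Hypotheses (y0 : 0 < y) (hlam : dl + b2 / y <= lam - y).
Variables (d' : measure_display) (T' : measurableType d') (Q : probability T' R)
  (z : unit + 'I_n -> T' -> R).
Hypothesis zG : std_gaussian Q z.

(** The corner exceeds [dl], or the border is longer than [sqrt b2]; the full
    border vector is used instead of its projection so that the event does not
    depend on the projection. *)
Definition bad_upper : set T' := [set t | dl < s * Num.sqrt 2 * z (inl tt) t] `|`
  [set t | b2 < s ^+ 2 * dotr (hrow (fun k => z k t)) (hrow (fun k => z k t))].

Lemma measurable_bad_upper : measurable bad_upper.
Proof.
have [mz _] := zG; apply: measurableU.
  rewrite -[X in measurable X]setTI; apply: measurable_fun_ltr => //.
  exact: measurable_funM.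
rewrite -[X in measurable X]setTI; apply: measurable_fun_ltr => //.
apply: measurable_funM => //.
by have := measurable_dotr_hrow (1%:M) mz; under eq_fun do rewrite mulmx1.
Qed.

(** An edge estimate without moments: all pivots are kept equal to a constant
    [y], which [hlam] makes stable under one elimination ([overshoot_upper]).
    After [m] eliminations the matrix is empty, and each elimination costs the
    probability of one exceptional event. *)
Lemma goe_upper (q : R) : (Q bad_upper <= q%:E)%E -> forall m (p : 'M[R]_n) v,
  oproj p -> \tr p = m%:R -> v *m p = v -> (m = 0 \/ dotr v v = 1) ->
  forall d (T : measurableType d) (P : probability T R) (H : 'I_n * 'I_n -> T -> R),
  std_gaussian P H ->
  (P [set t | overshoot lam y p v (goe s p (fun k => H k t))] <= (m%:R * q)%:E)%E.
Proof.
move=> hq; have q0 : 0 <= q by rewrite -lee_fin; apply: le_trans hq.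
elim=> [|m IHm] p v pp ptr vp v1 d T P H HG.
  have p0 := oproj_trace0 pp ptr; rewrite (_ : [set t | _] = set0) ?measure0 ?mul0r//.
  by apply/seteqP; split => // t /=; rewrite p0 goe0 => /overshoot_set0.
case: v1 => // v1.
have mS := mxevent_overshoot lam y v pp.
rewrite (goe_arrow_law s HG zG pp v1 vp mS).
have pp' := deflate_oproj pp v1 vp.
have ptr' : \tr (deflate p v) = m%:R by rewrite trace_deflate// ptr -natr1 addrK.
apply: (@le_trans _ _ (Q bad_upper + (m%:R * q)%:E)%E); last first.
  by rewrite -natr1 mulrDl mul1r addrC EFinD; apply: leeD.
apply: arrow_prob_le => //; first exact: measurable_bad_upper.
  by rewrite mulr_ge0.
move=> t nbad.
set g := s *: (hrow (fun k => z k t) *m deflate p v).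
have gp : g *m deflate p v = g by rewrite -scalemxAl -mulmxA; have [_ ->] := pp'.
have [u [b [u1 up gu bb]]] := border_direction pp' ptr' gp.
exists (overshoot lam y (deflate p v) u); split.
- exact: mxevent_overshoot.
- exact: IHm.
move=> w; apply: contraPP => nw.
apply: (overshoot_upper pp v1 vp gp (goe_sandwich _ _ pp') y0 _ gu nw).
apply: le_trans hlam.
have [h1 h2] : s * Num.sqrt 2 * z (inl tt) t <= dl /\ b ^+ 2 <= b2.
  split; rewrite leNgt; apply/negP => h; apply: nbad; [by left|right].
  apply: lt_le_trans h _; rewrite bb /g dotrZl dotrZr mulrA -expr2.
  by rewrite ler_wpM2l ?sqr_ge0// dotr_proj_le.
by apply: lerD => //; rewrite ler_wpM2r// invr_ge0 ltW.
Qed.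

End upper.

(** The projections reachable from the identity in [j] deflations. Their rank
    is [n - j], so they do not shorten a Gaussian vector by much when [j] is
    bounded. *)
Inductive coproj n : nat -> 'M[R]_n -> Prop :=
| coproj0 : coproj 0 1%:M
| coprojS j p v : coproj j p -> dotr v v = 1 -> v *m p = v -> coproj j.+1 (deflate p v).

Lemma coproj_oproj n j (p : 'M[R]_n) : coproj j p -> oproj p.
Proof.
by elim=> [|j' p' v _ IH v1 vp]; [exact: oproj1|exact: deflate_oproj].
Qed.

(** The vector [v] itself overshoots when the corner is large enough. *)
Lemma overshoot_corner n lam y (p : 'M[R]_n) v g W a : oproj p -> dotr v v = 1 -> v *m p = v ->
  g *m deflate p v = g -> deflate p v *m W *m deflate p v = W -> lam - y < a ->
  overshoot lam y p v (arrow a v g W).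
Proof.
move=> pp v1 vp gp Wp ha; exists v; split=> //.
have := arrow_form a pp v1 vp gp Wp 1 (x := 0); rewrite mul0mx => /(_ erefl).
rewrite scale1r addr0 => ->.
by rewrite v1 dotr0r bform0l !expr1n !mulr1 mulr0 !addr0.
Qed.

Section lower.
Variables (n : nat) (s lam dl b2 : R) (y : nat -> R).
Hypotheses (b20 : 0 < b2) (y0 : y 0%N = lam + dl)
  (yS : forall k, y k * (lam + dl - y k.+1) <= b2) (K : nat)
  (yge : forall k, (k < K)%N -> 0 <= y k).
Variables (d' : measure_display) (T' : measurableType d') (Q : probability T' R)
  (z : unit + 'I_n -> T' -> R).
Hypothesis zG : std_gaussian Q z.

Definition bad_lower (p : 'M[R]_n) : set T' := [set t | s * Num.sqrt 2 * z (inl tt) t <= - dl] `|`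
  [set t | s ^+ 2 * dotr (hrow (fun k => z k t) *m p) (hrow (fun k => z k t) *m p) < b2].

Lemma measurable_bad_lower p : measurable (bad_lower p).
Proof.
have [mz _] := zG; apply: measurableU.
  rewrite -[X in measurable X]setTI; apply: measurable_fun_ler => //.
  exact: measurable_funM.
rewrite -[X in measurable X]setTI; apply: measurable_fun_ltr => //.
by apply: measurable_funM => //; exact: measurable_dotr_hrow.
Qed.

(** The lower companion of [goe_upper]: pivots follow a truncated continued
    fraction [y], and only [k] eliminations are performed, after which
    [overshoot_corner] concludes. The number of steps does not depend on the
    dimension. *)
Lemma goe_lower (q : R) (J : nat) :
  (forall j p, coproj j p -> (j <= J)%N -> (Q (bad_lower p) <= q%:E)%E) ->
  forall k j (p : 'M[R]_n) v, coproj j p -> (j + k < J)%N -> (k <= K)%N ->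
  v *m p = v -> dotr v v = 1 ->
  forall d (T : measurableType d) (P : probability T R) (H : 'I_n * 'I_n -> T -> R),
  std_gaussian P H ->
  (P [set t | ~ overshoot lam (y k) p v (goe s p (fun k => H k t))] <= (k.+1%:R * q)%:E)%E.
Proof.
move=> hq; have q0 : 0 <= q.
  by rewrite -lee_fin; apply: le_trans (hq 0%N 1%:M (coproj0 n) (leq0n _)).
elim=> [|k IHk] j p v cp jJ kK vp v1 d T P H HG.
all: have pp := coproj_oproj cp; have pp' := deflate_oproj pp v1 vp.
all: have mS : forall k, mxevent (~` overshoot lam (y k) p v) by move=> k';
  exact: (measurableC (mxevent_overshoot lam (y k') v pp)).
all: have cp' := coprojS cp v1 vp.
all: have hQ := hq _ _ cp' (leq_trans (_ : j < _)%N jJ).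
  apply: (@le_trans _ _ (Q (bad_lower (deflate p v)) + 0%:E)%E); last first.
    by rewrite adde0 mul1r hQ// addn0.
  rewrite (goe_arrow_law s HG zG pp v1 vp (mS 0%N)).
  apply: arrow_prob_le => //; first exact: measurable_bad_lower.
  move=> t nbad; exists set0; split; first by rewrite /mxevent (_ : [set f | _] = set0).
    by rewrite (_ : [set f | _] = set0) ?measure0//.
  move=> w /=; apply; apply: overshoot_corner => //; last 2 first.
  - exact: goe_sandwich.
  - rewrite y0 opprD addrA subrr sub0r ltNge; apply/negP => h; apply: nbad; by left.
  by rewrite -scalemxAl -mulmxA; have [_ ->] := pp'.
apply: (@le_trans _ _ (Q (bad_lower (deflate p v)) + (k.+1%:R * q)%:E)%E); last first.
  rewrite -[k.+2%:R]natr1 mulrDl mul1r addrC EFinD; apply: leeD => //; apply: hQ.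
  by rewrite addnS ltnS leqW// leq_addr.
rewrite (goe_arrow_law s HG zG pp v1 vp (mS k.+1)).
apply: arrow_prob_le => //; first exact: measurable_bad_lower.
  by rewrite mulr_ge0.
move=> t nbad.
set g := s *: (hrow (fun k => z k t) *m deflate p v).
have gp : g *m deflate p v = g by rewrite -scalemxAl -mulmxA; have [_ ->] := pp'.
have [h1 h2] : - dl < s * Num.sqrt 2 * z (inl tt) t /\ b2 <= dotr g g.
  split; rewrite ?(leNgt b2) ?(ltNge (- dl)); apply/negP => h; apply: nbad; [by left|right].
  by apply: le_lt_trans h; rewrite /g dotrZl dotrZr mulrA -expr2.
have gg0 : 0 < dotr g g by apply: lt_le_trans h2.
have g0 : g != 0 by rewrite -dotr_eq0 gt_eqF.
have [u [u1 up gu]] := normalize gp g0.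
exists (~` overshoot lam (y k) (deflate p v) u); split.
- exact: (measurableC (mxevent_overshoot lam (y k) u pp')).
- apply: (IHk j.+1) => //; first by rewrite addSnnS.
  exact: ltnW.
move=> w /= hw hn; apply: hw.
apply: (overshoot_lower pp v1 vp gp (goe_sandwich _ _ pp') _ _ _ gu hn).
- exact: yge.
- by rewrite sqrtr_gt0.
rewrite (sqr_sqrtr (ltW gg0)); apply: le_trans h2; apply: le_trans (yS k).
by rewrite ler_wpM2l ?yge//; lra.
Qed.

End lower.

End goe_recursion.

(** * Probabilities of exceptional corners and borders *)

Section bad_events.
Context {R : realType}.
Implicit Types (n : nat).

Lemma measureU_le d (T : measurableType d) (P : probability T R) (A B C : set T) (a b : R) :
  measurable A -> measurable B -> measurable C -> A `<=` B `|` C ->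
  (P B <= a%:E)%E -> (P C <= b%:E)%E -> (P A <= (a + b)%:E)%E.
Proof.
move=> mA mB mC ABC ha hb; apply: (@le_trans _ _ (P (B `|` C))).
  by apply: le_measure; rewrite ?in_setE//; exact: measurableU.
apply: le_trans (measureU2 _ mB mC) _.
by rewrite EFinD; exact: leeD.
Qed.

(** A linear form with unit coefficients has the law of a single standard
    variable, by [gaussian_law_gram] with one vector on each side. *)
Lemma gaussian_projection d (T : measurableType d) (P : probability T R) (I : finType)
    (z : I -> T -> R) (a : I -> R) (S : set R) : std_gaussian P z -> dot a a = 1 -> measurable S ->
  P [set t | S (dot a (fun i => z i t))] = normal_prob 0 1 S.
Proof.
move=> zG a1 mS.
have mS' : measurable [set f : vecT unit | S (f tt)].
  rewrite -[X in measurable X]setTI.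
  exact: (measurable_vec_coord (R := R) tt measurableT).
have := gaussian_law_gram (a := fun _ : unit => a) (b := fun _ _ => 1) zG std_gaussian_unit _ mS'.
rewrite /= => ->; last by move=> _ _; rewrite a1 /dot (big_pred1 tt) ?mulr1//; case.
congr (normal_prob 0 1 _); apply/seteqP; split => x; rewrite /dot /= (big_pred1 tt) ?mul1r//; by case.
Qed.

Lemma gaussian_projection_tail (u : R) d (T : measurableType d) (P : probability T R) (I : finType)
    (z : I -> T -> R) (a : I -> R) : std_gaussian P z -> dot a a = 1 ->
  (P [set t | (u <= dot a (fun i => z i t) ^+ 2)%R] <= (2 * expR (- (u / 4)))%:E)%E.
Proof.
move=> zG a1.
have mS : measurable [set x : R | u <= x ^+ 2].
  rewrite -[X in measurable X]setTI; apply: measurable_fun_ler => //.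
rewrite (gaussian_projection zG a1 mS).
exact: (gaussian_tail u tt std_gaussian_unit).
Qed.

Section tails_of_bad.
Variables (d' : measure_display) (T' : measurableType d') (Q : probability T' R)
  (n : nat) (z : unit + 'I_n -> T' -> R).
Hypothesis zG : std_gaussian Q z.
Local Notation h t := (hrow (fun k => z k t)).

Lemma hrow_projection_tail (u : R) (v : 'rV[R]_n) : dotr v v = 1 ->
  (Q [set t | (u <= dotr v (h t) ^+ 2)%R] <= (2 * expR (- (u / 4)))%:E)%E.
Proof.
move=> v1; pose a (k : unit + 'I_n) := if k is inr i then v 0 i else 0.
have aE f : dot a f = dotr v (hrow f).
  rewrite dotrE /dot big_sumType /= big1 ?add0r; last by move=> i _; rewrite mul0r.
  by apply: eq_bigr => i _; rewrite mxE.
have a1 : dot a a = 1.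
  by rewrite -v1 dotrE /dot big_sumType /= big1 ?add0r// => i _; rewrite mul0r.
have := gaussian_projection_tail u zG a1.
by congr (Q _ <= _)%E; apply/seteqP; split => t /=; rewrite aE.
Qed.

Lemma measurable_dotr_v (v : 'rV[R]_n) :  measurable_fun setT (fun t => dotr v (h t)).
Proof.
have [mz _] := zG; rewrite (_ : (fun t => _) = (fun t => \sum_i v 0 i * z (inr i) t)).
  by apply: measurable_sum => i; apply: measurable_funM.
by apply/funext => t; rewrite dotrE; apply: eq_bigr => i _; rewrite mxE.
Qed.

(** Each deflation removes the square of one standard normal variable, which
    exceeds [u] with small probability. *)
Lemma coproj_tail (A a u : R) : (Q [set t | (dotr (h t) (h t) <= A)%R] <= a%:E)%E ->
  forall j (p : 'M[R]_n), coproj j p ->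
  (Q [set t | (dotr (h t *m p) (h t *m p) <= A - j%:R * u)%R] <=
     (a + j%:R * (2 * expR (- (u / 4))))%:E)%E.
Proof.
have [mz _] := zG; move=> ha j p; elim=> [|{}j {}p v cp IH v1 vp].
  rewrite [X in (_ <= (_ + X)%:E)%E]mul0r addr0 (_ : [set t | _] = [set t | dotr (h t) (h t) <= A])//.
  by apply/seteqP; split => t /=; rewrite mulmx1 mul0r subr0.
have pp := coproj_oproj cp.
rewrite -[j.+1%:R]natr1 [X in (_ <= (_ + X)%:E)%E]mulrDl addrA mul1r.
apply: (measureU_le _ _ _ _ IH (hrow_projection_tail u v1)).
- rewrite -[X in measurable X]setTI; apply: measurable_fun_ler => //.
  exact: measurable_dotr_hrow.
- rewrite -[X in measurable X]setTI; apply: measurable_fun_ler => //.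
  exact: measurable_dotr_hrow.
- rewrite -[X in measurable X]setTI; apply: measurable_fun_ler => //.
  by apply: measurable_funX; exact: measurable_dotr_v.
move=> t /= ht; rewrite (dotr_deflate _ _ pp v1 vp) -expr2.
have [h1|h1] := leP u (dotr v (h t) ^+ 2); first by right.
by left; move: ht; rewrite mulrDl mul1r; lra.
Qed.

Lemma hrow_gaussian : std_gaussian Q (fun i : 'I_n => z (inr i)).
Proof. exact: (std_gaussian_inj (@inr_inj unit 'I_n) zG). Qed.

Lemma dotr_hrowE t : dotr (h t) (h t) = \sum_i z (inr i) t ^+ 2.
Proof. by rewrite dotrE; apply: eq_bigr => i _; rewrite mxE expr2. Qed.

Lemma corner_tail (al dl : R) : al != 0 -> 0 <= dl ->
  (Q [set t | (dl <= `|al * z (inl tt) t|)%R] <= (2 * expR (- (dl ^+ 2 / (4 * al ^+ 2))))%:E)%E.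
Proof.
move=> al0 dl0; have a20 : 0 < al ^+ 2 by rewrite exprn_even_gt0.
have := gaussian_tail (dl ^+ 2 / al ^+ 2) (inl tt) zG.
have -> : dl ^+ 2 / al ^+ 2 / 4 = dl ^+ 2 / (4 * al ^+ 2) by field.
congr (Q _ <= _)%E; apply/seteqP; split => t /=.
  rewrite ler_pdivrMr// mulrC -exprMn => ht.
  by rewrite -(@ler_pXn2r _ 2)// ?nnegrE// real_normK ?num_real.
rewrite ler_pdivrMr// mulrC -exprMn => ht.
by rewrite -[leRHS]real_normK ?num_real// ler_pXn2r ?nnegrE.
Qed.

End tails_of_bad.

Lemma expR_le_min (c1 c2 x : R) : 0 <= x -> expR (- (c1 * x)) <= expR (- (Num.min c1 c2 * x)) /\
   expR (- (c2 * x)) <= expR (- (Num.min c1 c2 * x)).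
Proof.
by move=> x0; split; rewrite ler_expR lerN2 ler_wpM2r// ge_min lexx ?orbT.
Qed.

(** The rate does not depend on the scale [s]: this is what allows the scale to
    vary with the dimension. *)
Lemma bad_upper_tail (e dh : R) : 0 < e -> 0 < dh -> exists2 c : R, 0 < c &
  forall n s d' (T' : measurableType d') (Q : probability T' R) (z : unit + 'I_n -> T' -> R),
  s != 0 -> std_gaussian Q z ->
  (Q (bad_upper s (`|s| * dh * Num.sqrt n%:R) (s ^+ 2 * ((1 + e) * n%:R)) z) <=
   (3 * expR (- (c * n%:R)))%:E)%E.
Proof.
move=> e0 dh0; have [k k0 hk] := chi2_tail_up e0.
have dh2 : 0 < dh ^+ 2 / 8 by rewrite divr_gt0// exprn_gt0.
exists (Num.min (dh ^+ 2 / 8) k); first by rewrite lt_min dh2.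
move=> n s d' T' Q z s0 zG.
have [le1 le2] := expR_le_min (dh ^+ 2 / 8) k (ler0n R n).
set E := expR (- (Num.min _ _ * _)) in le1 le2 *.
have s20 : 0 < s ^+ 2 by rewrite exprn_even_gt0.
have q0 : s * Num.sqrt 2 != 0 by rewrite mulf_neq0// gt_eqF// sqrtr_gt0.
have n0 : 0 <= `|s| * dh * Num.sqrt n%:R by rewrite !mulr_ge0 ?sqrtr_ge0// ltW.
have -> : 3 * E = 2 * E + E by ring.
have [mz _] := zG.
apply: (measureU_le _ _ _ _ (B := [set t | `|s| * dh * Num.sqrt n%:R <= `|s * Num.sqrt 2 * z (inl tt) t|])
  (C := [set t | (1 + e) * n%:R <= \sum_i z (inr i) t ^+ 2])).
- exact: (measurable_bad_upper _ _ _ zG).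
- rewrite -[X in measurable X]setTI; apply: measurable_fun_ler => //.
  by apply: measurableT_comp => //; exact: measurable_funM.
- rewrite -[X in measurable X]setTI; apply: measurable_fun_ler => //.
  by apply: measurable_sumsq => i; exact: mz.
- move=> t [/= ht|/= ht]; [left|right] => /=.
    by apply: (le_trans (ltW ht)); exact: ler_norm.
  by move: ht; rewrite ltr_pM2l// dotr_hrowE => /ltW.
- apply: le_trans (corner_tail zG q0 n0) _.
  rewrite lee_fin ler_wpM2l//; apply: le_trans le1; rewrite ler_expR lerN2.
  rewrite !exprMn real_normK ?num_real// !sqr_sqrtr//.
  rewrite (_ : s ^+ 2 * dh ^+ 2 * n%:R / (4 * (s ^+ 2 * 2)) = dh ^+ 2 / 8 * n%:R)//.
  by field; rewrite ?s0 ?gt_eqF.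
have := hk _ _ _ _ _ (hrow_gaussian zG); rewrite card_ord => /le_trans; apply.
by rewrite lee_fin mulNr.
Qed.

Lemma border_lower_tail (e : R) (J : nat) : 0 < e < 1 -> exists2 c : R, 0 < c &
  forall n d' (T' : measurableType d') (Q : probability T' R) (z : unit + 'I_n -> T' -> R),
  std_gaussian Q z -> forall j (p : 'M[R]_n), coproj j p -> (j <= J)%N ->
  (Q [set t | (dotr (hrow (fun k => z k t) *m p) (hrow (fun k => z k t) *m p) <= (1 - e) * n%:R)%R] <=
   ((1 + 2 * J%:R) * expR (- (c * n%:R)))%:E)%E.
Proof.
move=> /andP[e0 e1]; have e20 : 0 < e / 2 < 1 by apply/andP; split; lra.
have [k k0 hk] := chi2_tail_down e20.
(* half of the defect e is left to the norm of the full vector, the other half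
   is shared by the at most J deflations *)
pose u := e / (2 * J.+1%:R).
have u0 : 0 < u by rewrite divr_gt0// mulr_gt0.
have u4 : 0 < u / 4 by rewrite divr_gt0.
exists (Num.min k (u / 4)); first by rewrite lt_min k0.
move=> n d' T' Q z zG j p cp jJ; have [mz _] := zG.
have [le1 le2] := expR_le_min k (u / 4) (ler0n R n).
set E := expR (- (Num.min _ _ * _)) in le1 le2 *.
have E0 : 0 <= E by exact: expR_ge0.
have hQ : (Q [set t | (dotr (hrow (fun k => z k t)) (hrow (fun k => z k t)) <= (1 - e / 2) * n%:R)%R] <= E%:E)%E.
  have := hk _ _ _ _ _ (hrow_gaussian zG); rewrite card_ord => h.
  apply: (@le_trans _ _ (expR (- k * n%:R))%:E); last by rewrite lee_fin mulNr.
  by move: h; congr (Q _ <= _)%E; apply/seteqP; split => t /=; rewrite dotr_hrowE.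
apply: (@le_trans _ _ (Q [set t | (dotr (hrow (fun k => z k t) *m p) (hrow (fun k => z k t) *m p) <=
    (1 - e / 2) * n%:R - j%:R * (u * n%:R))%R])).
  apply: le_measure; rewrite ?in_setE.
  - rewrite -[X in measurable X]setTI; apply: measurable_fun_ler => //.
    exact: measurable_dotr_hrow.
  - rewrite -[X in measurable X]setTI; apply: measurable_fun_ler => //.
    exact: measurable_dotr_hrow.
  move=> t /= ht; apply: (le_trans ht).
  rewrite mulrA -mulrBl ler_wpM2r//.
  have : j%:R * u <= J.+1%:R * u by rewrite ler_wpM2r ?(ltW u0)// ler_nat ltnW.
  have J0 : J.+1%:R != 0 :> R by rewrite pnatr_eq0.
  have -> : J.+1%:R * u = e / 2.
    by rewrite /u invfM (mulrA e) mulrCA mulfV// mulr1.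
  lra.
apply: le_trans (coproj_tail zG (u * n%:R) hQ cp) _.
have -> : u * n%:R / 4 = u / 4 * n%:R by ring.
have -> : (1 + 2 * J%:R) * E = E + J%:R * (2 * E) by ring.
rewrite lee_fin lerD2l.
apply: (@le_trans _ _ (j%:R * (2 * E))); first by rewrite !ler_wpM2l.
by rewrite ler_wpM2r ?mulr_ge0// ler_nat.
Qed.

Lemma bad_lower_tail (e dh : R) (J : nat) : 0 < e < 1 -> 0 < dh -> exists2 c : R, 0 < c &
  forall n s d' (T' : measurableType d') (Q : probability T' R) (z : unit + 'I_n -> T' -> R),
  s != 0 -> std_gaussian Q z -> forall j (p : 'M[R]_n), coproj j p -> (j <= J)%N ->
  (Q (bad_lower s (`|s| * dh * Num.sqrt n%:R) (s ^+ 2 * ((1 - e) * n%:R)) z p) <=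
   ((3 + 2 * J%:R) * expR (- (c * n%:R)))%:E)%E.
Proof.
move=> e0 dh0; have [k k0 hk] := border_lower_tail J e0.
have dh2 : 0 < dh ^+ 2 / 8 by rewrite divr_gt0// exprn_gt0.
exists (Num.min (dh ^+ 2 / 8) k); first by rewrite lt_min dh2.
move=> n s d' T' Q z s0 zG j p cp jJ.
have [le1 le2] := expR_le_min (dh ^+ 2 / 8) k (ler0n R n).
set E := expR (- (Num.min _ _ * _)) in le1 le2 *.
have s20 : 0 < s ^+ 2 by rewrite exprn_even_gt0.
have q0 : s * Num.sqrt 2 != 0 by rewrite mulf_neq0// gt_eqF// sqrtr_gt0.
have n0 : 0 <= `|s| * dh * Num.sqrt n%:R by rewrite !mulr_ge0 ?sqrtr_ge0// ltW.
have -> : (3 + 2 * J%:R) * E = 2 * E + (1 + 2 * J%:R) * E by ring.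
have [mz _] := zG.
apply: (measureU_le _ _ _ _ (B := [set t | `|s| * dh * Num.sqrt n%:R <= `|s * Num.sqrt 2 * z (inl tt) t|])
  (C := [set t | dotr (hrow (fun k => z k t) *m p) (hrow (fun k => z k t) *m p) <= (1 - e) * n%:R])).
- exact: (measurable_bad_lower _ _ _ zG).
- rewrite -[X in measurable X]setTI; apply: measurable_fun_ler => //.
  by apply: measurableT_comp => //; exact: measurable_funM.
- rewrite -[X in measurable X]setTI; apply: measurable_fun_ler => //.
  exact: measurable_dotr_hrow.
- move=> t [/= ht|/= ht]; [left|right] => /=.
    apply: (@le_trans _ _ (- (s * Num.sqrt 2 * z (inl tt) t))); first by rewrite lerNr.
    by apply: le_trans (ler_norm _) _; rewrite normrN.
  by move: ht; rewrite ltr_pM2l// => /ltW.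
- apply: le_trans (corner_tail zG q0 n0) _.
  rewrite lee_fin ler_wpM2l//; apply: le_trans le1; rewrite ler_expR lerN2.
  rewrite !exprMn real_normK ?num_real// !sqr_sqrtr//.
  rewrite (_ : s ^+ 2 * dh ^+ 2 * n%:R / (4 * (s ^+ 2 * 2)) = dh ^+ 2 / 8 * n%:R)//.
  by field; rewrite ?s0 ?gt_eqF.
apply: le_trans (hk _ _ _ _ _ zG _ _ cp jJ) _.
by rewrite lee_fin ler_wpM2l// addr_ge0// mulr_ge0.
Qed.

End bad_events.

(** * The quadratic form of a tensor contraction *)

Section multilinear.
Context {R : realType}.
Variables (r n : nat).
Implicit Types (A : r.-tuple 'I_n -> R) (S : comNzRingType).

(** The weights may depend on the position, so that two slots can be singled
    out from the others. *)
Definition mon (S : comNzRingType) (c : 'I_r -> 'I_n -> S) (k : r.-tuple 'I_n) : S :=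
  \prod_a c a (tnth k a).

Lemma sum_mon (S : comNzRingType) (c : 'I_r -> 'I_n -> S) :
  \sum_k mon c k = \prod_a \sum_i c a i.
Proof.
rewrite bigA_distr_bigA /=.
rewrite (reindex (fun k : r.-tuple 'I_n => [ffun a => tnth k a])) /=.
  by apply: eq_bigr => k _; apply: eq_bigr => a _; rewrite ffunE.
exists (fun f : {ffun 'I_r -> 'I_n} => [tuple f a | a < r]) => [k _|f _].
  by apply: eq_from_tnth => a; rewrite tnth_mktuple ffunE.
by apply/ffunP => a; rewrite ffunE tnth_mktuple.
Qed.

Definition permt (s : {perm 'I_r}) (k : r.-tuple 'I_n) : r.-tuple 'I_n := [tuple tnth k (s a) | a < r].

Lemma permt_perm s k : perm_eq (permt s k) k.
Proof. by apply/tuple_permP; exists s. Qed.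

Lemma mon_permt (S : comNzRingType) (c : 'I_r -> 'I_n -> S) (s : {perm 'I_r}) k :
  mon (fun a => c (s a)) (permt s k) = mon c k.
Proof.
rewrite /mon [RHS](reindex_perm s) /=; apply: eq_bigr => a _.
by rewrite tnth_mktuple.
Qed.

(** Permuting the slots only permutes the multi-indices, and [A] is symmetric.
    *)
Lemma sum_mon_perm A (c : 'I_r -> 'I_n -> R) (s : {perm 'I_r}) : symmetric_tensor A ->
  \sum_k A k * mon (fun a => c (s a)) k = \sum_k A k * mon c k.
Proof.
move=> Asym; rewrite (reindex (permt s)) /=.
  by apply: eq_bigr => k _; rewrite mon_permt (Asym _ k)// permt_perm.
exists (permt s^-1%g) => k _; apply: eq_from_tnth => a.
  by rewrite !tnth_mktuple permKV.
by rewrite !tnth_mktuple permK.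
Qed.

End multilinear.

Section contraction.
Context {R : realType}.
Variables (m n : nat).
Local Notation r := m.+2.
Implicit Types (A : r.-tuple 'I_n -> R) (w x y : 'rV[R]_n).

Let i0 : 'I_r := ord0.
Let i1 : 'I_r := lift ord0 ord0.

Definition two_slots (x y w : 'rV[R]_n) (a : 'I_r) (i : 'I_n) : R :=
  if a == i0 then x 0 i else if a == i1 then y 0 i else w 0 i.

Lemma mon_two_slots x y w k :
  mon (two_slots x y w) k =
  x 0 (tnth k i0) * y 0 (tnth k i1) * \prod_(l <- drop 2 k) w 0 l.
Proof.
rewrite /mon big_ord_recl big_ord_recl mulrA; congr (_ * _ * _).
case/tupleP: k => a k; case/tupleP: k => b k /=.
rewrite drop0 big_tuple; apply: eq_bigr => i _.
by rewrite /two_slots /= !tnthS.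
Qed.

Lemma take2_tuple (k : r.-tuple 'I_n) : take 2 k = [:: tnth k i0; tnth k i1].
Proof.
have E (d : 'I_n) : take 2 k = [:: nth d k 0; nth d k 1].
  by have := size_tuple k; case: (tval k) => [|a [|b l]] //= _; rewrite take0.
by rewrite (E (tnth k i0)) -(tnth_nth _ k i0) -(tnth_nth _ k i1).
Qed.

Lemma bform_contraction A w x y :
  bform (tensor_contraction A w) x y = \sum_k A k * mon (two_slots x y w) k.
Proof.
rewrite bformE.
transitivity (\sum_i \sum_j \sum_(k : r.-tuple 'I_n | take 2 k == [:: i; j])
    A k * mon (two_slots x y w) k).
  apply: eq_bigr => i _; apply: eq_bigr => j _.
  rewrite mxE mulr_sumr mulr_suml; apply: eq_bigr => k.
  by rewrite take2_tuple mon_two_slots => /eqP[-> ->]; ring.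
under eq_bigr do rewrite (exchange_big_dep predT)//=.
rewrite exchange_big /=; apply: eq_bigr => k _.
rewrite take2_tuple (bigD1 (tnth k i0))//= [X in _ + X]big1 ?addr0; last first.
  by move=> i ii0; rewrite big1// => j /eqP[ei]; rewrite ei eqxx in ii0.
rewrite (bigD1 (tnth k i1))//= big1 ?addr0// => j /andP[] /eqP[->].
by rewrite eqxx.
Qed.

Lemma contraction_sym A w : symmetric_tensor A ->
  (tensor_contraction A w)^T = tensor_contraction A w.
Proof.
move=> Asym; apply/matrixP => i j; rewrite mxE.
have E k l : tensor_contraction A w k l = bform (tensor_contraction A w) (delta_mx 0 k) (delta_mx 0 l).
  by rewrite /bform -rowE trmx_delta -colE !mxE.
rewrite !E !bform_contraction -[LHS](sum_mon_perm _ (tperm i0 i1) Asym).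
apply: eq_bigr => k _; congr (_ * _); apply: eq_bigr => a _.
rewrite /two_slots; case: tpermP => [->|->|/eqP/negbTE -> /eqP/negbTE ->] //=.
Qed.

(** The coefficient of [X^2] in the product over the slots of [w + X y] puts
    [y] in two slots in all possible ways; by symmetry every choice contributes
    the quadratic form of the contraction. *)
Lemma contraction_coef A w y : symmetric_tensor A ->
  ('C(r, 2))%:R * bform (tensor_contraction A w) y y =
  \sum_k A k * (\prod_a ((w 0 (tnth k a))%:P + (y 0 (tnth k a))%:P * 'X))`_2.
Proof.
move=> Asym.
pose c (E : {set 'I_r}) (a : 'I_r) (i : 'I_n) : R := if a \in E then y 0 i else w 0 i.
have coefE k : (\prod_a ((w 0 (tnth k a))%:P + (y 0 (tnth k a))%:P * 'X))`_2 =
    \sum_(E : {set 'I_r} | #|E| == 2) mon (c E) k.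
  rewrite (eq_bigr (fun a => (y 0 (tnth k a))%:P * 'X + (w 0 (tnth k a))%:P)); last first.
    by move=> a _; rewrite addrC.
  rewrite bigA_distr coef_sum [RHS]big_mkcond /=; apply: eq_bigr => E _.
  have -> : \prod_i (if i \in E then (y 0 (tnth k i))%:P * 'X else (w 0 (tnth k i))%:P) =
      (mon (c E) k)%:P * 'X^#|E|.
    rewrite /mon rmorph_prod /= -prodr_const.
    rewrite [X in _ = _ * X]big_mkcond /= -big_split /=; apply: eq_bigr => a _.
    by rewrite /c; case: (a \in E); rewrite ?mulr1.
  by rewrite coefCM coefXn eq_sym; case: eqP => _; rewrite ?mulr1 ?mulr0.
under eq_bigr do rewrite coefE mulr_sumr.
rewrite exchange_big /=.
have -> : ('C(r, 2))%:R = \sum_(E : {set 'I_r} | #|E| == 2) 1 :> R.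
  rewrite -[X in 'C(X, 2)](card_ord r) -card_draws -sum1_card natr_sum.
  by apply: eq_bigl => E; rewrite inE.
rewrite mulr_suml; apply: eq_bigr => E cE; have /cards2P[a [b [ab ->]]] := cE.
rewrite mul1r bform_contraction.
pose b' := tperm i0 a b.
pose s : {perm 'I_r} := (tperm i1 b' * tperm i0 a)%g.
have b'0 : b' != i0.
  apply: contra_neq ab => h; have := congr1 (tperm i0 a) h.
  by rewrite /b' tpermK tpermL.
have s0 : s i0 = a.
  by rewrite permM (tpermD (x := i1)) ?tpermL.
have s1 : s i1 = b by rewrite permM tpermL /b' tpermK.
rewrite -[RHS](sum_mon_perm _ s Asym); apply: eq_bigr => k _; congr (_ * _).
apply: eq_bigr => d _; rewrite /c /two_slots !inE -{1}s0 -s1 !(inj_eq perm_inj).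
by case: (d == i0); case: (d == i1).
Qed.

Lemma coef2M (p q : {poly R}) : (p * q)`_2 = p`_0 * q`_2 + p`_1 * q`_1 + p`_2 * q`_0.
Proof. by rewrite coefM !big_ord_recl big_ord0 /= addr0 addrA. Qed.

Lemma coef1M (p q : {poly R}) : (p * q)`_1 = p`_0 * q`_1 + p`_1 * q`_0.
Proof. by rewrite coefM !big_ord_recl big_ord0 /= addr0. Qed.

Lemma coef_lin (a b : R) : ((a%:P + b%:P * 'X)`_0 = a) * ((a%:P + b%:P * 'X)`_1 = b) *
  ((a%:P + b%:P * 'X)`_2 = 0).
Proof. by rewrite !coefD !coefC !coefMX !coefC /= !addr0 add0r. Qed.

(** The factor 2 avoids a division in the binomial coefficient. *)
Lemma coef_pow (q : R) k : let p := (1%:P + q%:P * 'X) ^+ k in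
  [/\ p`_0 = 1, p`_1 = k%:R * q & 2 * p`_2 = k%:R * (k%:R - 1) * q ^+ 2].
Proof.
elim: k => [|k [h0 h1 h2]] /=.
  by rewrite expr0 !coefC /= !mul0r mulr0.
rewrite exprS coef0M coef1M coef2M !coef_lin h0 h1 -natr1.
by split; [ring|ring|rewrite !mulrDr mul1r h2; ring].
Qed.

(** The two sides of the covariance of the contraction are treated differently:
    [x] sits in the first two slots, whereas [y] is spread over all pairs of
    slots through a coefficient. The sum over multi-indices then factorizes
    over the slots into [(<x, w> + <x, y> X)^2 (1 + <w, y> X)^m], whose
    coefficient of [X^2] is explicit. *)
Lemma sum_slots_coef w x y : dotr w w = 1 ->
  2 * \sum_k mon (two_slots x x w) k *
    (\prod_a ((w 0 (tnth k a))%:P + (y 0 (tnth k a))%:P * 'X))`_2 =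
  2 * dotr x y ^+ 2 + 4 * m%:R * dotr w x * dotr w y * dotr x y +
  m%:R * (m%:R - 1) * dotr w x ^+ 2 * dotr w y ^+ 2.
Proof.
move=> w1.
have -> : \sum_k mon (two_slots x x w) k *
    (\prod_a ((w 0 (tnth k a))%:P + (y 0 (tnth k a))%:P * 'X))`_2 =
   (\sum_k mon (fun a i => (two_slots x x w a i)%:P * ((w 0 i)%:P + (y 0 i)%:P * 'X)) k)`_2.
  rewrite coef_sum; apply: eq_bigr => k _; rewrite -coefCM /mon rmorph_prod /=.
  by rewrite -big_split.
rewrite sum_mon.
have lin (u : 'rV[R]_n) : \sum_i (u 0 i)%:P * ((w 0 i)%:P + (y 0 i)%:P * 'X) =
    (dotr u w)%:P + (dotr u y)%:P * 'X.
  rewrite !dotrE !rmorph_sum /= mulr_suml -big_split /=; apply: eq_bigr => i _.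
  by rewrite mulrDr mulrA !polyCM.
rewrite big_ord_recl big_ord_recl /=.
have -> : \prod_(a < m) \sum_i (two_slots x x w (lift ord0 (lift ord0 a)) i)%:P *
     ((w 0 i)%:P + (y 0 i)%:P * 'X) = (1%:P + (dotr w y)%:P * 'X) ^+ m.
  rewrite (eq_bigr (fun _ => 1%:P + (dotr w y)%:P * 'X)) ?prodr_const ?card_ord//.
  by move=> a _; rewrite -w1 -(lin w); apply: eq_bigr.
have -> : \sum_i (two_slots x x w ord0 i)%:P * ((w 0 i)%:P + (y 0 i)%:P * 'X) =
   (dotr x w)%:P + (dotr x y)%:P * 'X by rewrite -(lin x); apply: eq_bigr.
have E1 : \sum_i (two_slots x x w (lift ord0 ord0) i)%:P * ((w 0 i)%:P + (y 0 i)%:P * 'X) =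
   (dotr x w)%:P + (dotr x y)%:P * 'X by rewrite -(lin x); apply: eq_bigr.
have [h0 h1 h2] := coef_pow (dotr w y) m.
rewrite ?E1 mulrA coef2M coef0M coef1M coef2M !coef_lin h0 h1 (dotrC x w).
rewrite mulrDr mulrDr (_ : 2 * (dotr w x * dotr w x * _) = dotr w x ^+ 2 * (2 * ((1%:P + (dotr w y)%:P * 'X) ^+ m)`_2)); last by ring.
rewrite h2; ring.
Qed.

End contraction.

(** * The law of the contraction *)

Section gote.
Context {R : realType}.
Variables (d : measure_display) (T : measurableType d) (P : probability T R).
Variables (m n : nat) (G : m.+2.-tuple 'I_n -> {RV P >-> R}) (w : 'rV[R]_n).
Local Notation r := m.+2.
Hypotheses (hG : GOTE G) (w1 : dotr w w = 1).

Let leI (i j : 'I_n) : bool := (i <= j)%N.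

(** Distinct multisets correspond to distinct sorted multi-indices, so these
    index the independent entries. *)
Definition canon (k : r.-tuple 'I_n) : r.-tuple 'I_n := [tuple of sort leI k].

Lemma canon_perm k : perm_eq (canon k) k.
Proof. by rewrite /canon /= perm_sort. Qed.

Lemma canon_eq k l : (canon k == canon l) = perm_eq k l.
Proof.
have tot : total leI by move=> i j; exact: leq_total.
have tra : transitive leI by move=> i j k'; exact: leq_trans.
have ant : antisymmetric leI by move=> i j h; apply/val_inj/anti_leq.
apply/eqP/idP => [h|/(perm_sortP tot tra ant) h]; last exact: val_inj.
by apply/(perm_sortP tot tra ant); move: h => /(congr1 val).
Qed.

Definition multiset := {k : r.-tuple 'I_n | canon k == k}.

Definition entry_sd (k : r.-tuple 'I_n) : R := Num.sqrt (r%:R / (num_perm k)%:R).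

Lemma num_perm_gt0 (k : r.-tuple 'I_n) : (0 < num_perm k)%N.
Proof. by apply/card_gt0P; exists k; rewrite inE. Qed.

Lemma entry_sd_gt0 k : 0 < entry_sd k.
Proof. by rewrite sqrtr_gt0 divr_gt0// ltr0n num_perm_gt0. Qed.

Lemma entry_sd_sqr k : entry_sd k ^+ 2 = r%:R / (num_perm k)%:R.
Proof. by rewrite sqr_sqrtr// divr_ge0. Qed.

Definition std_entry (k : multiset) (t : T) : R := G (val k) t / entry_sd (val k).

(** Independence over the set of all sorted multi-indices, each entry being
    divided by its standard deviation. *)
Lemma std_entry_gaussian : std_gaussian P std_entry.
Proof.
have [_ hlaw hind] := hG; split; first by move=> k; apply: measurable_funM.
move=> B mB.
pose J : {set r.-tuple 'I_n} := [set k | canon k == k]%SET.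
pose C (k : r.-tuple 'I_n) : set R :=
  if insub k is Some i then [set x | B i (x / entry_sd k)] else setT.
have mC k : measurable (C k).
  rewrite /C; case: insub => // i; rewrite -[X in measurable X]setTI.
  by apply: (measurable_funM (f := id) (g := cst (entry_sd k)^-1)).
have Cval (i : multiset) : C (val i) = [set x | B i (x / entry_sd (val i))].
  by rewrite /C valK.
have hJ k l : k \in J -> l \in J -> perm_eq k l -> k = l.
  by rewrite !inE => /eqP {2}<- /eqP {2}<-; rewrite -canon_eq => /eqP.
have := hind J hJ C mC.
rewrite (_ : [set t | _] = [set t | forall i, B i (std_entry i t)]); last first.
  apply/seteqP; split => t /= h.
    by move=> i; have := h (val i); rewrite inE (valP i) Cval; apply.
  move=> k; rewrite inE => kJ; pose i : multiset := exist _ k kJ.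
  by have := h i; rewrite -[k]/(val i) Cval.
move=> ->; rewrite (reindex_omap (val : multiset -> _) insub) /=; last first.
  by move=> k; rewrite inE => kJ; rewrite insubT.
apply: eq_big => [i|i _]; first by rewrite inE (valP i) valK eqxx.
rewrite Cval; have := hlaw (val i) _ (mC (val i)); rewrite Cval /distribution /pushforward => ->.
exact: normal_prob_scale (entry_sd_gt0 _) (mB i).
Qed.

Definition same_multiset (k l : r.-tuple 'I_n) : R := (perm_eq l k)%:R.

(** The contraction is the sum of these matrices with independent standard
    Gaussian coefficients, see [tensor_contraction_mxcomb]. *)
Definition entry_mx (k : multiset) : 'M[R]_n :=
  entry_sd (val k) *: tensor_contraction (same_multiset (val k)) w.

Lemma same_multiset_sym (k : r.-tuple 'I_n) : symmetric_tensor (same_multiset k).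
Proof. by move=> l l' ll'; rewrite /same_multiset (permPl ll'). Qed.

Lemma entry_mx_sym k : (entry_mx k)^T = entry_mx k.
Proof. by rewrite /entry_mx linearZ /= (contraction_sym _ (@same_multiset_sym _)). Qed.

Lemma sum_multiset (F : r.-tuple 'I_n -> R) (c : r.-tuple 'I_n -> R) :
  symmetric_tensor c ->
  \sum_(k : multiset) c (val k) * (\sum_l same_multiset (val k) l * F l) = \sum_l c l * F l.
Proof.
move=> csym; under eq_bigr do rewrite mulr_sumr.
rewrite exchange_big /=; apply: eq_bigr => l _.
have cl : canon (canon l) == canon l by rewrite canon_eq canon_perm.
rewrite (bigD1 (exist _ (canon l) cl : multiset))//= big1 ?addr0; last first.
  move=> k kl; rewrite /same_multiset (_ : perm_eq l (val k) = false) ?mul0r ?mulr0//.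
  apply: contraNF kl => lk; apply/eqP/val_inj => /=.
  by rewrite -(eqP (valP k)); apply/esym/eqP; rewrite canon_eq.
by rewrite /same_multiset perm_sym canon_perm mul1r (csym _ l)// canon_perm.
Qed.

Lemma tensor_contraction_mxcomb t :
  tensor_contraction (fun k => G k t) w = mxcomb entry_mx (fun k => std_entry k t).
Proof.
have [Gsym _ _] := hG; apply/matrixP => i j; rewrite /mxcomb summxE mxE.
transitivity (\sum_l G l t * ((take 2 l == [:: i; j])%:R * \prod_(a <- drop 2 l) w 0 a)).
  by rewrite big_mkcond; apply: eq_bigr => l _; case: eqP; rewrite ?mul1r ?mul0r ?mulr0.
rewrite -(sum_multiset _ (Gsym t)); apply: eq_bigr => k _.
rewrite mxE /entry_mx mxE /std_entry mulrA divfK ?gt_eqF ?entry_sd_gt0// mxE.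
congr (_ * _); rewrite [RHS]big_mkcond /=; apply: eq_bigr => l _.
by case: eqP; rewrite ?mul1r ?mul0r ?mulr0.
Qed.

Lemma num_permE (k : r.-tuple 'I_n) : \sum_l same_multiset k l = (num_perm k)%:R :> R.
Proof. by rewrite /num_perm -sum1_card natr_sum [RHS]big_mkcond /=; apply: eq_bigr => l _; rewrite inE /same_multiset; case: perm_eq. Qed.

(** The variance [r / num_perm k] of an entry cancels the number of
    multi-indices in its class, so that the sum over multisets becomes the sum
    over all multi-indices of [sum_slots_coef]. Writing [<x, y> - <w, x> <w,
    y>] for the product of the parts orthogonal to [w] exhibits the corner, the
    border and the block. *)
Lemma entry_cov x y :
  \sum_k bform (entry_mx k) x x * bform (entry_mx k) y y =
  r%:R * dotr w x ^+ 2 * dotr w y ^+ 2 +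
  4 * dotr w x * dotr w y * (dotr x y - dotr w x * dotr w y) +
  2 / (r%:R - 1) * (dotr x y - dotr w x * dotr w y) ^+ 2.
Proof.
pose U (l : r.-tuple 'I_n) := mon (two_slots x x w) l.
pose V (l : r.-tuple 'I_n) := (\prod_a ((w 0 (tnth l a))%:P + (y 0 (tnth l a))%:P * 'X))`_2.
have Vsym : symmetric_tensor V.
  move=> k l /tuple_permP[s ks]; rewrite /V.
  pose f (i : 'I_n) : {poly R} := (w 0 i)%:P + (y 0 i)%:P * 'X.
  suff -> : \prod_(a < r) f (tnth k a) = \prod_(a < r) f (tnth l a) by [].
  rewrite [RHS](reindex_perm s) /=; apply: eq_bigr => a _.
  by rewrite (val_inj ks) tnth_mktuple.
have key k : ('C(r, 2))%:R * (bform (entry_mx k) x x * bform (entry_mx k) y y) =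
    r%:R * (V (val k) * \sum_l same_multiset (val k) l * U l).
  rewrite /entry_mx !bformZ bform_contraction -/U.
  set S := \sum_l _ * _.
  have hV := contraction_coef w y (@same_multiset_sym (val k)).
  have sV : \sum_l same_multiset (val k) l * V l = (num_perm (val k))%:R * V (val k).
    rewrite -num_permE mulr_suml; apply: eq_bigr => l _.
    by rewrite /same_multiset; case: (boolP (perm_eq l (val k))) => lk; rewrite ?mul0r// (Vsym _ _ lk).
  rewrite -/V sV in hV.
  transitivity (entry_sd (val k) ^+ 2 * S * ('C(r, 2)%:R * bform (tensor_contraction (same_multiset (val k)) w) y y)); first by ring.
  rewrite hV entry_sd_sqr.
  have np0 : (num_perm (val k))%:R != 0 :> R by rewrite pnatr_eq0 -lt0n num_perm_gt0.
  transitivity (r%:R / (num_perm (val k))%:R * (num_perm (val k))%:R * (V (val k) * S)); first by ring.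
  by rewrite divfK.
have r1 : r%:R - 1 = m.+1%:R :> R by rewrite -(natr1 m.+1) addrK.
have C2 : 2 * ('C(r, 2))%:R = r%:R * (r%:R - 1) :> R.
  have o : odd (r * m.+1) = false by rewrite oddM /= negbK andbN.
  rewrite r1 -!natrM; congr (_%:R).
  by rewrite bin2 /= -[RHS]odd_double_half o add0n mul2n.
have m0 : (m.+1%:R : R) != 0 by rewrite pnatr_eq0.
have r0 : (r%:R : R) != 0 by rewrite pnatr_eq0.
have C0 : 2 * ('C(r, 2))%:R != 0 :> R by rewrite C2 r1 mulf_neq0.
have hsum : ('C(r, 2))%:R * (\sum_k bform (entry_mx k) x x * bform (entry_mx k) y y) =
    r%:R * (\sum_l U l * V l).
  rewrite mulr_sumr (eq_bigr _ (fun k _ => key k)) -mulr_sumr (sum_multiset _ Vsym).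
  by congr (_ * _); apply: eq_bigr => l _; rewrite mulrC.
apply: (mulfI C0); rewrite -[LHS]mulrA hsum mulrCA.
rewrite (sum_slots_coef m x y w1) C2 r1.
have rE : r%:R = m%:R + 2 :> R by rewrite -natrD addn2.
have mE : m.+1%:R = m%:R + 1 :> R by rewrite natr1.
rewrite mE in m0 *; rewrite rE; field; exact: m0.
Qed.

(** Along [w] the contraction splits into a corner of variance [r], a standard
    border and an independent GOE block of scale [(r - 1)^(-1/2)]: by
    [entry_cov] both sides have the same covariance. The sign [c] is free
    because the law is symmetric, and it reduces the smallest eigenvalue to the
    largest one. *)
Lemma contraction_law (c : R) d1 (T1 : measurableType d1) (Q : probability T1 R)
    d2 (T2 : measurableType d2) (P2 : probability T2 R)
    (z : unit + 'I_n -> T1 -> R) (H : 'I_n * 'I_n -> T2 -> R) (S : set 'M[R]_n) :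
  c ^+ 2 = 1 -> std_gaussian Q z -> std_gaussian P2 H -> mxevent S ->
  P [set t | S (c *: tensor_contraction (fun k => G k t) w)] =
  prodP Q P2 [set t | S (arrow (Num.sqrt r%:R * z (inl tt) t.1) w
                (1 *: (hrow (fun k => z k t.1) *m deflate 1%:M w))
                (goe (Num.sqrt (r%:R - 1))^-1 (deflate 1%:M w) (fun k => H k t.2)))].
Proof.
move=> c1 zG HG mS.
have wp : w *m 1%:M = w by rewrite mulmx1.
have pp' := deflate_oproj (oproj1 n) w1 wp; have [pt' _] := pp'.
have := law_sym std_entry_gaussian (std_gaussian_prod zG HG) (A := fun k => c *: entry_mx k)
  (B := arrow_basis (Num.sqrt r%:R) 1 (Num.sqrt (r%:R - 1))^-1 w (deflate 1%:M w)) _ _ _ mS.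
move=> h; rewrite (_ : [set t | _] = [set t | S (mxcomb (fun k => c *: entry_mx k) (fun k => std_entry k t))]); last first.
  apply/seteqP; split => t /=; rewrite tensor_contraction_mxcomb /mxcomb scaler_sumr;
  by under eq_bigr do rewrite scalerA mulrC -scalerA.
have r1 : r%:R - 1 = m.+1%:R :> R by rewrite -(natr1 m.+1) addrK.
rewrite h => [|k|k|x y].
- by congr (prodP Q P2 _); apply/seteqP; split => t /=; rewrite arrow_basisE.
- by rewrite linearZ /= entry_mx_sym.
- exact: arrow_basis_sym.
rewrite (eq_bigr (fun k => bform (entry_mx k) x x * bform (entry_mx k) y y)); last first.
  by move=> k _; rewrite !bformZ mulrACA -expr2 c1 mul1r.
rewrite entry_cov arrow_cov//.
have -> : dotr (x *m deflate 1%:M w) (y *m deflate 1%:M w) = dotr x y - dotr w x * dotr w y.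
  have := dotr_deflate x y (oproj1 n) w1 wp; rewrite !mulmx1 => ->; ring.
rewrite sqr_sqrtr// exprVn sqr_sqrtr ?r1// expr1n; ring.
Qed.

End gote.

(** * Extreme eigenvalues at a fixed order *)

Section part_a.
Context {R : realType}.

Lemma contraction_law_ge2 (d : measure_display) (T : measurableType d) (P : probability T R)
    (r n : nat) (G : r.-tuple 'I_n -> {RV P >-> R}) (w : 'rV[R]_n)
    (c : R) d1 (T1 : measurableType d1) (Q : probability T1 R)
    d2 (T2 : measurableType d2) (P2 : probability T2 R)
    (z : unit + 'I_n -> T1 -> R) (H : 'I_n * 'I_n -> T2 -> R) (S : set 'M[R]_n) :
  (2 <= r)%N -> GOTE G -> dotr w w = 1 ->
  c ^+ 2 = 1 -> std_gaussian Q z -> std_gaussian P2 H -> mxevent S ->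
  P [set t | S (c *: tensor_contraction (fun k => G k t) w)] =
  prodP Q P2 [set t | S (arrow (Num.sqrt r%:R * z (inl tt) t.1) w
                (1 *: (hrow (fun k => z k t.1) *m deflate 1%:M w))
                (goe (Num.sqrt (r%:R - 1))^-1 (deflate 1%:M w) (fun k => H k t.2)))].
Proof.
case: r G => [|[|m]] // G _ hG w1; exact: contraction_law.
Qed.

Lemma contraction_trmx (d : measure_display) (T : measurableType d) (P : probability T R)
    (r n : nat) (G : r.-tuple 'I_n -> {RV P >-> R}) (w : 'rV[R]_n) c t :
  (2 <= r)%N -> GOTE G ->
  (c *: tensor_contraction (fun k => G k t) w)^T = c *: tensor_contraction (fun k => G k t) w.
Proof.
case: r G => [|[|m]] // G _ [Gsym _ _].
by rewrite linearZ /= (contraction_sym _ (Gsym t)).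
Qed.

(** The scale of the GOE block relative to the border: it is smaller than one,
    so that the direction [w] is heavier than the others, and this moves the
    edges away from the spectrum of the block. *)
Definition gap_scale (r : nat) : R := (Num.sqrt (r%:R - 1))^-1.

Lemma gap_scale_gt0 r : (2 <= r)%N -> 0 < gap_scale r.
Proof. by move=> r2; rewrite invr_gt0 sqrtr_gt0 subr_gt0 ltr1n. Qed.

Lemma gap_scale_sqr r : (2 <= r)%N -> gap_scale r ^+ 2 = (r%:R - 1)^-1.
Proof. by move=> r2; rewrite exprVn sqr_sqrtr// subr_ge0 ler1n ltnW. Qed.

Lemma gap_scale_le1 r : (2 <= r)%N -> gap_scale r <= 1.
Proof.
move=> r2; have h : 1 <= Num.sqrt (r%:R - 1) :> R.
  rewrite -[leLHS]sqrtr1 ler_wsqrtr// lerBrDr -[1 + 1]/(1%:R + 1%:R) -natrD ler_nat; exact: r2.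
by rewrite /gap_scale invf_le1// (lt_le_trans ltr01).
Qed.

Section varpi.
Variable r : nat.
Hypothesis r3 : (3 <= r)%N.
Local Notation om := (varpi R r).
Local Notation sg := (gap_scale r).

Let r2 : (2 <= r)%N. Proof. exact: ltnW. Qed.
Let p1 : 0 < r%:R - 1 :> R. Proof. by rewrite subr_gt0 ltr1n. Qed.
Let p2 : 0 < r%:R - 2 :> R. Proof. by rewrite subr_gt0 ltr_nat. Qed.

Lemma varpi_gt0 : 0 < om.
Proof. by rewrite mulr_gt0 ?invr_gt0 ?addr_gt0 ?invr_gt0 ?sqrtr_gt0. Qed.

Lemma varpi_sqr : om ^+ 2 = (r%:R - 1) / (r%:R - 2).
Proof.
rewrite /varpi exprMn exprVn sqr_sqrtr ?ltW// sqrrD exprVn sqr_sqrtr ?ltW//.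
rewrite mulfV ?gt_eqF ?sqrtr_gt0//; field.
by rewrite !gt_eqF.
Qed.

(** The edge solves the scalar equation of the outlier: with border of length
    [sqrt n] and block of scale [sg], the first pivot is [1 / om] and the
    remaining pivots must sustain it. *)
Lemma varpi_fixpoint : om^-1 + sg ^+ 2 * om = om.
Proof.
have o0 := varpi_gt0; apply: (@mulfI _ om); first by rewrite gt_eqF.
rewrite mulrDr mulfV ?gt_eqF// mulrCA -expr2 gap_scale_sqr// varpi_sqr.
by field; rewrite !gt_eqF.
Qed.

(** The map [y |-> y + sg^2 / y] increases beyond [sg], and [1 / om] lies in
    that range because [r >= 3]. *)
Lemma gap_scale_varpi : sg ^+ 2 <= om^-1 ^+ 2.
Proof.
rewrite gap_scale_sqr// exprVn varpi_sqr invf_div -[leLHS]mul1r ler_pM2r ?invr_gt0//.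
rewrite lerBrDr -[1 + 2]/(1%:R + 2%:R) -natrD ler_nat; exact: r3.
Qed.

(** Below the edge the continued fraction has no fixed point above [1 / om]: as
    long as it stays above, every step decreases it by at least [th]. *)
Lemma pivot_descent (lam' b2 : R) (y : nat -> R) (th : R) :
  0 < th -> th <= om^-1 -> 0 <= b2 -> b2 <= om^-1 ^+ 2 ->
  th + lam' <= om^-1 + b2 * om ->
  (forall k, y k.+1 = Num.max 0 (lam' - b2 / y k)) ->
  exists K, y K <= om^-1.
Proof.
move=> th0 thom b20 b2om hth yS; have o0 := varpi_gt0.
apply: contrapT => h0.
have h k : om^-1 < y k by rewrite ltNge; apply/negP => ?; apply: h0; exists k.
have dec k : y k.+1 <= y k - th.
  have hk := h k; have yk0 : 0 < y k by apply: lt_trans hk; rewrite invr_gt0.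
  rewrite yS ge_max; apply/andP; split; first by rewrite subr_ge0 (le_trans thom)// ltW.
  have : om^-1 + b2 * om <= y k + b2 / y k.
    rewrite -subr_ge0.
    have -> : y k + b2 / y k - (om^-1 + b2 * om) = (y k - om^-1) * (1 - b2 * om / y k).
      by field; rewrite !gt_eqF.
    apply: mulr_ge0; first by rewrite subr_ge0 ltW.
    rewrite subr_ge0 ler_pdivrMr// mul1r; apply: le_trans (ltW hk).
    apply: (le_trans (ler_wpM2r (ltW o0) b2om)).
    by rewrite expr2 -mulrA mulVf ?mulr1// gt_eqF.
  lra.
have hn k : y k <= y 0%N - k%:R * th.
  elim: k => [|k IH]; first by rewrite mul0r subr0.
  apply: (le_trans (dec k)); rewrite -natr1 mulrDl mul1r; lra.
have [k hk] : exists k : nat, y 0%N < k%:R * th.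
  exists (Num.truncn (y 0%N / th)).+1; rewrite -ltr_pdivrMr//; exact: truncnS_gt.
have := le_lt_trans (hn k) (_ : _ < 0); rewrite subr_lt0 => /(_ hk).
by apply/negP; rewrite -leNgt ltW// (lt_trans _ (h k))// invr_gt0.
Qed.

End varpi.

(** Two exponential bounds are absorbed into one with the smaller rate. *)
Lemma merge_exp (a b c1 c2 x y : R) : 0 <= a -> 0 <= b -> 0 <= x -> 1 <= y -> 
  a * expR (- (c1 * x)) + b * y * expR (- (c2 * x)) <=
  (a + b) * y * expR (- (Num.min c1 c2 * x)).
Proof.
move=> a0 b0 x0 y1; have [le1 le2] := expR_le_min c1 c2 x0.
have y0 : 0 <= y by apply: le_trans y1.
rewrite [leRHS](_ : _ = a * (y * expR (- (Num.min c1 c2 * x))) + b * y * expR (- (Num.min c1 c2 * x))); last by ring.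
apply: lerD; last by rewrite ler_wpM2l// mulr_ge0.
apply: ler_wpM2l => //; apply: (le_trans le1).
by rewrite -[leLHS]mul1r ler_wpM2r// expR_ge0.
Qed.

Section fixed_order.
Variable r : nat.
Hypothesis r3 : (3 <= r)%N.
Local Notation om := (varpi R r).
Local Notation sg := (gap_scale r).
Let r2 : (2 <= r)%N. Proof. exact: ltnW. Qed.
Let rp : 0 < r%:R :> R. Proof. by rewrite ltr0n; exact: leq_trans r3. Qed.

(** Above the edge: the block does not overshoot with constant pivots [sqrt n /
    om] by [goe_upper], whose rates leave room when [lamh > om]; one more
    elimination with the heavy border and the corner, which is of order one,
    gives the claim. *)
Lemma fixed_order_upper (lamh : R) : om < lamh -> exists A c : R, 0 < c /\
  forall (d : measure_display) (T : measurableType d) (P : probability T R)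
    (n : nat) (G : r.-tuple 'I_n -> {RV P >-> R}) (w : 'rV[R]_n) (s : R),
  (0 < n)%N -> GOTE G -> dotr w w = 1 -> s ^+ 2 = 1 ->
  (P [set t | (lamh * Num.sqrt n%:R < lambda_max (s *: tensor_contraction (fun k => G k t) w))%R]
   <= (A * n%:R * expR (- (c * n%:R)))%:E)%E.
Proof.
move=> hlam; have o0 := varpi_gt0 r3; have s0 := gap_scale_gt0 r2.
have s1 := gap_scale_le1 r2; have fx := varpi_fixpoint r3.
pose eta := lamh - om; have eta0 : 0 < eta by rewrite subr_gt0.
(* half of the margin eta goes to the corner, the other half to the border *)
pose dh := eta / 2; have dh0 : 0 < dh by rewrite divr_gt0.
pose e := eta / (2 * om); have e0 : 0 < e by rewrite divr_gt0// mulr_gt0.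
have eom : e * om = eta / 2 by rewrite /e; field; rewrite gt_eqF.
have hstep : sg * dh + sg ^+ 2 * (1 + e) * om <= lamh - om^-1.
  have h1 : sg * dh <= 1 * dh by rewrite ler_wpM2r// (ltW dh0).
  have h2 : sg ^+ 2 * (e * om) <= 1 * (e * om).
    by rewrite ler_wpM2r ?expr_le1// ?(ltW s0)// mulr_ge0// ltW.
  have -> : sg ^+ 2 * (1 + e) * om = sg ^+ 2 * om + sg ^+ 2 * (e * om) by ring.
  by move: h1 h2 fx; rewrite eom /dh /eta; lra.
have htop : dh + (1 + e) * om <= lamh.
  by rewrite mulrDl eom /dh /eta; lra.
have [c1 c10 hbulk] := bad_upper_tail e0 dh0.
have [k k0 hchi] := chi2_tail_up e0.
pose c2 := dh ^+ 2 / (4 * r%:R).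
have c20 : 0 < c2 by rewrite divr_gt0 ?exprn_gt0// mulr_gt0.
exists (3 + 3), (Num.min (Num.min c2 k) c1); split.
  by rewrite !lt_min c20 k0 c10.
move=> d T P n G w s n0 hG w1 ss.
have [d1 [T1 [Q [z zG]]]] := @std_gaussian_exists R (unit + 'I_n)%type.
have [d2 [T2 [P2 [H HG]]]] := @std_gaussian_exists R ('I_n * 'I_n)%type.
have [mz _] := zG.
set sn := Num.sqrt n%:R.
have sn0 : 0 < sn by rewrite sqrtr_gt0 ltr0n.
have sn2 : sn ^+ 2 = n%:R by rewrite sqr_sqrtr.
have n1 : 1 <= n%:R :> R by rewrite ler1n.
have mS := mxevent_overshoot (lamh * sn) 0 w (oproj1 n).
have -> : [set t | lamh * sn < lambda_max (s *: tensor_contraction (fun k => G k t) w)] =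
   [set t | overshoot (lamh * sn) 0 1%:M w (s *: tensor_contraction (fun k => G k t) w)].
  apply/seteqP; split => t /=; apply (lambda_max_gt_overshoot _ w n0 (contraction_trmx w s t r2 hG)).
rewrite (contraction_law_ge2 r2 hG w1 ss zG HG mS).
have wp : w *m 1%:M = w by rewrite mulmx1.
have pp' := deflate_oproj (oproj1 n) w1 wp.
have ptr : \tr (deflate 1%:M w) = n.-1%:R.
  by rewrite (trace_deflate _ w1) mxtrace1 -subn1 natrB.
pose Bad : set T1 := [set t | dh * sn <= `|Num.sqrt r%:R * z (inl tt) t|] `|`
  [set t | (1 + e) * n%:R <= \sum_i z (inr i) t ^+ 2].
have mB1 : measurable [set t | dh * sn <= `|Num.sqrt r%:R * z (inl tt) t|].
  rewrite -[X in measurable X]setTI; apply: measurable_fun_ler => //.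
  by apply: measurableT_comp => //; exact: measurable_funM.
have mB2 : measurable [set t | (1 + e) * n%:R <= \sum_i z (inr i) t ^+ 2].
  rewrite -[X in measurable X]setTI; apply: measurable_fun_ler => //.
  by apply: measurable_sumsq => i; exact: mz.
have hBad : (Q Bad <= (3 * expR (- (Num.min c2 k * n%:R)))%:E)%E.
  have -> : 3 = 2 + 1 :> R by ring.
  have [le1 le2] := expR_le_min c2 k (ler0n R n).
  rewrite mulrDl mul1r; apply: (measureU_le _ mB1 mB2 (@subset_refl _ Bad)).
  - exact: measurableU.
  - have sr0 : Num.sqrt r%:R != 0 :> R by rewrite gt_eqF// sqrtr_gt0.
    have dsn : 0 <= dh * sn by rewrite mulr_ge0 ?ltW.
    apply: le_trans (corner_tail zG sr0 dsn) _.
    rewrite lee_fin ler_wpM2l//; apply: le_trans le1; rewrite ler_expR lerN2.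
    rewrite exprMn sn2 sqr_sqrtr; last exact: ltW.
    by rewrite /c2 mulrAC.
  have := hchi _ _ _ _ _ (hrow_gaussian zG); rewrite card_ord => /le_trans; apply.
  by rewrite lee_fin mulNr.
pose y := om^-1 * sn.
have y0 : 0 < y by rewrite mulr_gt0 ?invr_gt0.
have b2y (b : R) : b * n%:R / y = b * om * sn.
  by rewrite /y -sn2; field; rewrite !gt_eqF.
have hl : `|sg| * dh * sn + sg ^+ 2 * ((1 + e) * n%:R) / y <= lamh * sn - y.
  rewrite [X in _ + X <= _](_ : _ = (sg ^+ 2 * (1 + e)) * n%:R / y); last by rewrite mulrA.
  rewrite b2y gtr0_norm// /y -mulrBl -mulrDl ler_wpM2r ?(ltW sn0)//.
pose q := 3 * expR (- (c1 * n%:R)).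
have q0 : 0 <= q by rewrite mulr_ge0 ?expR_ge0.
have hq := hbulk n sg _ _ Q z (lt0r_neq0 s0) zG.
apply: (@le_trans _ _ (Q Bad + (n.-1%:R * q)%:E)%E); last first.
  apply: (@le_trans _ _ ((3 * expR (- (Num.min c2 k * n%:R)))%:E + (n%:R * q)%:E)%E).
    apply: leeD => //; rewrite lee_fin ler_wpM2r// ler_nat; exact: leq_pred.
  rewrite -EFinD lee_fin /q.
  rewrite [X in _ + X <= _](_ : _ = 3 * n%:R * expR (- (c1 * n%:R))); last by ring.
  exact: merge_exp.
apply: arrow_prob_le => //.
- exact: measurableU.
- by rewrite mulr_ge0.
move=> t nbad.
set g := 1 *: (hrow (fun k => z k t) *m deflate 1%:M w).
have gp : g *m deflate 1%:M w = g by rewrite -scalemxAl -mulmxA; have [_ ->] := pp'.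
have [u [b [u1 up gu bb]]] := border_direction pp' ptr gp.
exists (overshoot (lamh * sn) y (deflate 1%:M w) u); split.
- exact: mxevent_overshoot.
- exact: (goe_upper y0 hl zG hq pp' ptr up u1 HG).
move=> v; apply: contraPP => nv.
apply: (overshoot_upper (oproj1 n) w1 wp gp (goe_sandwich _ _ pp') y0 _ gu nv).
have h1 : Num.sqrt r%:R * z (inl tt) t <= dh * sn.
  rewrite leNgt; apply/negP => h; apply: nbad; left => /=.
  by apply: le_trans (ltW h) (ler_norm _).
have h2 : b ^+ 2 <= (1 + e) * n%:R.
  rewrite leNgt; apply/negP => h; apply: nbad; right => /=; apply: (le_trans (ltW h)).
  by rewrite bb /g scale1r -dotr_hrowE dotr_proj_le.
rewrite subr0; apply: (@le_trans _ _ (dh * sn + (1 + e) * n%:R / y)).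
  by apply: lerD => //; rewrite ler_wpM2r// invr_ge0 ltW.
by rewrite b2y -mulrDl ler_wpM2r ?(ltW sn0).
Qed.

(** Below the edge: starting from the level [lamh], a bounded number [K] of
    eliminations brings the pivot below [1 / om] ([pivot_descent]), so that the
    block overshoots with high probability by [goe_lower]; the heavy border
    turns this into an overshoot of the whole matrix. *)
Lemma fixed_order_lower (lamh : R) : 0 < lamh -> lamh < om -> exists A c : R, 0 < c /\
  forall (d : measure_display) (T : measurableType d) (P : probability T R)
    (n : nat) (G : r.-tuple 'I_n -> {RV P >-> R}) (w : 'rV[R]_n) (s : R),
  (0 < n)%N -> GOTE G -> dotr w w = 1 -> s ^+ 2 = 1 ->
  (P [set t | (lambda_max (s *: tensor_contraction (fun k => G k t) w) <= lamh * Num.sqrt n%:R)%R]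
   <= (A * n%:R * expR (- (c * n%:R)))%:E)%E.
Proof.
move=> lamh0 hlam; have o0 := varpi_gt0 r3; have s0 := gap_scale_gt0 r2.
have s1 := gap_scale_le1 r2; have fx := varpi_fixpoint r3.
have s20 : 0 < sg ^+ 2 by rewrite exprn_gt0.
pose eta := om - lamh; have eta0 : 0 < eta by rewrite subr_gt0.
(* three losses are paid out of the margin eta: corners, borders, and the
   decrease of the pivots at each step *)
pose dh := eta / 8; have dh0 : 0 < dh by rewrite divr_gt0.
pose e := eta / (8 * om); have e0 : 0 < e by rewrite divr_gt0// mulr_gt0.
have eom : e * om = eta / 8 by rewrite /e; field; rewrite gt_eqF.
have e1 : e < 1.
  by rewrite -(ltr_pM2r o0) mul1r eom /eta; lra.
have e01 : 0 < e < 1 by rewrite e0.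
pose lam' := lamh + sg * dh; pose b2h := sg ^+ 2 * (1 - e).
have lam'0 : 0 < lam' by rewrite addr_gt0// mulr_gt0.
have b2h0 : 0 < b2h by rewrite mulr_gt0// subr_gt0.
(* pivots in units of sqrt n; the truncation keeps them nonnegative, as the
   elimination requires *)
pose yh k := iter k (fun y : R => Num.max 0 (lam' - b2h / y)) lam'.
have yh0 k : 0 <= yh k.
  by case: k => [|k]; [exact: ltW|rewrite /yh iterS le_max lexx].
have [K hK] : exists K, yh K <= om^-1.
  apply: (@pivot_descent r r3 lam' b2h yh (Num.min (eta / 2) om^-1)) => //.
  - by rewrite lt_min invr_gt0 o0 divr_gt0.
  - by rewrite ge_min lexx orbT.
  - exact: ltW.
  - apply: le_trans (gap_scale_varpi r3); rewrite /b2h ger_pMr//; lra.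
  apply: (@le_trans _ _ (eta / 2 + lam')); first by rewrite lerD2r ge_min lexx.
  have h1 : sg * dh <= 1 * dh by rewrite ler_wpM2r// (ltW dh0).
  have h2 : sg ^+ 2 * (e * om) <= 1 * (e * om).
    by rewrite ler_wpM2r ?expr_le1// ?(ltW s0)// mulr_ge0// ltW.
  have -> : b2h * om = sg ^+ 2 * om - sg ^+ 2 * (e * om) by rewrite /b2h; ring.
  by move: h1 h2 fx; rewrite eom /lam' /dh /eta; lra.
have htop : om^-1 * (lamh + dh) <= 1 - e.
  by rewrite mulrC ler_pdivrMr// mulrBl eom mul1r /dh /eta; lra.
have [c1 c10 hbulk] := bad_lower_tail K.+2 e01 dh0.
have [k k0 hchi] := border_lower_tail 1 e01.
pose c2 := dh ^+ 2 / (4 * r%:R).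
have c20 : 0 < c2 by rewrite divr_gt0 ?exprn_gt0// mulr_gt0.
pose B : R := K.+1%:R * (3 + 2 * K.+2%:R).
have B0 : 0 <= B by rewrite mulr_ge0 ?addr_ge0 ?mulr_ge0.
exists (5 + B), (Num.min (Num.min c2 k) c1); split.
  by rewrite !lt_min c20 k0 c10.
move=> d T P n G w s n0 hG w1 ss.
have [d1 [T1 [Q [z zG]]]] := @std_gaussian_exists R (unit + 'I_n)%type.
have [d2 [T2 [P2 [H HG]]]] := @std_gaussian_exists R ('I_n * 'I_n)%type.
have [mz _] := zG.
set sn := Num.sqrt n%:R.
have sn0 : 0 < sn by rewrite sqrtr_gt0 ltr0n.
have sn2 : sn ^+ 2 = n%:R by rewrite sqr_sqrtr.
have np : 0 < n%:R :> R by rewrite ltr0n.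
have n1 : 1 <= n%:R :> R by rewrite ler1n.
have mS : mxevent (~` overshoot (lamh * sn) 0 1%:M w).
  exact: (measurableC (mxevent_overshoot (lamh * sn) 0 w (oproj1 n))).
have -> : [set t | lambda_max (s *: tensor_contraction (fun k => G k t) w) <= lamh * sn] =
   [set t | (~` overshoot (lamh * sn) 0 1%:M w) (s *: tensor_contraction (fun k => G k t) w)].
  have hm t := lambda_max_gt_overshoot (lamh * sn) w n0 (contraction_trmx w s t r2 hG).
  apply/seteqP; split => t /=.
    by move=> ht /hm; rewrite ltNge ht.
  by move=> ht; rewrite leNgt; apply/negP => /hm.
rewrite (contraction_law_ge2 r2 hG w1 ss zG HG mS).
have wp : w *m 1%:M = w by rewrite mulmx1.
have pp' := deflate_oproj (oproj1 n) w1 wp.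
have cp1 : coproj 1 (deflate 1%:M w) := coprojS (coproj0 n) w1 wp.
pose Bad : set T1 := [set t | dh * sn <= `|Num.sqrt r%:R * z (inl tt) t|] `|`
  [set t | dotr (hrow (fun k => z k t) *m deflate 1%:M w) (hrow (fun k => z k t) *m deflate 1%:M w)
     <= (1 - e) * n%:R].
have mB1 : measurable [set t | dh * sn <= `|Num.sqrt r%:R * z (inl tt) t|].
  rewrite -[X in measurable X]setTI; apply: measurable_fun_ler => //.
  by apply: measurableT_comp => //; exact: measurable_funM.
have mB2 : measurable [set t | dotr (hrow (fun k => z k t) *m deflate 1%:M w)
    (hrow (fun k => z k t) *m deflate 1%:M w) <= (1 - e) * n%:R].
  rewrite -[X in measurable X]setTI; apply: measurable_fun_ler => //.
  exact: measurable_dotr_hrow.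
have hBad : (Q Bad <= (5 * expR (- (Num.min c2 k * n%:R)))%:E)%E.
  have -> : 5 = 2 + (1 + 2 * 1%:R) :> R by ring.
  have [le1 le2] := expR_le_min c2 k (ler0n R n).
  rewrite [X in (_ <= X%:E)%E]mulrDl; apply: (measureU_le _ mB1 mB2 (@subset_refl _ Bad)).
  - exact: measurableU.
  - have sr0 : Num.sqrt r%:R != 0 :> R by rewrite gt_eqF// sqrtr_gt0.
    have dsn : 0 <= dh * sn by rewrite mulr_ge0 ?ltW.
    apply: le_trans (corner_tail zG sr0 dsn) _.
    rewrite lee_fin ler_wpM2l//; apply: le_trans le1; rewrite ler_expR lerN2.
    rewrite exprMn sn2 sqr_sqrtr; last exact: ltW.
    by rewrite /c2 mulrAC.
  apply: le_trans (hchi _ _ _ _ _ zG _ _ cp1 (leqnn 1)) _.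
  by rewrite lee_fin ler_wpM2l.
pose q := (3 + 2 * K.+2%:R) * expR (- (c1 * n%:R)).
have q0 : 0 <= q by rewrite mulr_ge0 ?expR_ge0 ?addr_ge0 ?mulr_ge0.
pose y k := sn * yh k.
have b20 : 0 < sg ^+ 2 * ((1 - e) * n%:R) by rewrite mulr_gt0// mulr_gt0// subr_gt0.
have y0E : y 0%N = lamh * sn + `|sg| * dh * sn.
  by rewrite /y /yh /= /lam' gtr0_norm// -mulrDl mulrC.
have ySE k' : y k' * (lamh * sn + `|sg| * dh * sn - y k'.+1) <= sg ^+ 2 * ((1 - e) * n%:R).
  rewrite -y0E /y -mulrBr mulrACA -expr2 sn2 [leRHS]mulrA -/b2h mulrC ler_pM2r//.
  have := yh0 k'; rewrite le_eqVlt => /predU1P[<-|yk0]; first by rewrite mul0r ltW.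
  rewrite mulrC -ler_pdivlMr// [yh k'.+1]iterS -/(yh k') lerBlDl -lerBlDr.
  by rewrite le_max lexx orbT.
have yge k' : (k' < K)%N -> 0 <= y k' by move=> _; rewrite mulr_ge0// ltW.
have hq j p : coproj j p -> (j <= K.+2)%N ->
    (Q (bad_lower sg (`|sg| * dh * sn) (sg ^+ 2 * ((1 - e) * n%:R)) z p) <= q%:E)%E.
  by move=> cp jK; apply: (hbulk n sg _ _ Q z (lt0r_neq0 s0) zG j).
apply: (@le_trans _ _ (Q Bad + (K.+1%:R * q)%:E)%E); last first.
  apply: (@le_trans _ _ ((5 * expR (- (Num.min c2 k * n%:R)))%:E + (K.+1%:R * q)%:E)%E).
    exact: leeD.
  rewrite -EFinD lee_fin /q mulrA -/B.
  apply: (@le_trans _ _ (5 * expR (- (Num.min c2 k * n%:R)) + B * n%:R * expR (- (c1 * n%:R)))).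
    by rewrite lerD2l ler_wpM2r ?expR_ge0// ler_peMr.
  exact: merge_exp.
apply: arrow_prob_le => //.
- exact: measurableU.
- by rewrite mulr_ge0.
move=> t nbad.
set g := 1 *: (hrow (fun k => z k t) *m deflate 1%:M w).
have gp : g *m deflate 1%:M w = g by rewrite -scalemxAl -mulmxA; have [_ ->] := pp'.
have g2 : (1 - e) * n%:R < dotr g g.
  by rewrite ltNge; apply/negP => h; apply: nbad; right; rewrite /= -[X in dotr X X]scale1r.
have g20 : 0 < dotr g g by apply: lt_trans g2; rewrite mulr_gt0// subr_gt0.
have g0 : g != 0 by apply/eqP => g0; move: g20; rewrite g0 dotr0l ltxx.
have [u [u1 up gu]] := normalize gp g0.
exists (~` overshoot (lamh * sn) (y K) (deflate 1%:M w) u); split.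
- exact: (measurableC (mxevent_overshoot _ _ u pp')).
- exact: (goe_lower b20 y0E ySE yge zG hq cp1 _ (leqnn K) up u1 HG).
move=> v; apply: contra_not => hv.
apply: (overshoot_lower (oproj1 n) w1 wp gp (goe_sandwich _ _ pp') _ _ _ gu hv).
- by rewrite mulr_ge0// ltW.
- by rewrite sqrtr_gt0.
rewrite sqr_sqrtr ?(ltW g20)// subr0; apply: le_trans (ltW g2).
have h1 : - (dh * sn) <= Num.sqrt r%:R * z (inl tt) t.
  rewrite leNgt; apply/negP => h; apply: nbad; left => /=.
  by rewrite -normrN; apply: le_trans (ler_norm _); rewrite lerNr ltW.
apply: (@le_trans _ _ (sn * yh K * (sn * (lamh + dh)))).
  rewrite ler_wpM2l ?mulr_ge0 ?(ltW sn0)// mulrDr ![sn * _]mulrC lerD2l; lra.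
rewrite mulrACA -expr2 sn2 mulrC ler_pM2r//; apply: le_trans htop.
by rewrite ler_wpM2r// addr_ge0// ltW.
Qed.

End fixed_order.

End part_a.

(** * A rank-two part perturbed by a small block *)

Section two_level.
Context {R : realType}.
Implicit Types a b : R.

(** The largest eigenvalue of the two by two matrix with rows [(a, b)] and [(b,
    0)]; the smallest one is [- top2 (- a) b]. *)
Definition top2 a b : R := (a + Num.sqrt (a ^+ 2 + 4 * b ^+ 2)) / 2.

Let disc_ge0 a b : 0 <= a ^+ 2 + 4 * b ^+ 2.
Proof. by apply: addr_ge0; rewrite ?sqr_ge0// mulr_ge0// sqr_ge0. Qed.

Lemma top2_root a b : top2 a b * (top2 a b - a) = b ^+ 2.
Proof.
rewrite /top2; set S := Num.sqrt _.
have S2 : S ^+ 2 = a ^+ 2 + 4 * b ^+ 2 by rewrite sqr_sqrtr.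
have -> : (a + S) / 2 * ((a + S) / 2 - a) = (S ^+ 2 - a ^+ 2) / 4 by field.
by rewrite S2 addrAC subrr add0r mulrC mulKf.
Qed.

Lemma sqrt_le_of_sqr (x y : R) : 0 <= y -> x <= y ^+ 2 -> Num.sqrt x <= y.
Proof.
by move=> y0 h; rewrite -[y]ger0_norm// -sqrtr_sqr ler_wsqrtr.
Qed.

Lemma le_disc a b : `|a| <= Num.sqrt (a ^+ 2 + 4 * b ^+ 2).
Proof. by rewrite -sqrtr_sqr ler_wsqrtr// lerDl mulr_ge0 ?sqr_ge0. Qed.

Lemma le_disc2 a b : 2 * `|b| <= Num.sqrt (a ^+ 2 + 4 * b ^+ 2).
Proof.
rewrite -[2 * _]ger0_norm ?mulr_ge0// -sqrtr_sqr ler_wsqrtr//.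
have -> : (2 * `|b|) ^+ 2 = 4 * `|b| ^+ 2 by ring.
by rewrite real_normK ?num_real// lerDr sqr_ge0.
Qed.

Lemma top2_gt0 a b : 0 < b -> 0 < top2 a b.
Proof.
move=> b0; rewrite divr_gt0// -ltrBlDl sub0r.
have [a0|a0] := leP 0 a.
  have := le_disc2 a b; rewrite gtr0_norm// => h; apply: lt_le_trans h.
  by rewrite (le_lt_trans _ (_ : 0 < _)) ?mulr_gt0// oppr_le0.
rewrite -[- a]ger0_norm ?oppr_ge0 ?ltW// normrN -sqrtr_sqr ltr_sqrt; last first.
  by rewrite ltr_wpDl ?sqr_ge0// mulr_gt0// exprn_gt0.
by rewrite ltrDl mulr_gt0// exprn_gt0.
Qed.

(** The discriminant is the Euclidean norm of the vector [(a, 2 b)]. *)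
Lemma disc_lip a a' b b' : 
  Num.sqrt (a ^+ 2 + 4 * b ^+ 2) <= 
  Num.sqrt (a' ^+ 2 + 4 * b' ^+ 2) + `|a - a'| + 2 * `|b - b'|.
Proof.
apply: (@le_trans _ _ (Num.sqrt (a' ^+ 2 + 4 * b ^+ 2) + `|a - a'|)).
  set S := Num.sqrt (a' ^+ 2 + _); apply: sqrt_le_of_sqr; first by rewrite addr_ge0 ?sqrtr_ge0.
  have S2 : S ^+ 2 = a' ^+ 2 + 4 * b ^+ 2 by rewrite sqr_sqrtr.
  have hS : `|a'| <= S := le_disc a' b.
  have h : a' * (a - a') <= S * `|a - a'|.
    by apply: (le_trans (ler_norm _)); rewrite normrM ler_wpM2r.
  rewrite sqrrD S2 real_normK ?num_real// mulr2n.
  have -> : a ^+ 2 = a' ^+ 2 + (a' * (a - a') + a' * (a - a')) + (a - a') ^+ 2 by ring.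
  by lra.
rewrite addrAC lerD2r.
set S := Num.sqrt (a' ^+ 2 + 4 * b' ^+ 2); apply: sqrt_le_of_sqr; first by rewrite addr_ge0 ?sqrtr_ge0 ?mulr_ge0.
have S2 : S ^+ 2 = a' ^+ 2 + 4 * b' ^+ 2 by rewrite sqr_sqrtr.
have hS : 2 * `|b'| <= S := le_disc2 a' b'.
have h : 2 * (b' * (b - b')) <= S * `|b - b'|.
  apply: (@le_trans _ _ (2 * `|b'| * `|b - b'|)); last by rewrite ler_wpM2r.
  by rewrite -mulrA ler_wpM2l// -normrM ler_norm.
rewrite sqrrD S2 exprMn real_normK ?num_real// mulr2n.
have -> : 4 * b ^+ 2 = 4 * b' ^+ 2 + 4 * (2 * (b' * (b - b'))) + 2 ^+ 2 * (b - b') ^+ 2 by ring.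
rewrite [S * (2 * _)]mulrCA; lra.
Qed.

Lemma top2_lip a a' b b' : `|top2 a b - top2 a' b'| <= `|a - a'| + `|b - b'|.
Proof.
have h1 := disc_lip a a' b b'; have h2 := disc_lip a' a b' b.
rewrite distrC [`|b' - b|]distrC in h2.
have h3 := ler_norm (a - a'); have := ler_norm (a' - a); rewrite distrC => h4.
by rewrite ler_norml /top2; apply/andP; split; lra.
Qed.

Lemma top2_scale k a b : 0 <= k -> top2 (k * a) (k * b) = k * top2 a b.
Proof.
move=> k0; rewrite /top2 !exprMn.
have -> : k ^+ 2 * a ^+ 2 + 4 * (k ^+ 2 * b ^+ 2) = k ^+ 2 * (a ^+ 2 + 4 * b ^+ 2) by ring.
rewrite sqrtrM; last exact: sqr_ge0.
by rewrite sqrtr_sqr ger0_norm//; field.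
Qed.

Lemma top2_01 : top2 0 1 = 1.
Proof.
rewrite /top2 expr0n expr1n !add0r mulr1.
have -> : 4 = 2 ^+ 2 :> R by ring.
by rewrite sqrtr_sqr ger0_norm// divff.
Qed.

Lemma top2_max z : top2 z 0 = Num.max z 0.
Proof.
rewrite /top2 expr0n mulr0 addr0 sqrtr_sqr; have [z0|z0] := ltP z 0.
  by rewrite ltr0_norm// subrr mul0r.
by rewrite ger0_norm//; field.
Qed.

Lemma top2_opp a : top2 (- a) 1 = (top2 a 1)^-1.
Proof.
have t0 := top2_gt0 a ltr01; apply: (@mulfI _ (top2 a 1)); first by rewrite gt_eqF.
rewrite mulfV ?gt_eqF// -[RHS](expr1n _ 2) -(top2_root a 1); congr (_ * _).
by rewrite /top2 sqrrN; field.
Qed.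

Lemma continuous_top2 b : continuous (top2^~ b : R -> R).
Proof.
move=> a; apply/cvgrPdist_le => e e0; near=> a' => /=.
apply: (le_trans (top2_lip _ _ _ _)); rewrite subrr normr0 addr0; near: a'.
by apply/nbhs_ballP; exists e => //= x; exact: ltW.
Unshelve. all: by end_near. Qed.

Lemma measurable_top2 b : measurable_fun setT (top2^~ b : R -> R).
Proof. exact: continuous_measurable_fun (@continuous_top2 b). Qed.

End two_level.

Section arrow_extremes.
Context {R : realType}.

Lemma dotr_cauchy n (u x : 'rV[R]_n) : dotr u u = 1 -> dotr u x ^+ 2 <= dotr x x.
Proof.
move=> u1; have := dotr_ge0 (x - dotr u x *: u).
rewrite -scaleNr !(dotrDl, dotrDr) !(dotrZl, dotrZr) u1 (dotrC x u) mulr1.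
by set c := dotr u x; set D := dotr x x; clearbody c D => h; nra.
Qed.

Lemma arrow_corner n (v g : 'rV[R]_n) a W : dotr v v = 1 -> 
  g *m deflate 1%:M v = g -> deflate 1%:M v *m W *m deflate 1%:M v = W ->
  bform (arrow a v g W) v v = a.
Proof.
move=> v1 gp Wp; have vp : v *m 1%:M = v by rewrite mulmx1.
have := arrow_form a (oproj1 n) v1 vp gp Wp 1 (x := 0); rewrite mul0mx => /(_ erefl).
rewrite scale1r addr0 => ->.
by rewrite dotr0r bform0l !expr1n !mulr1 mulr0 !addr0.
Qed.

Lemma arrow_trmx n a (v g : 'rV[R]_n) W : W^T = W -> (arrow a v g W)^T = arrow a v g W.
Proof.
move=> Ws; rewrite /arrow !linearD /= Ws linearZ /= !trmx_mul !trmxK.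
by rewrite [g^T *m v + _]addrC.
Qed.

(** A block of norm at most [tau] moves the largest eigenvalue of the rank-two
    part by at most [tau]. *)
Lemma arrow_lambda_max n (w g : 'rV[R]_n) (W : 'M[R]_n) (a tau : R) :
  (0 < n)%N -> dotr w w = 1 -> g *m deflate 1%:M w = g ->
  deflate 1%:M w *m W *m deflate 1%:M w = W -> W^T = W -> g != 0 ->
  (forall x, x *m deflate 1%:M w = x -> `|bform W x x| <= tau * dotr x x) ->
  `|lambda_max (arrow a w g W) - top2 a (Num.sqrt (dotr g g))| <= tau.
Proof.
move=> n0 w1 gp Wp Ws g0 hW; have wp : w *m 1%:M = w by rewrite mulmx1.
have [u [u1 up gu]] := normalize gp g0.
set b := Num.sqrt (dotr g g) in gu *.
have b0 : 0 < b by rewrite sqrtr_gt0 dotr_gt0.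
set L := top2 a b; have L0 : 0 < L := top2_gt0 a b0.
have As := arrow_trmx a w g Ws.
have Lr : L * (L - a) = b ^+ 2 := top2_root a b.
have bL : b ^+ 2 / L = L - a by rewrite -Lr mulrAC mulfV ?mul1r// gt_eqF.
have tau0 : 0 <= tau by have := hW u up; rewrite u1 mulr1; exact: le_trans.
rewrite ler_distl; apply/andP; split.
  rewrite leNgt; apply/negP => hlt.
  suff : overshoot (lambda_max (arrow a w g W)) 0 1%:M w (arrow a w g W).
    by move/(lambda_max_gt_overshoot _ _ n0 As); rewrite ltxx.
  set lam := lambda_max _ in hlt *.
  apply: (overshoot_lower (oproj1 n) w1 wp gp Wp (ltW L0) b0 _ gu).
    by rewrite subr0 -Lr ler_pM2l//; move: (lam) hlt => l hl; clear -hl tau0; lra.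
  exists u; split => //; rewrite u1 expr1n !mulr1.
  have := hW u up; rewrite u1 mulr1 ler_norml => /andP[h _]; apply: lt_le_trans h.
  by move: (lam) hlt => l hl; clear -hl tau0; lra.
rewrite leNgt; apply/negP => /(lambda_max_gt_overshoot _ w n0 As).
apply: (overshoot_upper (oproj1 n) w1 wp gp Wp L0 _ gu).
  by rewrite bL subr0; clear -tau0; lra.
move=> [x [xp]]; apply/negP; rewrite -leNgt.
have h1 := hW x xp; have h2 := dotr_cauchy x u1.
apply: (le_trans (le_trans (ler_norm _) h1)).
rewrite mulrDl -addrAC lerDr subr_ge0 ler_wpM2l// ltW//.
Qed.

End arrow_extremes.

Section lambda_measurable.
Context {R : realType}.

Lemma measurable_lambda_max d (T : measurableType d) n (X : T -> 'M[R]_n) : (0 < n)%N ->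
  (forall t, (X t)^T = X t) -> (forall i j, measurable_fun setT (fun t => X t i j)) ->
  measurable_fun setT (fun t => lambda_max (X t)).
Proof.
move=> n0 Xs mX; apply: (measurability _ (RGenOInfty.measurableE R)) => //.
move=> _ [_ [x ->] <-]; rewrite setTI (_ : _ @^-1` _ = [set t | overshoot x 0 1%:M 0 (X t)]).
  exact: mxevent_preimage (mxevent_overshoot _ _ _ (oproj1 n)).
by apply/seteqP; split => t /=; rewrite in_itv /= andbT => /(lambda_max_gt_overshoot _ 0 n0 (Xs t)).
Qed.

End lambda_measurable.

(** * Concentration around the rank-two part *)

Section joint.
Context {R : realType}.

(** The corner is exactly Gaussian for every [n]: this variable carries the
    limit laws. *)
Lemma corner_law (d : measure_display) (T : measurableType d) (P : probability T R)
    (r n : nat) (G : r.-tuple 'I_n -> {RV P >-> R}) (w : 'rV[R]_n) (B : set R) :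
  (2 <= r)%N -> GOTE G -> dotr w w = 1 -> measurable B ->
  P [set t | B (bform (tensor_contraction (fun k => G k t) w) w w / Num.sqrt r%:R)] =
  normal_prob 0 1 B.
Proof.
move=> r2 hG w1 mB.
have [d1 [T1 [Q [z zG]]]] := @std_gaussian_exists R (unit + 'I_n)%type.
have [d2 [T2 [P2 [H HG]]]] := @std_gaussian_exists R ('I_n * 'I_n)%type.
have [mz _] := zG.
have sr0 : Num.sqrt r%:R != 0 :> R by rewrite gt_eqF// sqrtr_gt0 ltr0n ltnW.
pose S : set 'M[R]_n := [set W | B (1 * bform W w w / Num.sqrt r%:R)].
have mS : mxevent S.
  have m : measurable_fun setT (fun f : vecT ('I_n * 'I_n)%type => 1 * bform (vtomx f) w w / Num.sqrt r%:R : R).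
    by apply: measurable_funM => //; apply: measurable_funM => //; apply: measurable_bform; exact: measurable_vtomx.
  by rewrite /mxevent -[X in measurable X]setTI; exact: m.
have wp : w *m 1%:M = w by rewrite mulmx1.
have pp' := deflate_oproj (oproj1 n) w1 wp.
have := contraction_law_ge2 r2 hG w1 (expr1n R 2) zG HG mS.
rewrite (_ : [set t | _] = [set t | B (bform (tensor_contraction (fun k => G k t) w) w w / Num.sqrt r%:R)]); last first.
  by apply/seteqP; split => t; rewrite /S /= scale1r mul1r.
move=> ->.
rewrite (_ : [set t | _] = [set t : T1 | B (z (inl tt) t)] `*` [set: T2]); last first.
  have E t1 t2 : bform (arrow (Num.sqrt r%:R * z (inl tt) t1) w
       (1 *: (hrow (fun k => z k t1) *m deflate 1%:M w))
       (goe (Num.sqrt (r%:R - 1))^-1 (deflate 1%:M w) (fun k => H k t2))) w w =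
       Num.sqrt r%:R * z (inl tt) t1.
    apply: arrow_corner => //; last exact: goe_sandwich.
    by rewrite -scalemxAl -mulmxA; have [_ ->] := pp'.
  by apply/seteqP; split => -[t1 t2]; rewrite /S /= E mul1r mulrAC mulfV// mul1r // => -[].
rewrite prodPX//; last by rewrite -[X in measurable X]setTI; exact: mz.
have -> : P2 [set: T2] = 1%E by exact: probability_setT.
rewrite mule1.
pose a : unit + 'I_n -> R := fun k => if k is inl _ then 1 else 0.
have a1 : dot a a = 1.
  rewrite /dot big_sumType /= [X in _ + X]big1 ?addr0; last by move=> i _; rewrite mulr0.
  by rewrite (bigD1 tt)//= big1 ?addr0 ?mulr1// => -[].
rewrite -(gaussian_projection zG a1 mB); congr (Q _).
have E t : dot a (fun k => z k t) = z (inl tt) t.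
  rewrite /dot big_sumType /= [X in _ + X]big1 ?addr0; last by move=> i _; rewrite mul0r.
  by rewrite (bigD1 tt)//= big1 ?addr0 ?mul1r// => -[].
by apply/seteqP; split => t /=; rewrite E.
Qed.

(** For a large order the block is small relative to the border, whose length
    concentrates at [sqrt n]; the largest eigenvalue is then that of the
    rank-two part, with the corner of the same matrix. The bound is uniform in
    the order. *)
Lemma extreme_tail (rho : R) : 0 < rho < 1 -> exists A c : R, 0 < c /\
  forall (d : measure_display) (T : measurableType d) (P : probability T R)
    (r n : nat) (G : r.-tuple 'I_n -> {RV P >-> R}) (w : 'rV[R]_n) (s : R),
  (3 <= r)%N -> (0 < n)%N -> GOTE G -> dotr w w = 1 -> s ^+ 2 = 1 ->
  (P [set t | let M := s *: tensor_contraction (fun k => G k t) w in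
      ((4 * gap_scale r + rho) * Num.sqrt n%:R <
       `|lambda_max M - top2 (bform M w w) (Num.sqrt n%:R)|)%R]
   <= (A * n%:R * expR (- (c * n%:R)))%:E)%E.
Proof.
move=> rho01; have /andP[rho0 rho1] := rho01.
have [k1 k10 hup] := chi2_tail_up rho0.
have [k2 k20 hdn] := border_lower_tail 1 rho01.
have [c1 c10 hbulk] := bad_upper_tail (@ltr01 R) (@ltr01 R).
exists (4 + 6), (Num.min (Num.min k1 k2) c1); split.
  by rewrite !lt_min k10 k20 c10.
move=> d T P r n G w s r3 n0 hG w1 ss; have r2 : (2 <= r)%N := ltnW r3.
have [d1 [T1 [Q [z zG]]]] := @std_gaussian_exists R (unit + 'I_n)%type.
have [d2 [T2 [P2 [H HG]]]] := @std_gaussian_exists R ('I_n * 'I_n)%type.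
have [mz _] := zG.
set sg : R := gap_scale r; have sg0 : 0 < sg := gap_scale_gt0 r2.
set sn := Num.sqrt n%:R.
have sn0 : 0 < sn by rewrite sqrtr_gt0 ltr0n.
have sn2 : sn ^+ 2 = n%:R by rewrite sqr_sqrtr.
have np : 0 < n%:R :> R by rewrite ltr0n.
have n1 : 1 <= n%:R :> R by rewrite ler1n.
have wp : w *m 1%:M = w by rewrite mulmx1.
have pp' := deflate_oproj (oproj1 n) w1 wp.
have cp1 : coproj 1 (deflate 1%:M w) := coprojS (coproj0 n) w1 wp.
have ptr : \tr (deflate 1%:M w) = n.-1%:R.
  by rewrite (trace_deflate _ w1) mxtrace1 -subn1 natrB.
(* the largest eigenvalue is only controlled for symmetric matrices, so the
   event is formulated for the symmetric part *)
pose symm (W : 'M[R]_n) := 2^-1 *: (W + W^T).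
have symmT W : (symm W)^T = symm W.
  by rewrite /symm linearZ /= linearD /= trmxK addrC.
have symmE W : W^T = W -> symm W = W.
  by move=> h; rewrite /symm h; apply/matrixP => i j; rewrite !mxE; field.
pose S : set 'M[R]_n := [set W | (4 * sg + rho) * sn <
  `|lambda_max (symm W) - top2 (bform W w w) sn|].
have mS : mxevent S.
  rewrite /mxevent -[X in measurable X]setTI; apply: measurable_fun_ltr => //.
  apply: measurableT_comp => //; apply: measurable_funB.
    apply: measurable_lambda_max => // i j.
    have -> : (fun f : vecT ('I_n * 'I_n)%type => symm (vtomx f) i j) =
        (fun f => 2^-1 * (vtomx f i j + vtomx f j i)) by apply/funext => f; rewrite !mxE.
    by apply: measurable_funM => //; apply: measurable_funD => //; exact: measurable_vtomx.
  have mb : measurable_fun setT (fun f : vecT ('I_n * 'I_n)%type => bform (vtomx f) w w : R).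
    by apply: measurable_bform; exact: measurable_vtomx.
  exact: (measurableT_comp (measurable_top2 sn) mb).
rewrite (_ : [set t | _] = [set t | S (s *: tensor_contraction (fun k => G k t) w)]); last first.
  by apply/seteqP; split => t; rewrite /S /= symmE//; exact: contraction_trmx.
rewrite (contraction_law_ge2 r2 hG w1 ss zG HG mS).
pose h2 t := dotr (hrow (fun k => z k t) *m deflate 1%:M w) (hrow (fun k => z k t) *m deflate 1%:M w).
pose Bad : set T1 := [set t | (1 + rho) * n%:R <= \sum_i z (inr i) t ^+ 2] `|`
  [set t | h2 t <= (1 - rho) * n%:R].
have mB1 : measurable [set t | (1 + rho) * n%:R <= \sum_i z (inr i) t ^+ 2].
  rewrite -[X in measurable X]setTI; apply: measurable_fun_ler => //.
  by apply: measurable_sumsq => i; exact: mz.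
have mB2 : measurable [set t | h2 t <= (1 - rho) * n%:R].
  rewrite -[X in measurable X]setTI; apply: measurable_fun_ler => //.
  exact: measurable_dotr_hrow.
have hBad : (Q Bad <= (4 * expR (- (Num.min k1 k2 * n%:R)))%:E)%E.
  have -> : 4 = 1 + (1 + 2 * 1%:R) :> R by ring.
  have [le1 le2] := expR_le_min k1 k2 (ler0n R n).
  rewrite [X in (_ <= X%:E)%E]mulrDl; apply: (measureU_le _ mB1 mB2 (@subset_refl _ Bad)).
  - exact: measurableU.
  - have := hup _ _ _ _ _ (hrow_gaussian zG); rewrite card_ord => /le_trans; apply.
    by rewrite mul1r lee_fin mulNr.
  apply: le_trans (hdn _ _ _ _ _ zG _ _ cp1 (leqnn 1)) _.
  by rewrite lee_fin ler_wpM2l.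
pose q := 3 * expR (- (c1 * n%:R)).
have q0 : 0 <= q by rewrite mulr_ge0 ?expR_ge0.
apply: (@le_trans _ _ (Q Bad + (n.-1%:R * q + n.-1%:R * q)%:E)%E); last first.
  apply: (@le_trans _ _ ((4 * expR (- (Num.min k1 k2 * n%:R)))%:E + (n%:R * q + n%:R * q)%:E)%E).
    have nn : n.-1%:R <= n%:R :> R by rewrite ler_nat leq_pred.
    by apply: leeD => //; rewrite lee_fin; apply: lerD; rewrite ler_wpM2r.
  rewrite -EFinD lee_fin /q.
  rewrite [X in _ + X <= _](_ : _ = 6 * n%:R * expR (- (c1 * n%:R))); last by ring.
  exact: merge_exp.
apply: arrow_prob_le => //.
- exact: measurableU.
- by rewrite addr_ge0 ?mulr_ge0.
move=> t nbad.
set g := 1 *: (hrow (fun k => z k t) *m deflate 1%:M w).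
have gp : g *m deflate 1%:M w = g by rewrite -scalemxAl -mulmxA; have [_ ->] := pp'.
have gE : dotr g g = h2 t by rewrite /g scale1r.
have g2 : (1 - rho) * n%:R < dotr g g.
  by rewrite gE ltNge; apply/negP => h; apply: nbad; right.
have g2' : dotr g g <= (1 + rho) * n%:R.
  rewrite gE leNgt; apply/negP => h; apply: nbad; left => /=; apply: (le_trans (ltW h)).
  by rewrite -dotr_hrowE dotr_proj_le.
have g20 : 0 < dotr g g by apply: lt_trans g2; rewrite mulr_gt0// subr_gt0.
have g0 : g != 0 by apply/eqP => g0; move: g20; rewrite g0 dotr0l ltxx.
have [u [u1 up gu]] := normalize gp g0.
(* with deviations of relative size one, the pivot sg sqrt n balances 3 sg sqrt
   n of corner and border against the level 4 sg sqrt n *)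
pose y := sg * sn; have y0 : 0 < y by rewrite mulr_gt0.
pose L := overshoot (4 * sg * sn) y (deflate 1%:M w) u.
have mL : mxevent L := mxevent_overshoot _ _ u pp'.
have hlam (c : R) : c ^+ 2 = sg ^+ 2 -> `|c| = sg -> `|c| * 1 * sn + c ^+ 2 * ((1 + 1) * n%:R) / y <= 4 * sg * sn - y.
  move=> c2 ca; rewrite ca c2 -sn2 /y.
  have -> : sg ^+ 2 * ((1 + 1) * sn ^+ 2) / (sg * sn) = 2 * sg * sn by field; rewrite !gt_eqF.
  by rewrite le_eqVlt; apply/orP; left; apply/eqP; ring.
have hL (c : R) : c ^+ 2 = sg ^+ 2 -> `|c| = sg ->
    (P2 [set t | L (goe c (deflate 1%:M w) (fun k => H k t))] <= (n.-1%:R * q)%:E)%E.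
  move=> c2 ca; have c0 : c != 0 by rewrite -normr_eq0 ca gt_eqF.
  exact: (goe_upper y0 (hlam c c2 ca) zG (hbulk n c _ _ Q z c0 zG) pp' ptr up (or_intror u1) HG).
exists (L `|` [set W | L (- W)]); split.
- apply: measurableU => //.
  apply: (mxevent_preimage _ mL) => i j.
  have -> : (fun f : vecT ('I_n * 'I_n)%type => (- vtomx f) i j) =
      (fun f : vecT ('I_n * 'I_n)%type => - (vtomx f i j : R)).
    by apply/funext => f; rewrite mxE.
  by apply: measurableT_comp => //; exact: measurable_vtomx.
- have hNe v : - goe sg (deflate 1%:M w) (fun k => H k v) = goe (- sg) (deflate 1%:M w) (fun k => H k v).
    by rewrite /goe mulNr scaleNr.
  have [mH _] := HG.
  have m1 : measurable [set v | L (goe sg (deflate 1%:M w) (fun k => H k v))].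
    by apply: (mxevent_preimage _ mL) => i j; exact: measurable_goe.
  have m2 : measurable [set v | L (goe (- sg) (deflate 1%:M w) (fun k => H k v))].
    by apply: (mxevent_preimage _ mL) => i j; exact: measurable_goe.
  have sub : [set v | (L `|` [set W | L (- W)]) (goe sg (deflate 1%:M w) (fun k => H k v))] =
     [set v | L (goe sg (deflate 1%:M w) (fun k => H k v))] `|`
     [set v | L (goe (- sg) (deflate 1%:M w) (fun k => H k v))].
    by apply/seteqP; split => v /=; rewrite hNe.
  rewrite sub; apply: (measureU_le _ m1 m2 (@subset_refl _ _)).
  - exact: measurableU.
  - by apply: hL => //; rewrite gtr0_norm.
  - by apply: hL; rewrite ?sqrrN// normrN gtr0_norm.
move=> v; rewrite -/g; set a := Num.sqrt r%:R * _; set W := goe _ _ _.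
have Ws : W^T = W by apply: goe_sym; have [] := pp'.
have Wp : deflate 1%:M w *m W *m deflate 1%:M w = W := goe_sandwich _ _ pp'.
apply: contraPP => nL /=; apply/negP; rewrite -leNgt.
rewrite symmE; last exact: arrow_trmx.
rewrite (arrow_corner _ w1 gp Wp).
have bulk x : x *m deflate 1%:M w = x -> `|bform W x x| <= 4 * sg * sn * dotr x x.
  move=> xp; rewrite ler_norml; apply/andP; split; rewrite leNgt; apply/negP => h; apply: nL.
    right; exists x; split => //; rewrite bformN; apply: le_lt_trans (_ : _ < _); last first.
      by rewrite ltrNr; exact: h.
    by rewrite lerBlDr lerDl mulr_ge0 ?sqr_ge0 ?ltW.
  left; exists x; split => //; apply: le_lt_trans h.
  by rewrite lerBlDr lerDl mulr_ge0 ?sqr_ge0 ?ltW.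
have := arrow_lambda_max a n0 w1 gp Wp Ws g0 bulk.
set b := Num.sqrt (dotr g g); move=> hmax.
rewrite -(subrK (top2 a b) (lambda_max _)) -addrA; apply: (le_trans (ler_normD _ _)).
rewrite mulrDl; apply: lerD => //; apply: (le_trans (top2_lip _ _ _ _)).
rewrite subrr normr0 add0r.
have b0 : 0 <= b := sqrtr_ge0 _.
have b2 : b ^+ 2 = dotr g g by rewrite sqr_sqrtr// ltW.
rewrite -b2 -sn2 in g2 g2'.
move: b0 g2 g2' sn0 rho0 rho1; clear; move: b sn => b sn b0 g1 g2 sn0 rho0 rho1.
have s2 : 0 <= sn ^+ 2 := sqr_ge0 sn.
have h1 : (1 - rho) * sn <= b.
  rewrite -(@ler_pXn2r _ 2)// ?nnegrE; last by rewrite mulr_ge0 ?(ltW sn0)// subr_ge0 ltW.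
  apply: ltW.
  by apply: le_lt_trans g1; rewrite exprMn ler_wpM2r// expr2; nra.
have h2 : b <= (1 + rho) * sn.
  rewrite -(@ler_pXn2r _ 2)// ?nnegrE; last by rewrite mulr_ge0 ?(ltW sn0)// addr_ge0// ltW.
  by apply: (le_trans g2); rewrite exprMn ler_wpM2r// expr2; nra.
by rewrite ler_norml; apply/andP; split; lra.
Qed.

End joint.

(** * Tools for convergence *)

Section convergence.
Context {R : realType}.

Lemma norm_pair_ge (e : R) (p q : R * R) : (e <= `|p - q|) = (e <= `|p.1 - q.1|) || (e <= `|p.2 - q.2|).
Proof. by rewrite prod_normE /= le_max. Qed.

(** An open set of the plane is the union of the rational boxes that it
    contains. *)
Lemma continuous_measurable_pair (f : R * R -> R) : continuous f -> measurable_fun setT f.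
Proof.
move=> cf; apply: (measurability _ (RGenOInfty.measurableE R)) => //.
move=> _ [_ [a ->] <-]; rewrite setTI.
pose box (q : rat * rat * nat) : set (R * R) :=
  [set p | `|ratr q.1.1 - p.1| < q.2.+1%:R^-1 /\ `|ratr q.1.2 - p.2| < q.2.+1%:R^-1].
pose U : set (R * R) := f @^-1` `]a, +oo[.
pose D : set (rat * rat * nat) := [set q | box q `<=` U].
have -> : f @^-1` `]a, +oo[ = \bigcup_(q in D) box q.
  apply/seteqP; split => [p Up|p [q Dq]]; last exact: Dq.
  have oU : open U by apply: open_comp => // x _; exact: cf.
  have [e e0 he] : exists2 e : R, 0 < e & ball p e `<=` U.
    by apply/nbhs_ballP; exact: open_nbhs_nbhs.
  have [k hk] : exists k : nat, k.+1%:R^-1 < e / 2.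
    exists (Num.truncn (2 / e)); rewrite -[e / 2]invrK ltf_pV2 ?posrE ?invr_gt0 ?divr_gt0//.
    by rewrite invf_div truncnS_gt.
  have kp : 0 < k.+1%:R^-1 :> R by rewrite invr_gt0.
  have hr (x : R) : exists q : rat, `|ratr q - x| < k.+1%:R^-1.
    have /rat_in_itvoo[q /itvP hq] : x - k.+1%:R^-1 < x + k.+1%:R^-1.
      by rewrite ltrD2l (lt_trans _ kp)// oppr_lt0.
    by exists q; rewrite ltr_distl !hq.
  have [q1 hq1] := hr p.1; have [q2 hq2] := hr p.2.
  exists ((q1, q2), k); last by split.
  move=> x; rewrite /box /=; move: (k.+1%:R^-1) hk kp hq1 hq2 {hr} => dk hk kp hq1 hq2 [h1 h2].
  apply: he; split; [change (`|p.1 - x.1| < e)|change (`|p.2 - x.2| < e)].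
    by have := ler_distD (ratr q1) p.1 x.1; rewrite [`|p.1 - ratr _|]distrC; lra.
  by have := ler_distD (ratr q2) p.2 x.2; rewrite [`|p.2 - ratr _|]distrC; lra.
rewrite bigcup_mkcond; apply: countable_bigcupT_measurable => [|q]; first exact: countableP.
case: ifPn => // _; apply: measurableI.
  rewrite -[X in measurable X]setTI; apply: measurable_fun_ltr => //.
  by apply: measurableT_comp => //; exact: measurable_funB.
rewrite -[X in measurable X]setTI; apply: measurable_fun_ltr => //.
by apply: measurableT_comp => //; exact: measurable_funB.
Qed.

Lemma ereal_cvg0 (p : nat -> \bar R) : (forall n, 0 <= p n)%E ->
  (forall e : R, 0 < e -> \forall n \near \oo, (p n <= e%:E)%E) -> p n @[n --> \oo] --> 0%E.
Proof.
move=> p0 h; apply/fine_cvgP; split.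
  near=> n; rewrite ge0_fin_numE//; apply: (@le_lt_trans _ _ 1%E); last exact: ltry.
  near: n; exact: h.
apply/cvgr0Pnorm_le => e e0; near=> n.
have hn : (p n <= e%:E)%E by near: n; exact: h.
rewrite ger0_norm; last exact: fine_ge0.
by rewrite -lee_fin fineK// ge0_fin_numE// (le_lt_trans hn)// ltry.
Unshelve. all: by end_near. Qed.

Lemma ereal_cvg0_near (p : nat -> \bar R) (e : R) : p n @[n --> \oo] --> 0%E -> 0 < e ->
  \forall n \near \oo, (p n <= e%:E)%E.
Proof.
move=> /fine_cvgP[pfin /cvgr0Pnorm_le pe] e0; have {}pe := pe e e0.
near=> n; have nfin : p n \is a fin_num by near: n.
have hn : `|fine (p n)| <= e by near: n.
by rewrite -(fineK nfin) lee_fin (le_trans (ler_norm _)).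
Unshelve. all: by end_near. Qed.

Lemma invn_cvg0 : n%:R^-1 @[n --> \oo] --> (0 : R).
Proof.
apply/gtr0_cvgV0; last exact: cvgr_idn.
by exists 1%N => // n /= n1; rewrite ltr0n.
Qed.

(** From [exp x >= (1 + x / 2)^2] for [x >= 0]. *)
Lemma exp_rate_cvg0 (A c : R) : 0 < c -> A * n%:R * expR (- (c * n%:R)) @[n --> \oo] --> 0.
Proof.
move=> c0; pose B := `|A| * (4 / c ^+ 2).
apply/cvgr0Pnorm_le => e e0.
have : B * n%:R^-1 @[n --> \oo] --> B * 0 by apply: cvgMr; exact: invn_cvg0.
rewrite mulr0 => /cvgr0Pnorm_le/(_ e e0) hB.
near=> n; have n0 : 0 < n%:R :> R by near: n; exists 1%N => // n /= n1; rewrite ltr0n.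
have hn : `|B * n%:R^-1| <= e by near: n; exact: hB.
have -> : `|A * n%:R * expR (- (c * n%:R))| = `|A| * (n%:R * expR (- (c * n%:R))).
  by rewrite -mulrA normrM [X in _ * X]ger0_norm// mulr_ge0// expR_ge0.
apply: le_trans hn; rewrite [leRHS]ger0_norm; last first.
  apply: mulr_ge0; last by rewrite invr_ge0.
  by apply: mulr_ge0 => //; rewrite divr_ge0// sqr_ge0.
rewrite /B -[leRHS]mulrA ler_wpM2l// expRN ler_pdivrMr ?expR_gt0//.
have cn : 0 < c * n%:R by rewrite mulr_gt0.
have h : (c * n%:R) ^+ 2 / 4 <= expR (c * n%:R).
  rewrite [c * n%:R in leRHS]splitr expRD -expr2.
  apply: (@le_trans _ _ ((1 + c * n%:R / 2) ^+ 2)).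
    by rewrite sqrrD expr_div_n; move: (c * n%:R) cn => x x0; rewrite mulr2n; lra.
  by rewrite ler_pXn2r ?nnegrE ?expR_ge0 ?expR_ge1Dx// addr_ge0// divr_ge0// ltW.
have nE : n%:R = 4 / c ^+ 2 / n%:R * ((c * n%:R) ^+ 2 / 4) by field; rewrite !gt_eqF.
rewrite [leLHS]nE.
by rewrite ler_wpM2l// !mulr_ge0 ?invr_ge0 ?sqr_ge0// ltW.
Unshelve. all: by end_near. Qed.

Lemma normal_tail_small (e : R) : 0 < e -> exists2 L : R, 0 < L &
  (normal_prob 0 1 [set x | (L <= `|x|)%R] <= e%:E)%E.
Proof.
move=> e0.
pose u := Num.max 1 (4 * (2 / e)).
have u1 : 1 <= u by rewrite le_max lexx.
have u0 : 0 < u by apply: lt_le_trans u1.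
exists (Num.sqrt u); first by rewrite sqrtr_gt0.
have := gaussian_tail u tt std_gaussian_unit.
rewrite (_ : [set t | _] = [set x | Num.sqrt u <= `|x|]); last first.
  by apply/seteqP; split => x /=; rewrite -sqrtr_sqr ler_sqrt// sqr_ge0.
move/le_trans; apply; rewrite lee_fin expRN ler_pdivrMr ?expR_gt0//.
apply: (@le_trans _ _ (e * (u / 4))).
  rewrite -ler_pdivrMl// ler_pdivlMr// mulrC [_^-1 * _]mulrC le_max lexx orbT//.
rewrite ler_wpM2l ?(ltW e0)//; apply: le_trans (expR_ge1Dx _); lra.
Qed.

End convergence.

(** * Convergence in distribution by coupling *)

Section weak_convergence.
Context {R : realType}.

Lemma bounded_integrable d (T : measurableType d) (P : probability T R) (U : T -> R) (C : R) :
  measurable_fun setT U -> (forall t, `|U t| <= C) -> P.-integrable setT (EFin \o U).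
Proof.
move=> mU hU; apply: measurable_bounded_integrable => //.
  by apply: le_lt_trans (probability_le1 P measurableT) _; exact: ltry.
by exists C; split; rewrite ?num_real// => x Cx y _ /=; exact: le_trans (ltW Cx).
Qed.

(** The difference is at most [e] off [Bad], and at most [2 C] on [Bad]. *)
Lemma expectation_near d (T : measurableType d) (P : probability T R) (U V : T -> R) (C e : R)
    (Bad : set T) :
  measurable_fun setT U -> measurable_fun setT V -> (forall t, `|U t| <= C) ->
  (forall t, `|V t| <= C) -> measurable Bad -> 0 <= e ->
  (forall t, ~ Bad t -> `|U t - V t| <= e) ->
  (`|'E_P[U] - 'E_P[V]| <= e%:E + (2 * C)%:E * P Bad)%E.
Proof.
move=> mU mV hU hV mB e0 hUV.
have C0 (t : T) : 0 <= C by apply: le_trans (hU t).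
rewrite unlock -integralB_EFin//; [|exact: bounded_integrable hU|exact: bounded_integrable hV].
have mUV : measurable_fun [set: T] (fun t => (U t - V t)%:E).
  by apply/measurable_EFinP; exact: measurable_funB.
apply: (le_trans (le_abse_integral _ _ _)) => //.
apply: (@le_trans _ _ (\int[P]_t (e%:E + (2 * C * \1_Bad t)%:E))%E).
  apply: ge0_le_integral => //.
  - by apply: measurableT_comp.
  - apply: emeasurable_funD => //; apply/measurable_EFinP; exact: measurable_funM.
  move=> t _ /=; rewrite -EFinD lee_fin indicE.
  have [tB|/negP tB] := boolP (t \in Bad).
    rewrite mulr1; apply: (le_trans (ler_normB _ _)).
    by apply: (le_trans (lerD (hU t) (hV t))); rewrite mulr_natl mulr2n lerDr.
  by rewrite mulr0 addr0; apply: hUV => h; apply: tB; exact: mem_set.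
have [t0 _] : exists t : T, True.
  apply: contrapT => noT; have E : [set: T] = set0.
    by apply/seteqP; split => // t _; apply: noT; exists t.
  have /eqP : P [set: T] = 1%E by exact: probability_setT.
  by rewrite E measure0 eq_sym onee_eq0.
have C2 : 0 <= 2 * C by rewrite mulr_ge0// (C0 t0).
rewrite ge0_integralD//; last 2 first.
  by move=> t _; rewrite lee_fin mulr_ge0.
  by apply/measurable_EFinP; exact: measurable_funM.
rewrite integral_cst// [X in (e%:E * X)%E](_ : _ = 1%E); last exact: probability_setT.
rewrite mule1; apply: leeD => //.
under eq_integral do rewrite EFinM.
rewrite ge0_integralZl_EFin//; last exact/measurable_EFinP.
by rewrite integral_indic// setIT.
Qed.

Lemma eq_law_expectation d (T : measurableType d) (P : probability T R)
    d' (T' : measurableType d') (Q : probability T' R) (z : T -> R) (z' : T' -> R)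
    (h : R -> R) (C : R) : measurable_fun setT z -> measurable_fun setT z' ->
  (forall A, measurable A -> P (z @^-1` A) = Q (z' @^-1` A)) ->
  measurable_fun setT h -> (forall x, `|h x| <= C) -> ('E_P[h \o z] = 'E_Q[h \o z'])%E.
Proof.
move=> mz mz' law mh hC; rewrite unlock.
have mhz : P.-integrable setT (EFin \o (h \o z)).
  by apply: (@bounded_integrable _ _ _ _ C) => [|t]; [exact: measurableT_comp|exact: hC].
have mhz' : Q.-integrable setT (EFin \o (h \o z')).
  by apply: (@bounded_integrable _ _ _ _ C) => [|t]; [exact: measurableT_comp|exact: hC].
have mh' : measurable_fun [set: measurableTypeR R] (EFin \o h) by exact/measurable_EFinP.
have -> : (\int[P]_t ((h \o z) t)%:E = \int[pushforward P z]_x (EFin \o h) x)%E.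
  by rewrite integral_pushforward.
have -> : (\int[Q]_t ((h \o z') t)%:E = \int[pushforward Q z']_x (EFin \o h) x)%E.
  by rewrite integral_pushforward.
by apply: (@eq_measure_integral _ _ _ _ (pushm Q mz') (pushm P mz)) => A mA _; exact: law.
Qed.

(** A continuous function is uniformly continuous near a compact piece of a
    curve. *)
Lemma continuous_uniform_curve (f : R * R -> R) (F : R -> R * R) (L e : R) :
  continuous f -> continuous F -> 0 < e ->
  exists2 de : R, 0 < de & forall z, `|z| <= L -> forall q, `|q - F z| < de -> `|f q - f (F z)| < e.
Proof.
move=> cf cF e0.
have : \forall de \near (0 : R)^'+, `[- L, L]%classic `<=`
    [set z | forall q, `|q - F z| < de -> `|f q - f (F z)| < e].
  have /compact_near_coveringP := @segment_compact R (- L) L.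
  move=> /(_ R (0 : R)^'+ (fun de z => forall q, `|q - F z| < de -> `|f q - f (F z)| < e)); apply.
  move=> x _; have e2 : 0 < e / 2 by rewrite divr_gt0.
  have /cvgrPdist_lt/(_ _ e2)/nbhs_ballP[r /= r0 hr] := cf (F x).
  have r2 : 0 < r / 2 by rewrite divr_gt0.
  have /cvgrPdist_lt/(_ _ r2) hF := cF x.
  near=> z de => q hq.
  have hz : `|F x - F z| < r / 2 by near: z.
  have hde : de < r / 2 by near: de; exact: nbhs_right_lt.
  have rball p : `|F x - p| < r -> `|f (F x) - f p| < e / 2.
    by move=> hp; apply: hr; rewrite -ball_normE.
  have h1 : `|f (F x) - f q| < e / 2.
    apply: rball; apply: (le_lt_trans (ler_distD (F z) _ _)); rewrite (distrC (F z)) [r]splitr.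
    by rewrite ltrD// (lt_trans hq).
  have h2 : `|f (F x) - f (F z)| < e / 2 by apply: rball; apply: (lt_trans hz); rewrite ltr_pdivrMr// ltr_pMr// ltr1n.
  apply: (le_lt_trans (ler_distD (f (F x)) _ _)); rewrite (distrC (f q)) [e]splitr.
  exact: ltrD.
rewrite near_withinE => /nbhs_ballP[r /= r0 hr]; exists (r / 2); first by rewrite divr_gt0.
move=> z zL; apply: (hr (r / 2)) => /=; last 2 first.
- by rewrite divr_gt0.
- by rewrite /= in_itv /= -ler_norml.
change (`|0 - r / 2| < r); rewrite sub0r normrN gtr0_norm ?divr_gt0//; lra.
Unshelve. all: by end_near. Qed.

(** The variables live on different spaces, but [zeta n] has the same law for
    all [n], so the expectations of [f (F (zeta n))] are all equal to their
    limit, and only the distance from [X n] to [F (zeta n)] matters. Uniform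
    continuity of [f] is available on the compact set to which [zeta n] is
    confined with high probability. *)
Lemma cvg_distribution_approx (d : nat -> measure_display)
    (T : forall n : nat, measurableType (d n)) (P : forall n, probability (T n) R)
    (X : forall n, T n -> R * R) (zeta : forall n, T n -> R) (F : R -> R * R)
    d' (T' : measurableType d') (Q : probability T' R) (z : {RV Q >-> R}) :
  (forall n, measurable_fun setT (X n)) -> (forall n, measurable_fun setT (zeta n)) ->
  continuous F -> measurable_fun setT F -> has_normal_law z 0 1 ->
  (forall n A, (0 < n)%N -> measurable A -> P n (zeta n @^-1` A) = normal_prob 0 1 A) ->
  (forall e : R, 0 < e -> P n [set t | e <= `|X n t - F (zeta n t)|] @[n --> \oo] --> 0%E) ->
  cvg_in_distribution P X Q (fun t => F (z t)).
Proof.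
move=> mX mzeta cF mF zlaw law happ.
split => // [|f cf [C hC]]; first exact: measurableT_comp.
have mf := continuous_measurable_pair cf.
have zlaw1 A : measurable A -> Q (z @^-1` A) = normal_prob 0 1 A.
  by move=> mA; have := zlaw A mA; rewrite sqrtr1.
have C0 : 0 <= C by apply: le_trans (hC (0, 0)).
have mFz n : measurable_fun setT (fun t => F (zeta n t)) by exact: measurableT_comp.
have mfX n : measurable_fun setT (f \o X n) by exact: measurableT_comp.
have mfF n : measurable_fun setT (f \o (fun t => F (zeta n t))) by exact: measurableT_comp.
have mBad n (e : R) : measurable [set t | e <= `|X n t - F (zeta n t)|].
  rewrite (_ : [set t | _] = [set t | e <= `|(X n t).1 - (F (zeta n t)).1|] `|`
     [set t | e <= `|(X n t).2 - (F (zeta n t)).2|]); last first.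
    apply/seteqP; split => t /=; rewrite norm_pair_ge => /orP //.
  have /measurable_fun_pairP[mX1 mX2] := mX n.
  have /measurable_fun_pairP[mF1 mF2] := mFz n.
  apply: measurableU; rewrite -[X in measurable X]setTI; apply: measurable_fun_ler => //;
  by apply: measurableT_comp => //; exact: measurable_funB.
have fin d0 (T0 : measurableType d0) (P0 : probability T0 R) (U : T0 -> R) :
    measurable_fun setT U -> (forall t, `|U t| <= C) -> ('E_P0[U] \is a fin_num)%E.
  move=> mU hU; rewrite unlock; apply: integrable_fin_num => //; exact: bounded_integrable hU.
have EF n : (0 < n)%N -> ('E_(P n)[f \o (fun t => F (zeta n t))] = 'E_Q[f \o (fun t => F (z t))])%E.
  move=> n0; apply: (@eq_law_expectation _ _ _ _ _ _ (zeta n) z (f \o F) C) => //.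
    by move=> A mA; rewrite law// zlaw1.
    exact: measurableT_comp.
  by move=> x; exact: hC.
have finQ := fin _ _ Q _ (measurableT_comp mf (measurableT_comp mF (measurable_funP z))) (fun t => hC (F (z t))).
set c := ('E_Q[_])%E in finQ EF *.
rewrite -(fineK finQ); apply/fine_cvgP; split.
  by near=> n; apply: (fin _ _ (P n)) => // t; exact: hC.
apply/cvgrPdist_le => e e0.
pose eta := e / (8 * (C + 1)).
have C10 : 0 < C + 1 by rewrite ltr_wpDl.
have eta0 : 0 < eta by rewrite divr_gt0// mulr_gt0.
have etaC : 2 * C * (eta + eta) <= e / 2.
  have -> : e / 2 = 2 * (C + 1) * (eta + eta) by rewrite /eta; field; rewrite gt_eqF.
  by rewrite ler_wpM2r ?addr_ge0 ?(ltW eta0)// ler_wpM2l// lerDl.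
have [L L0 hL] := normal_tail_small eta0.
have e20 : 0 < e / 2 by rewrite divr_gt0.
have [de de0 hde] := continuous_uniform_curve L cf cF e20.
have hnear := ereal_cvg0_near (happ de de0) eta0.
near=> n.
have n0 : (0 < n)%N by near: n; exists 1%N.
have hn : (P n [set t | (de <= `|X n t - F (zeta n t)|)%R] <= eta%:E)%E by near: n.
have mL : measurable [set x : R | L <= `|x|].
  by rewrite -[X in measurable X]setTI; apply: measurable_fun_ler.
have hn2 : (P n (zeta n @^-1` [set x | (L <= `|x|)%R]) <= eta%:E)%E by rewrite law.
have mzL : measurable (zeta n @^-1` [set x | L <= `|x|]).
  by rewrite -[X in measurable X]setTI; exact: mzeta.
pose Bad := [set t | de <= `|X n t - F (zeta n t)|] `|` (zeta n @^-1` [set x | L <= `|x|]).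
have mB : measurable Bad by exact: measurableU.
have hB : (P n Bad <= (eta + eta)%:E)%E.
  exact: (measureU_le mB (mBad n de) mzL (@subset_refl _ _) hn hn2).
have := expectation_near (P n) (C := C) (mfX n) (mfF n) (fun t => hC _) (fun t => hC _) mB (ltW e20).
rewrite EF// => /(_ _)/le_trans h.
have finX : ('E_(P n)[f \o X n] \is a fin_num)%E by apply: (fin _ _ (P n)) => // t; exact: hC.
rewrite -lee_fin distrC; move: h; rewrite -(fineK finX) -(fineK finQ) -EFinB /= => h.
apply: h => [t nB|].
  apply: ltW; apply: hde.
    by rewrite leNgt; apply/negP => h; apply: nB; right; exact: ltW.
  by rewrite ltNge; apply/negP => h; apply: nB; left.
apply: (@le_trans _ _ ((e / 2)%:E + (2 * C)%:E * (eta + eta)%:E)%E).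
  by apply: leeD => //; apply: lee_wpmul2l => //; rewrite lee_fin mulr_ge0.
by rewrite -EFinM -EFinD lee_fin [leRHS]splitr lerD2l.
Unshelve. all: by end_near. Qed.

End weak_convergence.

(** * Sequences of contractions *)

Section levels.
Context {R : realType}.

(** The extreme eigenvalues of the rank-two part after normalization, as a
    function of the standardized corner [z]: [al] is the limit of [sqrt r] and
    [be] that of [sqrt n], both in units of the normalization. All three
    regimes with a diverging order are instances. *)
Definition levels (al be z : R) : R * R := (top2 (al * z) be, - top2 (- (al * z)) be).

Lemma continuous_levels al be : continuous (levels al be).
Proof.
have c1 a : continuous (fun z : R => top2 (a * z) be : R).
  move=> z; apply: (@continuous_comp _ _ _ ( *%R a) (top2^~ be)); last exact: continuous_top2.
  exact: mulrl_continuous.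
move=> z; apply: (@cvg_pair _ _ _ _ (nbhs (top2 (al * z) be))
  (nbhs (- top2 (- (al * z)) be))); first exact: c1.
by apply: cvgN; rewrite -mulNr; under eq_fun do rewrite -mulNr; exact: c1.
Qed.

Lemma measurable_levels al be : measurable_fun setT (levels al be).
Proof.
apply: measurable_fun_pair.
  by apply: (measurableT_comp (measurable_top2 be)); exact: measurable_funM.
apply: measurableT_comp => //; apply: (measurableT_comp (measurable_top2 be)).
by apply: measurableT_comp => //; exact: measurable_funM.
Qed.

Lemma levels_xi c z : 0 < c -> levels (Num.sqrt c) 1 z = (xi c z, - (xi c z)^-1).
Proof.
move=> c0; have E : top2 (Num.sqrt c * z) 1 = xi c z.
  by rewrite /top2 /xi exprMn sqr_sqrtr ?(ltW c0)// expr1n mulr1.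
by rewrite /levels top2_opp E.
Qed.

Lemma levels_max z : levels 1 0 z = (Num.max z 0, - Num.max (- z) 0).
Proof. by rewrite /levels !top2_max mul1r. Qed.

Lemma levels_01 z : levels 0 1 z = (1, - 1).
Proof. by rewrite /levels mul0r oppr0 top2_01. Qed.

End levels.

Section sequence.
Unset Implicit Arguments.
Context {R : realType}.
Variables (d : nat -> measure_display) (T : forall n : nat, measurableType (d n))
  (P : forall n : nat, probability (T n) R)
  (r : nat -> nat) (w : forall n : nat, 'rV[R]_n)
  (G : forall n : nat, (r n).-tuple 'I_n -> {RV (P n) >-> R})
  (M : forall n : nat, T n -> 'M[R]_n).
Hypotheses (hr : forall n : nat, (0 < n)%N -> (3 <= r n)%N)
  (hw : forall n : nat, (0 < n)%N -> \sum_(i < n) w n ord0 i ^+ 2 = 1)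
  (hG : forall n : nat, (0 < n)%N -> GOTE (G n))
  (hM : forall (n : nat) (t : T n), M n t = tensor_contraction (fun k => G n k t) (w n)).
Set Implicit Arguments.

Let hw1 n : (0 < n)%N -> dotr (w n) (w n) = 1.
Proof. by move=> n0; rewrite dotrE -(hw _ n0); apply: eq_bigr => i _; rewrite expr2. Qed.

Let hr2 n : (0 < n)%N -> (2 <= r n)%N.
Proof. by move=> /hr; exact: ltnW. Qed.

Lemma measurable_entries n i j : measurable_fun setT (fun t => M n t i j).
Proof.
have -> : (fun t => M n t i j) = (fun t => \sum_(k : (r n).-tuple 'I_n)
    if take 2 k == [:: i; j] then G n k t * \prod_(l <- drop 2 k) w n ord0 l else 0).
  by apply/funext => t; rewrite hM mxE; exact: big_mkcond.
by apply: measurable_sum => k; case: (take 2 k == [:: i; j]) => //; apply: measurable_funM.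
Qed.

Lemma scaled_trmx n s t : (0 < n)%N -> (s *: M n t)^T = s *: M n t.
Proof. by move=> n0; rewrite hM; apply: contraction_trmx; [exact: hr2|exact: hG]. Qed.

Lemma measurable_lambda_scaled n s : (0 < n)%N ->
  measurable_fun setT (fun t => lambda_max (s *: M n t)).
Proof.
move=> n0; apply: measurable_lambda_max => // [t|i j]; first exact: scaled_trmx.
have -> : (fun t => (s *: M n t) i j) = (fun t => s * M n t i j) by apply/funext => t; rewrite mxE.
by apply: measurable_funM => //; exact: measurable_entries.
Qed.

(** The signs [1] and [-1] make the two eigenvalues instances of the same
    statement about the scaled matrix. *)
Lemma extreme_eigenvaluesE n s t :
  extreme_eigenvalues s (M n t) = (lambda_max (1 *: M n t) / s, - (lambda_max (-1 *: M n t) / s)).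
Proof. by rewrite /extreme_eigenvalues lambda_minE scale1r scaleN1r mulNr. Qed.

Lemma measurable_extreme n s : measurable_fun setT (fun t => extreme_eigenvalues s (M n t)).
Proof.
have [n0|] := posnP n.
  have -> : (fun t => extreme_eigenvalues s (M n t)) = cst (extreme_eigenvalues s (0 : 'M[R]_n)).
    by apply/funext => t /=; congr extreme_eigenvalues; apply/matrixP => -[i hi]; exfalso; move: hi; rewrite n0.
  exact: measurable_cst.
move=> n0; under eq_fun do rewrite extreme_eigenvaluesE.
apply: measurable_fun_pair; last apply: measurableT_comp => //;
by apply: measurable_funM => //; exact: measurable_lambda_scaled.
Qed.

Lemma fixed_order_cvg r0 : (3 <= r0)%N -> (forall n, (0 < n)%N -> r n = r0) ->
  cvg_in_probability P (fun n t => extreme_eigenvalues (Num.sqrt n%:R) (M n t))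
    (varpi R r0, - varpi R r0).
Proof.
move=> r03 rE; split => [n|eps eps0]; first exact: measurable_extreme.
have om0 := varpi_gt0 (R := R) r03; set om := varpi R r0 in om0 *.
pose e := Num.min eps om / 2.
have e0 : 0 < e by rewrite divr_gt0// lt_min eps0.
have eeps : e < eps.
  by rewrite ltr_pdivrMr// (le_lt_trans (_ : _ <= eps)) ?ge_min ?lexx// ltr_pMr// ltr1n.
have eom : e < om.
  by rewrite ltr_pdivrMr// (le_lt_trans (_ : _ <= om)) ?ge_min ?lexx ?orbT// ltr_pMr// ltr1n.
have up : om < om + e by rewrite ltrDl.
have lo0 : 0 < om - e by rewrite subr_gt0.
have lo : om - e < om by rewrite gtrBl.
have [A1 [c1 [c10 hup]]] := fixed_order_upper r03 up.
have [A2 [c2 [c20 hlo]]] := fixed_order_lower r03 lo0 lo.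
pose D n s := [set t | (om + e) * Num.sqrt n%:R < lambda_max (s *: M n t)] `|`
  [set t | lambda_max (s *: M n t) <= (om - e) * Num.sqrt n%:R].
have mD1 n s : (0 < n)%N -> measurable [set t | (om + e) * Num.sqrt n%:R < lambda_max (s *: M n t)].
  move=> n0; rewrite -[X in measurable X]setTI; apply: measurable_fun_ltr => //.
  exact: measurable_lambda_scaled.
have mD2 n s : (0 < n)%N -> measurable [set t | lambda_max (s *: M n t) <= (om - e) * Num.sqrt n%:R].
  move=> n0; rewrite -[X in measurable X]setTI; apply: measurable_fun_ler => //.
  exact: measurable_lambda_scaled.
have mD n s : (0 < n)%N -> measurable (D n s).
  by move=> n0; apply: measurableU; [exact: mD1|exact: mD2].
have hM' n s t : s *: M n t = s *: tensor_contraction (fun k => G n k t) (w n) by rewrite hM.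
have hD n s : (0 < n)%N -> s ^+ 2 = 1 -> (P n (D n s) <=
    (A1 * n%:R * expR (- (c1 * n%:R)) + A2 * n%:R * expR (- (c2 * n%:R)))%:E)%E.
  move=> n0 s2; apply: (measureU_le (mD n s n0) (mD1 n s n0) (mD2 n s n0)) => //.
    have := hM' n s; have := hG n n0; move: (G n); rewrite (rE n n0) => Gn hGn hMn.
    rewrite (_ : [set t | _] = [set t | (om + e) * Num.sqrt n%:R <
        lambda_max (s *: tensor_contraction (fun k => Gn k t) (w n))]).
      apply: hup => //; exact: hw1.
    by apply/seteqP; split => t /=; rewrite hMn.
  have := hM' n s; have := hG n n0; move: (G n); rewrite (rE n n0) => Gn hGn hMn.
  rewrite (_ : [set t | _] = [set t | lambda_max (s *: tensor_contraction (fun k => Gn k t) (w n)) <=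
      (om - e) * Num.sqrt n%:R]).
    apply: hlo => //; exact: hw1.
  by apply/seteqP; split => t /=; rewrite hMn.
have close n s t : (0 < n)%N -> ~ D n s t -> `|lambda_max (s *: M n t) / Num.sqrt n%:R - om| < eps.
  move=> n0 nD; have sn0 : 0 < Num.sqrt n%:R :> R by rewrite sqrtr_gt0 ltr0n.
  apply: le_lt_trans eeps; rewrite ler_distl; apply/andP; split.
    by rewrite ler_pdivlMr// leNgt; apply/negP => h; apply: nD; right; exact: ltW.
  by rewrite ler_pdivrMr// leNgt; apply/negP => h; apply: nD; left.
apply: ereal_cvg0 => // eta eta0.
have eta4 : 0 < eta / 4 by rewrite divr_gt0.
have /cvgr0Pnorm_le/(_ _ eta4) lim1 := exp_rate_cvg0 A1 c10.
have /cvgr0Pnorm_le/(_ _ eta4) lim2 := exp_rate_cvg0 A2 c20.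
near=> n; have n0 : (0 < n)%N by near: n; exists 1%N.
have h1 : `|A1 * n%:R * expR (- (c1 * n%:R))| <= eta / 4 by near: n.
have h2 : `|A2 * n%:R * expR (- (c2 * n%:R))| <= eta / 4 by near: n.
have hDe s : s ^+ 2 = 1 -> (P n (D n s) <= (eta / 2)%:E)%E.
  move=> s2; apply: (le_trans (hD n s n0 s2)); rewrite lee_fin.
  have -> : eta / 2 = eta / 4 + eta / 4 by field.
  by apply: lerD; [exact: le_trans (ler_norm _) h1|exact: le_trans (ler_norm _) h2].
rewrite [eta]splitr.
apply: (measureU_le _ (mD n 1 n0) (mD n (-1) n0)).
- rewrite (_ : [set t | _] =
    [set t | eps <= `|(extreme_eigenvalues (Num.sqrt n%:R) (M n t)).1 - om|] `|`
    [set t | eps <= `|(extreme_eigenvalues (Num.sqrt n%:R) (M n t)).2 - - om|]); last first.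
    by apply/seteqP; split => t /=; rewrite norm_pair_ge => /orP.
  have /measurable_fun_pairP[m1 m2] := @measurable_extreme n (Num.sqrt n%:R).
  apply: measurableU; rewrite -[X in measurable X]setTI; apply: measurable_fun_ler => //;
  by apply: measurableT_comp => //; exact: measurable_funB.
- move=> t /=; rewrite norm_pair_ge extreme_eigenvaluesE /=.
  apply: contraPP => /not_orP[nD1 nD2]; apply/negP; rewrite negb_or -!ltNge close//=.
  by rewrite -opprD normrN close.
- by apply: hDe; rewrite expr1n.
- by apply: hDe; rewrite sqrrN expr1n.
Unshelve. all: by end_near. Qed.

Definition corner n t : R := bform (M n t) (w n) (w n) / Num.sqrt (r n)%:R.
Arguments corner : clear implicits.

Lemma measurable_corner n : measurable_fun setT (corner n).
Proof. by apply: measurable_funM => //; apply: measurable_bform => i j; exact: measurable_entries. Qed.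

Lemma corner_normal n A : (0 < n)%N -> measurable A -> P n (corner n @^-1` A) = normal_prob 0 1 A.
Proof.
move=> n0 mA; rewrite -(corner_law (hr2 n0) (hG n n0) (hw1 n0) mA).
by congr (P n _); apply/seteqP; split => t; rewrite /corner /= hM.
Qed.

(** Since [r] diverges, the block is negligible by [extreme_tail]. The rank-two
    part depends continuously on the ratios [sqrt r / D] and [sqrt n / D],
    uniformly on the event that the corner is bounded by [L], whose probability
    is close to one for all [n] at once. *)
Lemma levels_approx (D : nat -> R) (al be : R) :
  (forall n, (0 < n)%N -> 0 < D n) ->
  (r n)%:R^-1 @[n --> \oo] --> (0 : R) ->
  Num.sqrt (r n)%:R / D n @[n --> \oo] --> al ->
  Num.sqrt n%:R / D n @[n --> \oo] --> be ->
  forall e : R, 0 < e ->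
  P n [set t | e <= `|extreme_eigenvalues (D n) (M n t) - levels al be (corner n t)|]
    @[n --> \oo] --> 0%E.
Proof.
move=> D0 roo hal hbe e e0; apply: ereal_cvg0 => // eta eta0.
have eta2 : 0 < eta / 2 by rewrite divr_gt0.
have eta4 : 0 < eta / 2 / 2 by rewrite divr_gt0.
have [L L0 hL] := normal_tail_small eta2.
have B0 : 0 < `|be| + 1 by rewrite ltr_wpDl.
(* the error (4 gap + rho) sqrt n / D is at most 2 rho (|be| + 1) once gap is
   below rho / 4 *)
pose rho := Num.min (1 / 2) (e / (8 * (`|be| + 1))).
have rho0 : 0 < rho by rewrite lt_min !divr_gt0// mulr_gt0.
have rho1 : rho < 1 by rewrite gt_min; apply/orP; left; lra.
have rhoe : 2 * rho * (`|be| + 1) <= e / 4.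
  have : rho <= e / (8 * (`|be| + 1)) by rewrite ge_min lexx orbT.
  by rewrite ler_pdivlMr ?mulr_gt0// => h; lra.
have rho01 : 0 < rho < 1 by rewrite rho0.
have [A [c [c0 htail]]] := @extreme_tail R rho rho01.
have e4 : 0 < e / 4 by rewrite divr_gt0.
have eL : 0 < e / (4 * L) by rewrite divr_gt0// mulr_gt0.
have rho2 : 0 < (rho / 4) ^+ 2 / 2 by rewrite divr_gt0// exprn_gt0// divr_gt0.
have /cvgr0Pnorm_le/(_ _ eta4) lim1 := exp_rate_cvg0 A c0.
have /cvgrPdist_le/(_ _ eL) lim2 := hal.
have /cvgrPdist_lt/(_ _ e4) lim3 := hbe.
have /cvgrPdist_le/(_ _ ltr01) lim4 := hbe.
have /cvgr0Pnorm_le/(_ _ rho2) lim5 := roo.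
near=> n; have n0 : (0 < n)%N by near: n; exists 1%N.
have h1 : `|A * n%:R * expR (- (c * n%:R))| <= eta / 2 / 2 by near: n.
have h2 : `|al - Num.sqrt (r n)%:R / D n| <= e / (4 * L) by near: n.
have h3 : `|be - Num.sqrt n%:R / D n| < e / 4 by near: n.
have h4 : `|be - Num.sqrt n%:R / D n| <= 1 by near: n.
have h5 : `|(r n)%:R^-1| <= (rho / 4) ^+ 2 / 2 by near: n.
set aln := Num.sqrt (r n)%:R / D n in h2.
set ben := Num.sqrt n%:R / D n in h3 h4.
have Dn0 := D0 n n0; have r3 := hr n n0.
have rp : 0 < (r n)%:R :> R by rewrite ltr0n (leq_trans _ r3).
have gap : gap_scale (r n) <= rho / 4.
  have g0 : 0 < gap_scale (r n) :> R := gap_scale_gt0 (hr2 n0).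
  rewrite -(@ler_pXn2r _ 2)// ?nnegrE ?(ltW g0) ?divr_ge0 ?(ltW rho0)//.
  rewrite gap_scale_sqr ?hr2//.
  rewrite ger0_norm ?invr_ge0 ?(ltW rp)// in h5.
  have r1 : (r n)%:R <= 2 * ((r n)%:R - 1) :> R.
    have : 3%:R <= (r n)%:R :> R by rewrite ler_nat.
    by move: ((r n)%:R : R) => x hx; lra.
  have rp1 : 0 < (r n)%:R - 1 :> R by rewrite subr_gt0 ltr1n hr2.
  apply: (@le_trans _ _ (2 * (r n)%:R^-1)).
    by rewrite -[leLHS]mul1r ler_pdivrMr// mulrAC ler_pdivlMr// mul1r.
  by rewrite mulrC -ler_pdivlMr.
have ben0 : 0 <= ben by apply: divr_ge0; [exact: sqrtr_ge0|exact: ltW].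
have benB : ben <= `|be| + 1.
  have := ler_norm (- (be - ben)); rewrite normrN => h.
  by have := ler_norm be; lra.
have thr : (4 * gap_scale (r n) + rho) * ben <= e / 4.
  apply: le_trans rhoe; apply: ler_pM => //.
    by rewrite addr_ge0 ?(ltW rho0)// mulr_ge0// ltW// gap_scale_gt0 ?hr2.
  by move: gap; move: (gap_scale (r n)) => x; lra.
pose E s := [set t | (4 * gap_scale (r n) + rho) * Num.sqrt n%:R <
  `|lambda_max (s *: M n t) - top2 (bform (s *: M n t) (w n) (w n)) (Num.sqrt n%:R)|].
have mbf s : measurable_fun setT (fun t => bform (s *: M n t) (w n) (w n)).
  apply: measurable_bform => i j.
  have -> : (fun t => (s *: M n t) i j) = (fun t => s * M n t i j) by apply/funext => t; rewrite mxE.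
  by apply: measurable_funM => //; exact: measurable_entries.
have mE s : measurable (E s).
  rewrite -[X in measurable X]setTI; apply: measurable_fun_ltr => //.
  apply: measurableT_comp => //; apply: measurable_funB; first exact: measurable_lambda_scaled.
  exact: (measurableT_comp (measurable_top2 _) (mbf s)).
have hE s : s ^+ 2 = 1 -> (P n (E s) <= (eta / 2 / 2)%:E)%E.
  move=> s2; apply: (@le_trans _ _ (A * n%:R * expR (- (c * n%:R)))%:E); last first.
    by rewrite lee_fin; exact: le_trans (ler_norm _) h1.
  rewrite (_ : E s = [set t | let N := s *: tensor_contraction (fun k => G n k t) (w n) in
      (4 * gap_scale (r n) + rho) * Num.sqrt n%:R <
      `|lambda_max N - top2 (bform N (w n) (w n)) (Num.sqrt n%:R)|]).
    by apply: htail => //; [exact: hG|exact: hw1].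
  by apply/seteqP; split => t; rewrite /E /= hM.
have close s t : s ^+ 2 = 1 -> ~ E s t -> `|corner n t| < L ->
    `|lambda_max (s *: M n t) / D n - top2 (al * (s * corner n t)) be| < e.
  move=> s2 nE cL.
  have bE : bform (s *: M n t) (w n) (w n) / D n = aln * (s * corner n t).
    rewrite bformZ /corner /aln; field.
    by rewrite !gt_eqF// sqrtr_gt0.
  have tE : top2 (bform (s *: M n t) (w n) (w n)) (Num.sqrt n%:R) / D n = top2 (aln * (s * corner n t)) ben.
    by rewrite -bE /ben mulrC -top2_scale ?invr_ge0 ?(ltW Dn0)// ![(D n)^-1 * _]mulrC.
  apply: (le_lt_trans (ler_distD (top2 (aln * (s * corner n t)) ben) _ _)).
  have k1 : `|lambda_max (s *: M n t) / D n - top2 (aln * (s * corner n t)) ben| <= e / 4.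
    rewrite -tE -mulrBl normrM (gtr0_norm (_ : 0 < (D n)^-1)) ?invr_gt0//.
    apply: le_trans thr; rewrite /ben mulrA ler_pM2r ?invr_gt0// leNgt; apply/negP => h.
    exact: nE.
  have s1 : `|s| = 1.
    by apply/eqP; rewrite -(@eqrXn2 _ 2)// real_normK ?num_real// s2 expr1n.
  have k2 : `|top2 (aln * (s * corner n t)) ben - top2 (al * (s * corner n t)) be| <=
      `|aln - al| * `|corner n t| + `|be - ben|.
    by apply: (le_trans (top2_lip _ _ _ _)); rewrite -mulrBl 2!normrM s1 mul1r [`|ben - be|]distrC.
  have k3 : `|aln - al| * `|corner n t| <= e / 4.
    apply: (@le_trans _ _ (e / (4 * L) * L)); last by rewrite le_eqVlt; apply/orP; left; apply/eqP; field; rewrite gt_eqF.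
    by apply: ler_pM => //; [rewrite distrC|exact: ltW].
  apply: (le_lt_trans (lerD k1 (le_trans k2 (lerD k3 (lexx _))))).
  by move: h3; move: `|be - ben| => x; lra.
have mL : measurable (corner n @^-1` [set x | L <= `|x|]).
  rewrite -[X in measurable X]setTI; apply: measurable_corner => //.
  by rewrite -[X in measurable X]setTI; apply: measurable_fun_ler.
have mX : measurable [set x : R | L <= `|x|].
  by rewrite -[X in measurable X]setTI; apply: measurable_fun_ler.
have hLn : (P n (corner n @^-1` [set x | (L <= `|x|)%R]) <= (eta / 2)%:E)%E by rewrite corner_normal.
have hEE : (P n (E 1%R `|` E (-1)%R) <= (eta / 2)%:E)%E.
  rewrite [eta / 2]splitr; apply: (measureU_le _ (mE 1) (mE (-1)) (@subset_refl _ _)).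
  - exact: measurableU.
  - by apply: hE; rewrite expr1n.
  - by apply: hE; rewrite sqrrN expr1n.
rewrite [eta]splitr.
apply: (measureU_le _ (measurableU _ _ (mE 1) (mE (-1))) mL _ hEE hLn).
- rewrite (_ : [set t | _] =
    [set t | e <= `|(extreme_eigenvalues (D n) (M n t)).1 - (levels al be (corner n t)).1|] `|`
    [set t | e <= `|(extreme_eigenvalues (D n) (M n t)).2 - (levels al be (corner n t)).2|]); last first.
    by apply/seteqP; split => t /=; rewrite norm_pair_ge => /orP.
  have /measurable_fun_pairP[m1 m2] := @measurable_extreme n (D n).
  have /measurable_fun_pairP[l1 l2] := measurableT_comp (measurable_levels al be) (@measurable_corner n).
  apply: measurableU; rewrite -[X in measurable X]setTI; apply: measurable_fun_ler => //;
  by apply: measurableT_comp => //; exact: measurable_funB.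
move=> t /=; rewrite norm_pair_ge extreme_eigenvaluesE /=.
apply: contraPP => /not_orP[/not_orP[nE1 nE2] /negP]; rewrite -ltNge => cL.
apply/negP; rewrite negb_or -!ltNge.
have := close 1 t (expr1n _ _) nE1 cL; rewrite mul1r => ->.
have := close (-1) t _ nE2 cL; rewrite sqrrN expr1n mulN1r mulrN => /(_ erefl).
by rewrite -opprD normrN.
Unshelve. all: by end_near. Qed.

End sequence.

Lemma sqrt_ratio_cvg (R : realType) (u v : nat -> R) (c : R) :
  (forall n, 0 <= u n) -> (forall n, 0 <= v n) -> u n / v n @[n --> \oo] --> c ->
  Num.sqrt (u n) / Num.sqrt (v n) @[n --> \oo] --> Num.sqrt c.
Proof.
move=> u0 v0 h.
have -> : (fun n => Num.sqrt (u n) / Num.sqrt (v n)) = Num.sqrt \o (fun n => u n / v n).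
  by apply/funext => n /=; rewrite sqrtrM// sqrtrV.
exact: (cvg_comp _ _ h (@sqrt_continuous R c)).
Qed.

(** In the regimes where [r] is at least of the order of [n], the order
    diverges because [n] does. *)
Lemma inv_order_cvg0 (R : realType) (r : nat -> nat) (l : R) :
  n%:R / (r n)%:R @[n --> \oo] --> l -> (r n)%:R^-1 @[n --> \oo] --> (0 : R).
Proof.
move=> h; have h0 : (n%:R / (r n)%:R) * n%:R^-1 @[n --> \oo] --> (0 : R).
  by rewrite -(mulr0 l); exact: cvgM h (@invn_cvg0 R).
suff hn : \forall n \near \oo, (n%:R / (r n)%:R) * n%:R^-1 = (r n)%:R^-1 :> R.
  apply: cvg_trans h0; exact: near_eq_cvg.
near=> n; have n0 : n%:R != 0 :> R.
  by rewrite pnatr_eq0 -lt0n; near: n; exists 1%N.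
by rewrite mulrAC mulfV// mul1r.
Unshelve. all: by end_near. Qed.

Theorem theorem2p1 (R : realType) (d : nat -> measure_display)
    (T : forall n : nat, measurableType (d n))
    (P : forall n : nat, probability (T n) R)
    (r : nat -> nat) (w : forall n : nat, 'rV[R]_n)
    (G : forall n : nat, (r n).-tuple 'I_n -> {RV (P n) >-> R})
    (M : forall n : nat, T n -> 'M[R]_n)
    (hr : forall n : nat, (0 < n)%N -> (3 <= r n)%N)
    (hw : forall n : nat, (0 < n)%N -> \sum_(i < n) w n ord0 i ^+ 2 = 1)
    (hG : forall n : nat, (0 < n)%N -> GOTE (G n))
    (hM : forall (n : nat) (t : T n),
      M n t = tensor_contraction (fun k => G n k t) (w n)) :
  [/\ (* (a) *)
      forall r0 : nat, (3 <= r0)%N ->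
        (forall n : nat, (0 < n)%N -> r n = r0) ->
        cvg_in_probability P
          (fun n t => extreme_eigenvalues (Num.sqrt n%:R) (M n t))
          (varpi R r0, - varpi R r0),
      (* (b) *)
      much_less (fun _ : nat => 1 : R) (fun n => (r n)%:R) ->
        much_less (fun n => (r n)%:R : R) (fun n => n%:R) ->
        cvg_in_probability P
          (fun n t => extreme_eigenvalues (Num.sqrt n%:R) (M n t))
          (1, - 1),
      (* (c) *)
      forall c : R, 0 < c ->
        (r n)%:R / n%:R @[n --> \oo] --> c ->
        forall (d' : measure_display) (T' : measurableType d')
          (Q : probability T' R) (zeta : {RV Q >-> R}),
          has_normal_law zeta 0 1 ->
          cvg_in_distribution P
            (fun n t => extreme_eigenvalues (Num.sqrt n%:R) (M n t))
            Q (fun t => (xi c (zeta t), - (xi c (zeta t))^-1))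
    & (* (d) *)
      (r n)%:R / n%:R @[n --> \oo] --> (+oo : set_system R) ->
        forall (d' : measure_display) (T' : measurableType d')
          (Q : probability T' R) (zeta : {RV Q >-> R}),
          has_normal_law zeta 0 1 ->
          cvg_in_distribution P
            (fun n t => extreme_eigenvalues (Num.sqrt (r n)%:R) (M n t))
            Q (fun t => (Num.max (zeta t) 0, - Num.max (- zeta t) 0))].
Proof.
have ratio_self (D : nat -> R) : (forall n, (0 < n)%N -> 0 < D n) -> D n / D n @[n --> \oo] --> (1 : R).
  move=> D0; apply: cvg_near_cst; near=> n; rewrite mulfV// gt_eqF// D0//.
  by near: n; exists 1%N.
have sn0 n : (0 < n)%N -> 0 < Num.sqrt n%:R :> R by move=> n0; rewrite sqrtr_gt0 ltr0n.
have sr0 n : (0 < n)%N -> 0 < Num.sqrt (r n)%:R :> R.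
  by move=> n0; rewrite sqrtr_gt0 ltr0n (leq_trans _ (hr n n0)).
have mX (D : nat -> R) n : measurable_fun setT (fun t => extreme_eigenvalues (D n) (M n t)).
  exact: (measurable_extreme hr hG hM).
have approx := levels_approx hr hw hG hM.
have in_dist (D : nat -> R) (al be : R) :
    (forall e : R, 0 < e -> P n [set t | e <= `|extreme_eigenvalues (D n) (M n t) -
       levels al be (corner r w M t)|] @[n --> \oo] --> 0%E) ->
  forall (d' : measure_display) (T' : measurableType d') (Q : probability T' R)
    (zeta : {RV Q >-> R}), has_normal_law zeta 0 1 ->
    cvg_in_distribution P (fun n t => extreme_eigenvalues (D n) (M n t)) Q
      (fun t => levels al be (zeta t)).
  move=> h d' T' Q zeta hz.
  apply: (cvg_distribution_approx (mX D) _ (@continuous_levels R al be) _ hz _ h).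
  - by move=> n; exact: (measurable_corner hM).
  - exact: measurable_levels.
  - by move=> n A; exact: (corner_normal hr hw hG hM).
split.
- by move=> r0 r03 rE; exact: (fixed_order_cvg hr hw hG hM r03 rE).
- move=> r1 rn; split => [n|e e0]; first exact: (mX (fun n => Num.sqrt n%:R)).
  have roo : (r n)%:R^-1 @[n --> \oo] --> (0 : R).
    by move: r1; rewrite /much_less; under eq_fun do rewrite mul1r.
  have ral : Num.sqrt (r n)%:R / Num.sqrt n%:R @[n --> \oo] --> (0 : R).
    by have := sqrt_ratio_cvg (fun n => ler0n R (r n)) (fun n => ler0n R n) rn; rewrite sqrtr0.
  have h := approx (fun n => Num.sqrt n%:R) 0 1 sn0 roo ral (ratio_self _ sn0) e e0.
  rewrite (_ : (fun n => _) = (fun n => P n [set t |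
    e <= `|extreme_eigenvalues (Num.sqrt n%:R) (M n t) - levels 0 1 (corner r w M t)|])) //.
  by apply/funext => n; congr (P n _); apply/seteqP; split => t /=; rewrite levels_01.
- move=> c c0 rn d' T' Q zeta hz.
  rewrite (_ : (fun t => _) = (fun t => levels (Num.sqrt c) 1 (zeta t))); last first.
    by apply/funext => t; rewrite levels_xi.
  have nr : n%:R / (r n)%:R @[n --> \oo] --> c^-1.
    have -> : (fun n => n%:R / (r n)%:R) = (fun n => ((r n)%:R / n%:R)^-1) :> (nat -> R).
      by apply/funext => n; rewrite invf_div.
    by apply: cvgV => //; rewrite gt_eqF.
  apply: (in_dist (fun n => Num.sqrt n%:R)) => //; apply: approx => //.
  + exact: inv_order_cvg0 nr.
  + exact: sqrt_ratio_cvg rn.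
  + exact: ratio_self.
move=> rn d' T' Q zeta hz.
rewrite (_ : (fun t => _) = (fun t => levels 1 0 (zeta t))); last first.
  by apply/funext => t; rewrite levels_max.
have nr : n%:R / (r n)%:R @[n --> \oo] --> (0 : R).
  have -> : (fun n => n%:R / (r n)%:R) = (fun n => ((r n)%:R / n%:R)^-1) :> (nat -> R).
    by apply/funext => n /=; rewrite invf_div.
  apply: (gtr0_cvgV0 (f := fun n => (r n)%:R / n%:R) _).2 => //; near=> n.
  have n0 : (0 < n)%N by near: n; exists 1%N.
  by rewrite divr_gt0 ?ltr0n// (leq_trans _ (hr n n0)).
apply: (in_dist (fun n => Num.sqrt (r n)%:R)) => //; apply: approx => //.
+ exact: inv_order_cvg0 nr.
+ exact: ratio_self.
+ by have := sqrt_ratio_cvg (fun n => ler0n R n) (fun n => ler0n R (r n)) nr; rewrite sqrtr0.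
Unshelve. all: by end_near. Qed.
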